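(* Let $a>0$ and let $\widetilde{\mathbf V}=\{u\in H^1_0(\mathbb H^2(-a^2)): d^*u=0\}$, where $d^*u$ is understood in the weak sense. Then $\mathbb V=\widetilde{\mathbf V}$.
   Context: $\mathbb H^2(-a^2)$ is the two-dimensional hyperbolic space of constant curvature $-a^2$ with metric $g$, volume form $\mathrm{Vol}$, Levi-Civita connection $\overline\nabla$, induced tensor metric $\overline g$; $d^*$ is the formal $L^2$-adjoint of $d$. $\mathrm{Def}\,u=\frac12(\overline\nabla u+(\overline\nabla u)^T)$, understood weakly for $L^2$ 1-forms. $\|u\|_{H^1}^2=\|u\|_{L^2}^2+2\|\mathrm{Def}\,u\|_{L^2}^2$; $H^1_0$ = completion of smooth compactly supported 1-forms in this norm. For an $L^2$ 1-form $u$, $d^*u=w\in L^2$ weakly means $\int w\phi\,\mathrm{Vol}=\int g(u,d\phi)\mathrm{Vol}$ for all $\phi\in C^\infty_c$. $\Lambda^1_{c,\sigma}$ = smooth compactly supported 1-forms $\theta$ with $d^*\theta=0$; $\mathbf V$ = closure of $\Lambda^1_{c,\sigma}$ in $\|\cdot\|_{H^1}$; $\mathbb F=\{dF\in L^2:F\text{ harmonic on }\mathbb H^2(-a^2)\}$; $\mathbb V=\mathbf V\oplus\mathbb F$. *)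

(* Defs.v *)
(* Model of H^2(-a^2): the upper half-plane
   H = {(x,y) : y > 0} with metric g = (dx^2 + dy^2) / (a^2 y^2). *)
From HB Require Import structures.
From mathcomp Require Import all_boot all_order all_algebra.
From mathcomp Require Import all_classical all_reals all_analysis.
Set Implicit Arguments. Unset Strict Implicit. Unset Printing Implicit Defensive.
Import Order.TTheory GRing.Theory Num.Theory.
Import numFieldNormedType.Exports.
Local Open Scope classical_set_scope.
Local Open Scope ring_scope.

Section Hyp.
Variable R : realType.

Definition Hp : set (R * R) := [set p | 0 < p.2].

Definition leb2 := (@lebesgue_measure R \x @lebesgue_measure R)%E.

Definition px (f : R * R -> R) (p : R * R) : R := derive1 (fun t => f (t, p.2)) p.1.
Definition py (f : R * R -> R) (p : R * R) : R := derive1 (fun t => f (p.1, t)) p.2.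

Fixpoint Ck_on (n : nat) (f : R * R -> R) : Prop :=
  match n with
  | 0%N => forall p, Hp p -> {for p, continuous f}
  | k.+1 => (forall p, Hp p ->
               derivable (fun t => f (t, p.2)) p.1 1 /\
               derivable (fun t => f (p.1, t)) p.2 1)
            /\ Ck_on k f /\ Ck_on k (px f) /\ Ck_on k (py f)
  end.
Definition smooth_on (f : R * R -> R) : Prop := forall n, Ck_on n f.

Definition test_fun (f : R * R -> R) : Prop :=
  smooth_on f /\ exists K : set (R * R),
    compact K /\ K `<=` Hp /\ (forall p, ~ K p -> f p = 0).

(* 1-forms u = u1 dx + u2 dy are represented by u : R*R -> R*R, u p = (u1 p, u2 p) *)
Definition oneform := R * R -> R * R.
Definition fm1 (u : oneform) : R * R -> R := fun p => (u p).1.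
Definition fm2 (u : oneform) : R * R -> R := fun p => (u p).2.

Definition test_form (u : oneform) : Prop := test_fun (fm1 u) /\ test_fun (fm2 u).

(* |u|_g^2 Vol = (u1^2 + u2^2) dx dy *)
Definition formsq (u : oneform) (p : R * R) : R := (fm1 u p) ^+ 2 + (fm2 u p) ^+ 2.

Definition L2fun (f : R * R -> R) : Prop :=
  measurable_fun Hp f /\ (\int[leb2]_(p in Hp) ((f p) ^+ 2)%:E < +oo)%E.
Definition L2form (u : oneform) : Prop := L2fun (fm1 u) /\ L2fun (fm2 u).

(* symmetric 2-tensors (components in the basis dx, dy) *)
Record sym2 := Sym2 { s11 : R * R -> R; s12 : R * R -> R; s22 : R * R -> R }.

(* |D|_{gbar}^2 Vol = a^2 y^2 (D11^2 + 2 D12^2 + D22^2) dx dy *)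
Definition tensq (a : R) (D : sym2) (p : R * R) : R :=
  a ^+ 2 * p.2 ^+ 2 * ((s11 D p) ^+ 2 + 2 * (s12 D p) ^+ 2 + (s22 D p) ^+ 2).

Definition L2sym (a : R) (D : sym2) : Prop :=
  [/\ measurable_fun Hp (s11 D), measurable_fun Hp (s12 D),
      measurable_fun Hp (s22 D) &
      (\int[leb2]_(p in Hp) (tensq a D p)%:E < +oo)%E].

(* Christoffel symbols of g: Gamma^2_11 = 1/y, Gamma^1_12 = -1/y,
   Gamma^2_22 = -1/y, others 0.  Hence
   Def u = sym(partial u) - Gamma u :
     (Def u)_11 = d_x u1 - u2/y,
     (Def u)_12 = (d_y u1 + d_x u2)/2 + u1/y,
     (Def u)_22 = d_y u2 + u2/y. *)
Definition Def_smooth (u : oneform) : sym2 :=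
  Sym2 (fun p => px (fm1 u) p - fm2 u p / p.2)
       (fun p => (py (fm1 u) p + px (fm2 u) p) / 2 + fm1 u p / p.2)
       (fun p => py (fm2 u) p + fm2 u p / p.2).

(* Def u = D in the weak sense: the symmetrized weak derivatives of u
   are D + Gamma u (tested against smooth compactly supported functions) *)
Definition weak_Def (u : oneform) (D : sym2) : Prop :=
  forall psi, test_fun psi ->
  [/\ (\int[leb2]_(p in Hp) ((s11 D p + fm2 u p / p.2) * psi p)%:E =
        - \int[leb2]_(p in Hp) (fm1 u p * px psi p)%:E)%E,
      (\int[leb2]_(p in Hp) ((s12 D p - fm1 u p / p.2) * psi p)%:E =
        - \int[leb2]_(p in Hp) ((fm1 u p * py psi p + fm2 u p * px psi p) / 2)%:E)%E &
      (\int[leb2]_(p in Hp) ((s22 D p - fm2 u p / p.2) * psi p)%:E =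
        - \int[leb2]_(p in Hp) (fm2 u p * py psi p)%:E)%E].

Definition form_sub (u v : oneform) : oneform := fun p => (u p - v p)%R.
Definition sym_sub (D E : sym2) : sym2 :=
  Sym2 (fun p => s11 D p - s11 E p) (fun p => s12 D p - s12 E p)
       (fun p => s22 D p - s22 E p).

Definition H1dist2 (a : R) (u : oneform) (Du : sym2) (th : oneform) : \bar R :=
  (\int[leb2]_(p in Hp) (formsq (form_sub u th) p)%:E
   + 2%:E * \int[leb2]_(p in Hp) (tensq a (sym_sub Du (Def_smooth th)) p)%:E)%E.

(* closure of a set S of smooth compactly supported 1-forms in the H^1 norm,
   realized inside L^2 *)
Definition H1_closure (a : R) (S : set oneform) : set oneform :=
  [set u | L2form u /\ exists Du : sym2, weak_Def u Du /\ L2sym a Du /\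
     forall eps : R, 0 < eps -> exists2 th, S th & (H1dist2 a u Du th < eps%:E)%E].

Definition H10 (a : R) : set oneform := H1_closure a test_form.

Definition dstar_smooth (a : R) (u : oneform) (p : R * R) : R :=
  - (a ^+ 2 * p.2 ^+ 2) * (px (fm1 u) p + py (fm2 u) p).

(* weak d^* u = 0 : int g(u, d phi) Vol = int (u1 phi_x + u2 phi_y) dx dy = 0 *)
Definition weak_dstar0 (u : oneform) : Prop :=
  forall phi, test_fun phi ->
  (\int[leb2]_(p in Hp) (fm1 u p * px phi p + fm2 u p * py phi p)%:E = 0)%E.

Definition Lc_sigma (a : R) : set oneform :=
  [set th | test_form th /\ forall p, Hp p -> dstar_smooth a th p = 0].

Definition Vbold (a : R) : set oneform := H1_closure a (Lc_sigma a).

Definition harmonic (a : R) (F : R * R -> R) : Prop :=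
  smooth_on F /\
  forall p, Hp p -> a ^+ 2 * p.2 ^+ 2 * (px (px F) p + py (py F) p) = 0.

Definition dfun (F : R * R -> R) : oneform := fun p => (px F p, py F p).

Definition Fharm (a : R) : set oneform :=
  [set w | exists F, harmonic a F /\ L2form (dfun F) /\ w = dfun F].

Definition Vbb (a : R) : set oneform :=
  [set u | exists v w, Vbold a v /\ Fharm a w /\
     forall p, Hp p -> u p = (v p + w p)%R].

Definition Vtilde (a : R) : set oneform :=
  [set u | H10 a u /\ weak_dstar0 u].

End Hyp.

(* Main.v *)
Require Import Defs.
From HB Require Import structures.
From mathcomp Require Import all_boot all_order all_algebra.
From mathcomp Require Import all_classical all_reals all_analysis.
From mathcomp Require Import measurable_realfun.
From mathcomp Require Import ring lra.
Set Implicit Arguments. Unset Strict Implicit. Unset Printing Implicit Defensive.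
Import Order.TTheory GRing.Theory Num.Theory.
Import numFieldNormedType.Exports.
Local Open Scope classical_set_scope.
Local Open Scope ring_scope.

(** For compactly supported forms the Bochner identity reads
    [2 |Def th|^2 = |d th|^2 + 2 |d^* th|^2 + 2 a^2 |th|^2] after integration.
    Applied to [chi_n dF] with [F] harmonic, [dF] in [L^2] and cutoffs [chi_n]
    whose hyperbolic gradients are bounded, it bounds [Def dF] in [L^2], and then
    [chi_n dF] tends to [dF] in [H^1]; this gives one inclusion.

    Conversely let [u] be in [H^1_0] with [d^* u = 0], let [v] be its orthogonal
    projection on [V] and [w = u - v]. Orthogonality to the test forms
    [(psi_y, - psi_x)] is an equation [Lap Omega = c y^-2 Omega], [c > 0], for
    [Omega = y h], where [h] is [y] times the curl of [w] and lies in [L^2] by the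
    Bochner identity. A Caccioppoli estimate with the cutoffs [chi_n], carried
    out on mollifications, yields [h = 0]. Hence [w] is closed and coclosed, so it
    is smooth by Weyl's lemma and equals [dF] with [F] harmonic. *)

(** * Square-integrable functions on the half-plane *)

(** In dimension two the [L^2] norm of 1-forms is conformally invariant, so it is the flat one for
    [dx dy], and the metric only puts a factor [a * y] on derivatives. Everything therefore takes
    place in the flat [L^2] of the half-plane with explicit weights [y] and [1/y]. Negative
    curvature makes the zero-order term of the Bochner identity nonnegative, so the [H^1] norm
    dominates the curl directly. In [c = 2 + 1/a^2] the 2 is the curvature term and [1/a^2] comes
    from the [L^2] part of the norm. The obstacle is regularity: the curl of [w] exists only as an
    [L^2] limit of curls of test forms, and its equation only against test functions. Instead of a
    regularity theory, one uses that a kernel of small scale centred at a given point is itself a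
    test function, so that weak equations hold pointwise for mollifications. In Weyl's lemma this
    takes the form that averages against the kernel do not depend on its scale. Finally, forms are
    functions and not classes, while [Vbb] asks for an equality at every point; this is why [v] must
    be corrected on a null set at the end. *)

Section SquareIntegrable.
Variable R : realType.
Implicit Types (f g h : R * R -> R).

(* [leb2] lives on the product of two copies of [measurableTypeR R]; its
   measurable sets are convertible to, but its display differs from, those of
   the canonical product structure on [R * R] used in [L2fun]. *)
Definition RR := (measurableTypeR R * measurableTypeR R)%type.
Definition HH : set RR := @Hp R.
Definition measH f := measurable_fun HH f.

Definition integrableH f := (@leb2 R).-integrable HH (EFin \o f).
(** [fine] sends an infinite integral to the default value 0, hence the integrability hypotheses of
    the linearity and comparison lemmas below. *)
Definition I f : R := \int[@leb2 R]_(p in HH) f p.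

Lemma measurable_Hp : measurable HH.
Proof.
have -> : HH = setT `*` `]0, +oo[%classic.
  by apply/seteqP; split => -[x y]; rewrite /HH /Hp /= in_itv /= andbT // => -[].
exact: measurableX.
Qed.
Hint Resolve measurable_Hp : core.

Lemma integralEI f : integrableH f ->
  (\int[@leb2 R]_(p in @Hp R) (f p)%:E = (I f)%:E)%E.
Proof. by move=> fi; rewrite /I /Rintegral fineK // integrable_fin_num. Qed.

Lemma integrableH_meas f : integrableH f -> measH f.
Proof. by move=> /integrableP[/measurable_EFinP]. Qed.

Lemma eq_integrableH f g : (forall p, Hp p -> f p = g p) -> integrableH f -> integrableH g.
Proof.
by move=> fg; apply: eq_integrable => // p; rewrite inE => Hpp /=; rewrite fg.
Qed.

Lemma eq_I f g : (forall p, Hp p -> f p = g p) -> I f = I g.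
Proof. by move=> fg; apply: eq_Rintegral => p; rewrite inE => Hpp; rewrite fg. Qed.

Lemma integrableHD f g : integrableH f -> integrableH g -> integrableH (fun p => f p + g p).
Proof.
move=> fi gi; have := integrableD measurable_Hp fi gi.
by apply: eq_integrable => // p _.
Qed.

Lemma integrableHZ r f : integrableH f -> integrableH (fun p => r * f p).
Proof.
move=> fi; have := integrableZl measurable_Hp r fi.
by apply: eq_integrable => // p _.
Qed.

Lemma integrableHN f : integrableH f -> integrableH (fun p => - f p).
Proof.
by move=> /(integrableHZ (-1)); apply: eq_integrableH => p _; rewrite mulN1r.
Qed.

Lemma integrableHB f g : integrableH f -> integrableH g -> integrableH (fun p => f p - g p).
Proof. by move=> fi /integrableHN; exact: integrableHD. Qed.

Lemma ID f g : integrableH f -> integrableH g -> I (fun p => f p + g p) = I f + I g.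
Proof. by move=> fi gi; rewrite /I RintegralD. Qed.

Lemma IB f g : integrableH f -> integrableH g -> I (fun p => f p - g p) = I f - I g.
Proof. by move=> fi gi; rewrite /I RintegralB. Qed.

Lemma IZ r f : integrableH f -> I (fun p => r * f p) = r * I f.
Proof. by move=> fi; rewrite /I RintegralZl. Qed.

Lemma IN f : integrableH f -> I (fun p => - f p) = - I f.
Proof.
by move=> fi; rewrite -mulN1r -IZ//; apply: eq_I => p _; rewrite mulN1r.
Qed.

Lemma I_ge0 f : (forall p, Hp p -> 0 <= f p) -> 0 <= I f.
Proof. by move=> f0; rewrite /I; apply: Rintegral_ge0 => p; exact: f0. Qed.

Lemma le_I f g : integrableH f -> integrableH g ->
  (forall p, Hp p -> f p <= g p) -> I f <= I g.
Proof. by move=> fi gi fg; exact: le_Rintegral. Qed.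

Lemma le_integrableH f g : measH f -> integrableH g ->
  (forall p, Hp p -> `|f p| <= g p) -> integrableH f.
Proof.
move=> mf gi fg; apply: le_integrable gi => //; first exact/measurable_EFinP.
move=> p Hpp /=; rewrite lee_fin (le_trans (fg _ Hpp))//; exact: ler_norm.
Qed.

Lemma I0 : I (fun=> 0) = 0.
Proof. by rewrite /I /Rintegral integral0_eq. Qed.

Lemma integrableH0 : integrableH (fun=> 0).
Proof. exact: integrable0. Qed.

Lemma L2_sqr f : L2fun f -> integrableH (fun p => f p ^+ 2).
Proof.
move=> [mf fi]; apply/integrableP; split.
  by apply/measurable_EFinP; exact: measurable_funX.
apply: le_lt_trans fi; rewrite le_eqVlt; apply/orP; left; apply/eqP.
by apply: eq_integral => p _ /=; rewrite ger0_norm ?sqr_ge0.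
Qed.

Lemma sqr_L2 f : measH f -> integrableH (fun p => f p ^+ 2) -> L2fun f.
Proof.
move=> mf /integrableP[_ fi]; split => //; apply: le_lt_trans fi.
rewrite le_eqVlt; apply/orP; left; apply/eqP; apply: eq_integral => p _ /=.
by rewrite ger0_norm ?sqr_ge0.
Qed.

Lemma L2M f g : L2fun f -> L2fun g -> integrableH (fun p => f p * g p).
Proof.
move=> f2 g2; apply: le_integrableH (integrableHD (L2_sqr f2) (L2_sqr g2)) _.
  by apply: measurable_funM; [case: f2|case: g2].
move=> p _; rewrite ler_norml; apply/andP; split.
  by have := sqr_ge0 (f p + g p); have := sqr_ge0 (f p); have := sqr_ge0 (g p); nra.
by have := sqr_ge0 (f p - g p); have := sqr_ge0 (f p); have := sqr_ge0 (g p); nra.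
Qed.

Lemma le_L2 f g : measH f -> L2fun g ->
  (forall p, Hp p -> f p ^+ 2 <= g p ^+ 2) -> L2fun f.
Proof.
move=> mf g2 fg; apply: sqr_L2 => //; apply: le_integrableH (L2_sqr g2) _.
  exact: measurable_funX.
by move=> p Hpp; rewrite ger0_norm ?sqr_ge0// fg.
Qed.

Lemma eq_L2 f g : (forall p, Hp p -> f p = g p) -> L2fun f -> L2fun g.
Proof.
move=> fg f2; apply: (le_L2 _ f2); last by move=> p Hpp; rewrite fg.
by apply: eq_measurable_fun f2.1 => p; rewrite inE => /fg.
Qed.

Lemma L2D f g : L2fun f -> L2fun g -> L2fun (fun p => f p + g p).
Proof.
move=> f2 g2; apply: sqr_L2; first by apply: measurable_funD; [case: f2|case: g2].
have := integrableHD (integrableHD (L2_sqr f2) (L2_sqr g2)) (integrableHZ 2 (L2M f2 g2)).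
by apply: eq_integrableH => p _; ring.
Qed.

Lemma L2Z r f : L2fun f -> L2fun (fun p => r * f p).
Proof.
move=> f2; apply: sqr_L2; first by apply: measurable_funM => //; case: f2.
by apply: eq_integrableH (integrableHZ (r ^+ 2) (L2_sqr f2)) => p _; ring.
Qed.

Lemma L2N f : L2fun f -> L2fun (fun p => - f p).
Proof. by move=> /(L2Z (-1)); apply: eq_L2 => p _; rewrite mulN1r. Qed.

Lemma L2B f g : L2fun f -> L2fun g -> L2fun (fun p => f p - g p).
Proof. by move=> f2 /L2N; exact: L2D. Qed.

Lemma L2_0 : L2fun (fun _ : R * R => 0 : R).
Proof.
apply: sqr_L2; first exact: measurable_cst.
by apply: eq_integrableH integrableH0 => p _; rewrite expr0n.
Qed.

Lemma L2_bdM M b f : measH b -> (forall p, Hp p -> `|b p| <= M) ->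
  L2fun f -> L2fun (fun p => b p * f p).
Proof.
move=> mb bM f2; apply: (le_L2 _ (L2Z M f2)).
  by apply: measurable_funM => //; case: f2.
move=> p Hpp; rewrite !exprMn ler_wpM2r ?sqr_ge0//.
rewrite -(real_normK (num_real (b p))) lerXn2r ?nnegrE ?bM//.
exact: le_trans (bM _ Hpp).
Qed.

Definition ip f g := I (fun p => f p * g p).
Definition nsq f := I (fun p => f p ^+ 2).

Lemma eq_ip f f' g g' : (forall p, Hp p -> f p = f' p) -> (forall p, Hp p -> g p = g' p) ->
  ip f g = ip f' g'.
Proof. by move=> ff gg; apply: eq_I => p Hpp; rewrite ff// gg. Qed.

Lemma eq_nsq f f' : (forall p, Hp p -> f p = f' p) -> nsq f = nsq f'.
Proof. by move=> ff; apply: eq_I => p Hpp; rewrite ff. Qed.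

Lemma ipC f g : ip f g = ip g f.
Proof. by apply: eq_I => p _; rewrite mulrC. Qed.

Lemma nsqE f : nsq f = ip f f.
Proof. by apply: eq_I => p _; rewrite expr2. Qed.

Lemma nsq_ge0 f : 0 <= nsq f.
Proof. by apply: I_ge0 => p _; exact: sqr_ge0. Qed.

Lemma le_nsq f g : L2fun f -> L2fun g -> (forall p, Hp p -> f p ^+ 2 <= g p ^+ 2) ->
  nsq f <= nsq g.
Proof. by move=> /L2_sqr fi /L2_sqr gi; exact: le_I. Qed.

Lemma ipDl f g h : L2fun f -> L2fun g -> L2fun h ->
  ip (fun p => f p + g p) h = ip f h + ip g h.
Proof.
move=> f2 g2 h2; rewrite /ip -ID; [|exact: L2M..].
by apply: eq_I => p _; rewrite mulrDl.
Qed.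

Lemma ipBl f g h : L2fun f -> L2fun g -> L2fun h ->
  ip (fun p => f p - g p) h = ip f h - ip g h.
Proof.
move=> f2 g2 h2; rewrite /ip -IB; [|exact: L2M..].
by apply: eq_I => p _; rewrite mulrBl.
Qed.

Lemma ipZl r f h : L2fun f -> L2fun h -> ip (fun p => r * f p) h = r * ip f h.
Proof.
move=> f2 h2; rewrite /ip -IZ; last exact: L2M.
by apply: eq_I => p _; rewrite mulrA.
Qed.

Lemma ipNl f h : L2fun f -> L2fun h -> ip (fun p => - f p) h = - ip f h.
Proof.
move=> f2 h2; rewrite /ip -IN; last exact: L2M.
by apply: eq_I => p _; rewrite mulNr.
Qed.

Lemma nsqD f g : L2fun f -> L2fun g ->
  nsq (fun p => f p + g p) = nsq f + 2 * ip f g + nsq g.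
Proof.
move=> f2 g2; have fg := L2M f2 g2; have ff := L2_sqr f2; have gg := L2_sqr g2.
have fg2 := integrableHZ 2 fg.
rewrite /nsq /ip -IZ// -ID// -ID//; last exact: integrableHD.
by apply: eq_I => p _; ring.
Qed.

Lemma nsqZ r f : L2fun f -> nsq (fun p => r * f p) = r ^+ 2 * nsq f.
Proof.
by move=> /L2_sqr fi; rewrite /nsq -IZ//; apply: eq_I => p _; ring.
Qed.

Lemma nsqN f : nsq (fun p => - f p) = nsq f.
Proof. by apply: eq_I => p _; rewrite sqrrN. Qed.

Lemma nsqBC f g : nsq (fun p => f p - g p) = nsq (fun p => g p - f p).
Proof. by apply: eq_I => p _; ring. Qed.

(** Parallelogram law with the square of the difference dropped. Only squared norms occur, and this
    takes the place of the triangle inequality. *)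
Lemma nsqD_le f g : L2fun f -> L2fun g ->
  nsq (fun p => f p + g p) <= 2 * nsq f + 2 * nsq g.
Proof.
move=> f2 g2; have := nsq_ge0 (fun p => f p - g p).
have -> : nsq (fun p => f p - g p) = nsq f - 2 * ip f g + nsq g.
  by rewrite (nsqD f2 (L2N g2)) nsqN ipC ipNl// ipC mulrN.
by rewrite nsqD//; lra.
Qed.

Lemma cauchy_schwarz f g : L2fun f -> L2fun g -> ip f g ^+ 2 <= nsq f * nsq g.
Proof.
move=> f2 g2.
have key t : 0 <= nsq f + 2 * t * ip f g + t ^+ 2 * nsq g.
  have := nsq_ge0 (fun p => f p + t * g p).
  by rewrite (nsqD f2 (L2Z t g2)) nsqZ// ipC ipZl// ipC mulrA.
have [g0|g0] := eqVneq (nsq g) 0.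
  rewrite g0 mulr0; have [->|i0] := eqVneq (ip f g) 0; first by rewrite expr0n.
  (* In the degenerate case [nsq g = 0] the bound [key] is affine in [t], and this [t] makes its
     right-hand side equal to [- nsq f - 2]. *)
  have := key (- (nsq f + 1) / ip f g); rewrite g0 mulr0 addr0 -mulrA mulfVK//.
  by have := nsq_ge0 f; lra.
have gp : 0 < nsq g by rewrite lt_neqAle eq_sym g0 nsq_ge0.
have := key (- ip f g / nsq g).
rewrite -(ler_pM2r gp) mul0r [X in 0 <= X](_ : _ = nsq f * nsq g - ip f g ^+ 2).
  by rewrite subr_ge0.
by field.
Qed.

End SquareIntegrable.
#[global] Hint Resolve measurable_Hp : core.

(** * Convergence and completeness in [L^2] *)

Section Limits.
Variable R : realType.
Implicit Types (f g h : R * R -> R) (F G : nat -> R * R -> R).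

Lemma cvg0_le (a b : nat -> R) : (forall n, 0 <= a n <= b n) ->
  b n @[n --> \oo] --> 0 -> a n @[n --> \oo] --> 0.
Proof.
move=> ab b0; apply: (squeeze_cvgr _ (cvg_cst 0) b0).
by apply: nearW => n; exact: ab.
Qed.

Lemma cvg0_eps (a : nat -> R) : (forall n, 0 <= a n) ->
  (forall e, 0 < e -> exists N, forall n, (N <= n)%N -> a n < e) ->
  a n @[n --> \oo] --> 0.
Proof.
move=> a0 ae; apply/cvgrPdist_lt => e e0; have [N aN] := ae _ e0.
by exists N => // n /= /aN; rewrite sub0r normrN ger0_norm.
Qed.

Lemma cvg0_epsE (a : nat -> R) e : a n @[n --> \oo] --> 0 -> 0 < e ->
  exists N, forall n, (N <= n)%N -> `|a n| < e.
Proof.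
move=> /cvgrPdist_lt a0 /a0 [N _ aN]; exists N => n /aN /=.
by rewrite sub0r normrN.
Qed.

Lemma cvg0_sqr (a : nat -> R) : a n ^+ 2 @[n --> \oo] --> 0 -> a n @[n --> \oo] --> 0.
Proof.
move=> a2; apply/cvgrPdist_lt => e e0.
have [N aN] := cvg0_epsE a2 (exprn_gt0 2 e0).
exists N => // n /= /aN; rewrite sub0r normrN normrX.
by rewrite ltr_pXn2r// nnegrE ltW.
Qed.

Lemma measH_EFin f : measH f -> measurable_fun (@HH R) (fun p : RR R => (f p)%:E).
Proof. by move=> mf; apply/measurable_EFinP; exact: mf. Qed.

(** Fatou's lemma for the squares. It supplies the square integrability of the limit together with
    its bound. *)
Lemma fatou_sq F f (M : R) : (forall n, L2fun (F n)) -> measH f ->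
  (\forall p \ae (@leb2 R), HH p -> F n p @[n --> \oo] --> f p) ->
  (forall n, nsq (F n) <= M) -> L2fun f /\ nsq f <= M.
Proof.
move=> F2 mf Ff FM.
have key : (\int[@leb2 R]_(p in @HH R) ((f p) ^+ 2)%:E <= M%:E)%E.
  rewrite (@ge0_ae_eq_integral _ _ _ _ _ _ (fun p : RR R => limn_einf (fun n => ((F n p) ^+ 2)%:E))) //.
  - apply: (le_trans (fatou (@leb2 R) _ _ _)) => //.
    + by move=> n; apply: measH_EFin; apply: measurable_funX; case: (F2 n).
    + by move=> n p _; rewrite lee_fin sqr_ge0.
    rewrite limn_einf_lim; apply: lime_le; first exact: is_cvg_einfs.
    apply: nearW => n; apply: (@le_trans _ _ (\int[@leb2 R]_(p in @HH R) ((F n p) ^+ 2)%:E)%E).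
      by apply: ereal_inf_lbound; exists n => //=.
    by rewrite (integralEI (L2_sqr (F2 n))) lee_fin FM.
  - by apply: measH_EFin; exact: measurable_funX.
  (* Measurability of the lower limit is read off from that of the upper limit of the opposites. *)
  - rewrite (_ : (fun _ => _) =
        fun p : RR R => (- limn_esup (fun n => - ((F n p) ^+ 2)%:E))%E); last first.
      by apply/funext => p; rewrite -[RHS]limn_einfN; congr limn_einf;
        apply/funext => n /=; rewrite opprK.
    apply: measurableT_comp => //; apply: measurable_fun_limn_esup => n.
    apply: measurableT_comp => //; apply: measH_EFin.
    by apply: measurable_funX; case: (F2 n).
  - by move=> p _; rewrite lee_fin sqr_ge0.
  - move=> p _; rewrite limn_einf_lim; apply: lime_ge; first exact: is_cvg_einfs.
    apply: nearW => n; apply: le_ereal_inf_tmp => _ [k _ <-].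
    by rewrite lee_fin sqr_ge0.
  - apply: filterS Ff => p Ffp Hpp; apply/esym.
    rewrite is_cvg_limn_einfE.
      apply/cvg_lim => //; apply: cvg_EFin; first exact: nearW.
      exact: (cvgM (Ffp Hpp) (Ffp Hpp)).
    apply/cvg_ex; exists ((f p) ^+ 2)%:E; apply: cvg_EFin; first exact: nearW.
    exact: (cvgM (Ffp Hpp) (Ffp Hpp)).
have f2 : L2fun f by split => //; apply: le_lt_trans key _; rewrite ltry.
by split => //; rewrite -lee_fin -(integralEI (L2_sqr f2)).
Qed.

Lemma dct F f g : (forall n, measH (F n)) -> measH f -> integrableH g ->
  (forall n p, Hp p -> `|F n p| <= g p) ->
  (forall p, Hp p -> F n p @[n --> \oo] --> f p) ->
  integrableH f /\ I (F n) @[n --> \oo] --> I f.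
Proof.
move=> mF mf gi Fg Ff.
have [] := @dominated_convergence _ _ _ (@leb2 R) _ (@measurable_Hp R)
  (fun n (p : RR R) => (F n p)%:E) (EFin \o f) (EFin \o g).
- by move=> n; exact: measH_EFin.
- exact: measH_EFin.
- by apply: aeW => p Hpp; apply: cvg_EFin; [exact: nearW|exact: Ff].
- exact: gi.
- by apply: aeW => p n Hpp; rewrite lee_fin Fg.
move=> fi _ cv; split => //.
by rewrite /I /Rintegral; apply: fine_cvg; rewrite fineK//; exact: integrable_fin_num.
Qed.

Definition L2cvg F f := nsq (fun p => F n p - f p) @[n --> \oo] --> 0.

Lemma ip_cvg0 F G (M : R) : (forall n, L2fun (F n)) -> (forall n, L2fun (G n)) ->
  nsq (F n) @[n --> \oo] --> 0 -> (forall n, nsq (G n) <= M) ->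
  ip (F n) (G n) @[n --> \oo] --> 0.
Proof.
move=> F2 G2 F0 GM; apply: cvg0_sqr.
apply: (@cvg0_le _ (fun n => nsq (F n) * M)).
  move=> n; rewrite sqr_ge0 (le_trans (cauchy_schwarz _ _))//.
  by rewrite ler_wpM2l ?nsq_ge0.
by rewrite -[0 in X in _ --> X](mul0r M); apply: cvgMl.
Qed.

Lemma L2cvg_ip F f g : (forall n, L2fun (F n)) -> L2fun f -> L2fun g ->
  L2cvg F f -> ip (F n) g @[n --> \oo] --> ip f g.
Proof.
move=> F2 f2 g2 Ff; apply/subr_cvg0.
have := ip_cvg0 (fun n => L2B (F2 n) f2) (fun=> g2) Ff (fun=> lexx _).
by under eq_fun do rewrite ipBl//.
Qed.

Lemma nsq_bound F f : (forall n, L2fun (F n)) -> L2fun f -> L2cvg F f ->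
  exists M, forall n, nsq (F n) <= M.
Proof.
move=> F2 f2 Ff; have : cvgn (fun n => nsq (fun p => F n p - f p)) by apply/cvg_ex; exists 0.
move=> /cvg_seq_bounded [M [_ MM]]; exists (2 * (M + 1) + 2 * nsq f) => n.
have := nsqD_le (L2B (F2 n) f2) f2.
rewrite (@eq_nsq _ _ (F n)); last by move=> p _; rewrite subrK.
move=> /le_trans; apply; rewrite lerD2r ler_pM2l//.
have := MM (M + 1); rewrite ltrDl ltr01 => /(_ isT n Logic.I) /=.
exact/le_trans/ler_norm.
Qed.

Lemma L2cvg_ip2 F G f g : (forall n, L2fun (F n)) -> (forall n, L2fun (G n)) ->
  L2fun f -> L2fun g -> L2cvg F f -> L2cvg G g ->
  ip (F n) (G n) @[n --> \oo] --> ip f g.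
Proof.
move=> F2 G2 f2 g2 Ff Gg; have [M MG] := nsq_bound G2 g2 Gg.
have h1 := ip_cvg0 (fun n => L2B (F2 n) f2) G2 Ff MG.
have h2 : ip (G n) f @[n --> \oo] --> ip g f by exact: L2cvg_ip.
have := cvgD h1 h2; rewrite add0r ipC.
suff <- : (fun n => ip (F n) (G n)) =
  (fun n => ip (fun p => F n p - f p) (G n)) + (fun n => ip (G n) f) by exact.
by apply/funext => n /=; rewrite -[RHS]/(_ + _) ipBl// (ipC (G n)) subrK.
Qed.

Lemma L2cvgB F G f g : (forall n, L2fun (F n)) -> (forall n, L2fun (G n)) ->
  L2fun f -> L2fun g -> L2cvg F f -> L2cvg G g ->
  L2cvg (fun n p => F n p - G n p) (fun p => f p - g p).
Proof.
move=> F2 G2 f2 g2 Ff Gg.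
apply: (@cvg0_le _ (fun n => 2 * nsq (fun p => F n p - f p) + 2 * nsq (fun p => G n p - g p))).
  move=> n; rewrite nsq_ge0 -[X in _ + 2 * X]nsqN.
  have := nsqD_le (L2B (F2 n) f2) (L2N (L2B (G2 n) g2)); apply: le_trans.
  by rewrite le_eqVlt; apply/orP; left; apply/eqP; apply: eq_nsq => p _; ring.
rewrite -[0 in X in _ --> X](_ : 2 * 0 + 2 * 0 = 0); last by ring.
by apply: cvgD; apply: cvgMr.
Qed.

Lemma L2cvg_bdM M b F f : measH b -> (forall p, Hp p -> `|b p| <= M) ->
  (forall n, L2fun (F n)) -> L2fun f -> L2cvg F f ->
  L2cvg (fun n p => b p * F n p) (fun p => b p * f p).
Proof.
move=> mb bM F2 f2 Ff.
apply: (@cvg0_le _ (fun n => M ^+ 2 * nsq (fun p => F n p - f p))); last first.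
  by rewrite -[0 in X in _ --> X](mulr0 (M ^+ 2)); apply: cvgMr.
move=> n; rewrite nsq_ge0 -nsqZ; last exact: L2B.
have d2 := L2B (F2 n) f2.
rewrite (@eq_nsq _ _ (fun p => b p * (F n p - f p))); last by move=> p _; ring.
apply: le_nsq; [exact: L2_bdM bM d2|exact: L2Z|].
move=> p Hpp; rewrite !exprMn ler_wpM2r ?sqr_ge0//.
rewrite -(real_normK (num_real (b p))) lerXn2r ?nnegrE ?bM//.
exact: le_trans (bM _ Hpp).
Qed.

Lemma nsq0_ip f g : L2fun f -> L2fun g -> nsq f = 0 -> ip f g = 0.
Proof.
move=> f2 g2 f0; apply/eqP; rewrite -sqrf_eq0 eq_le sqr_ge0 andbT.
by rewrite (le_trans (cauchy_schwarz f2 g2))// f0 mul0r.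
Qed.

Lemma L2cvg_unique F f g : (forall n, L2fun (F n)) -> L2fun f -> L2fun g ->
  L2cvg F f -> L2cvg F g -> nsq (fun p => f p - g p) = 0.
Proof.
move=> F2 f2 g2 Ff Fg.
have : (fun _ : nat => nsq (fun p => f p - g p)) n @[n --> \oo] --> (0 : R).
  apply: (@cvg0_le _ (fun n => 2 * nsq (fun p => F n p - f p) + 2 * nsq (fun p => F n p - g p))).
    move=> n; rewrite nsq_ge0 -[X in 2 * X + _]nsqN.
    have := nsqD_le (L2N (L2B (F2 n) f2)) (L2B (F2 n) g2); apply: le_trans.
    by rewrite le_eqVlt; apply/orP; left; apply/eqP; apply: eq_nsq => p _; ring.
  rewrite -[0 in X in _ --> X](_ : 2 * 0 + 2 * 0 = 0); last by ring.
  by apply: cvgD; apply: cvgMr.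
by move/cvg_lim => <- //; rewrite lim_cst.
Qed.

(** Riesz-Fischer. Along a fast subsequence [g] the sum [h] of [4 ^ k (g k.+1 - g k) ^ 2] has finite
    integral, hence is finite almost everywhere; there the increments of [g] are dominated by a
    geometric series of ratio [1/2]. *)
Lemma L2_complete F : (forall n, L2fun (F n)) ->
  (forall e, 0 < e -> exists N, forall n m, (N <= n)%N -> (N <= m)%N ->
     nsq (fun p => F n p - F m p) < e) ->
  exists f, L2fun f /\ L2cvg F f.
Proof.
move=> F2 FC.
(* The factor [4 ^ k] cancels the weight in [h], and [2 ^ k.+1] makes the integrals of its terms sum
   to at most 1. *)
pose d k : R := (4 ^+ k * 2 ^+ k.+1)^-1.
have d0 k : 0 < d k by rewrite invr_gt0 mulr_gt0// exprn_gt0.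
have /choice [s sP] : forall k, exists N, forall n m, (N <= n)%N -> (N <= m)%N ->
     nsq (fun p => F n p - F m p) < d k by move=> k; exact: FC.
(* [S k] is the maximum of [s 0], ..., [s k]: it dominates [s k] and is nondecreasing, so that [g k]
   can be compared with all later terms. *)
pose S := fix S k := if k is k'.+1 then maxn (S k') (s k) else s 0%N.
have sS k : (s k <= S k)%N by case: k => [//|k] /=; rewrite leq_maxr.
have SS k : (S k <= S k.+1)%N by rewrite /= leq_maxl.
pose g k := F (S k).
have g2 k : L2fun (g k) by exact: F2.
pose h p := (\sum_(0 <= k <oo) (4 ^+ k * (g k.+1 p - g k p) ^+ 2)%:E)%E.
have t0 k p : (0 <= (4 ^+ k * (g k.+1 p - g k p) ^+ 2)%:E)%E.
  by rewrite lee_fin mulr_ge0 ?sqr_ge0// exprn_ge0.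
have mt k : measH (fun p => 4 ^+ k * (g k.+1 p - g k p) ^+ 2).
  apply: measurable_funM => //; apply: measurable_funX; apply: measurable_funB.
    by case: (g2 k.+1).
  by case: (g2 k).
have hlt : (\int[@leb2 R]_(p in @HH R) h p <= 1)%E.
  rewrite /h integral_nneseries//; last by move=> k; exact: measH_EFin.
  apply: (@le_trans _ _ (\sum_(i <oo) (1 / (2 ^ i.+1)%:R)%:E)%E); last exact: epsilon_trick0.
  apply: lee_nneseries => k _; first by move=> _; apply: integral_ge0.
  have di := L2_sqr (L2B (g2 k.+1) (g2 k)).
  rewrite (integralEI (integrableHZ (4 ^+ k) di)) IZ// lee_fin.
  rewrite -ler_pdivlMl ?exprn_gt0// mul1r -invfM natrX; apply: ltW; apply: sP; last exact: sS.
  exact: leq_trans (sS k) (SS k).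
have hi : (@leb2 R).-integrable (@HH R) h.
  apply/integrableP; split.
    by apply: ge0_emeasurable_sum => // k _; exact: measH_EFin.
  apply: le_lt_trans (ltry 1); apply: le_trans hlt.
  rewrite le_eqVlt; apply/orP; left; apply/eqP; apply: eq_integral => p _ /=.
  by rewrite gee0_abs// nneseries_ge0.
have gcv : \forall p \ae (@leb2 R), HH p -> cvgn (fun k => g k p).
  apply: filterS (integrable_ae (@measurable_Hp R) hi) => p hp Hpp.
  have {hp} := hp Hpp; rewrite fin_numElt => /andP[_ hp].
  have hge0 : (0 <= h p)%E by exact: nneseries_ge0.
  pose r := fine (h p); have hr : h p = r%:E.
    by rewrite /r fineK// ge0_fin_numE.
  have r0 : 0 <= r by rewrite -lee_fin -hr.
  have dk k : `|g k.+1 p - g k p| <= (r + 1) * (2^-1) ^+ k.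
    have : (4 ^+ k * (g k.+1 p - g k p) ^+ 2 <= r).
      rewrite -lee_fin -hr; apply: le_trans (nneseries_lim_ge k.+1 _) => //.
      rewrite big_nat_recr//= leeDr// sume_ge0//.
    rewrite (_ : 4 ^+ k = (2 ^+ k) ^+ 2); last by rewrite -exprM mulnC exprM; congr (_ ^+ _); ring.
    rewrite -exprMn => dr.
    rewrite exprVn ler_pdivlMr ?exprn_gt0// mulrC.
    rewrite -[2 ^+ k]ger0_norm ?exprn_ge0// -normrM.
    rewrite -ler_sqr ?nnegrE ?addr_ge0// real_normK ?num_real//.
    by apply: le_trans dr _; nra.
  have scv : cvgn (series (fun k => g k.+1 p - g k p)).
    apply: normed_cvg; apply: (series_le_cvg _ _ dk) => //.
      by move=> k; rewrite mulr_ge0 ?addr_ge0// exprn_ge0.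
    apply: is_cvg_geometric_series.
    by rewrite ger0_norm// invf_lt1// ltr1n.
  have -> : (fun k => g k p) = (fun k => g 0%N p + series (fun k => g k.+1 p - g k p) k).
    apply/funext => k; rewrite /series /= telescope_sumr//; ring.
  by apply: is_cvgD => //; exact: is_cvg_cst.
(* The upper limit is defined and measurable everywhere, and it agrees with the limit of [g] almost
   everywhere on the half-plane. *)
pose f p := fine (limn_esup (fun k => (g k p)%:E)).
have mf : measH f.
  rewrite /f; apply: (measurableT_comp (@fine_measurable _ _ measurableT)).
  by apply: measurable_fun_limn_esup => k; apply: measH_EFin; case: (g2 k).
have gf : \forall p \ae (@leb2 R), HH p -> g k p @[k --> \oo] --> f p.
  apply: filterS gcv => p cp Hpp; have := cp Hpp => /cvg_ex [l gl].
  have -> // : f p = l.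
  have gl' : (g k p)%:E @[k --> \oo] --> l%:E.
    by apply: cvg_EFin; [exact: nearW|exact: gl].
  by rewrite /f (cvg_limn_einf_sup gl').
(* Fatou's lemma in [j], for fixed [k], turns the Cauchy bound between [g (k + j)] and [g k] into a
   distance from [g k] to the limit. *)
have fg k : L2fun (fun p => f p - g k p) /\ nsq (fun p => f p - g k p) <= d k.
  have FF j : L2fun (fun p => g (k + j)%N p - g k p) by exact: L2B.
  apply: (@fatou_sq (fun j p => g (k + j)%N p - g k p)) => //.
  - by apply: measurable_funB => //; case: (g2 k).
  - apply: filterS gf => p gp Hpp; apply: cvgB; last exact: cvg_cst.
    have := gp Hpp; rewrite -(cvg_shiftn k) => gk.
    by apply: cvg_trans gk; apply: near_eq_cvg; apply: nearW => j /=; rewrite addnC.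
  - move=> j; apply: ltW; apply: sP; last exact: sS.
    apply: leq_trans (sS k) _; elim: j => [|j IH]; first by rewrite addn0.
    by rewrite addnS (leq_trans IH).
have f2 : L2fun f.
  by apply: eq_L2 (L2D (fg 0%N).1 (g2 0%N)) => p _; rewrite subrK.
exists f; split => //; apply: cvg0_eps; first by move=> n; exact: nsq_ge0.
move=> e e0.
have d2k k : d k <= 2^-1 ^+ k.
  rewrite /d exprVn lef_pV2 ?posrE ?mulr_gt0 ?exprn_gt0// exprS mulrA.
  have h4 : 1 <= 4 ^+ k :> R by rewrite exprn_ege1// ler1n.
  by have h2 : 0 < 2 ^+ k :> R; [rewrite exprn_gt0|nra].
have : geometric 1 (2^-1 : R) k @[k --> \oo] --> 0.
  by apply: cvg_geometric; rewrite ger0_norm// invf_lt1// ltr1n.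
move=> /cvg0_epsE /(_ (divr_gt0 e0 (ltr0n R 4))) [K KP].
have := KP K (leqnn _); rewrite /geometric /= mul1r ger0_norm ?exprn_ge0// => Ke.
have dK : d K < e / 4 by exact: le_lt_trans (d2k K) Ke.
exists (S K) => n Sn.
have h1 : nsq (fun p => F n p - g K p) < d K.
  by apply: sP; [exact: leq_trans (sS K) Sn|exact: sS].
have h2 := (fg K).2; rewrite nsqBC in h2.
have := nsqD_le (L2B (F2 n) (g2 K)) (L2B (g2 K) f2).
rewrite (@eq_nsq _ _ (fun p => F n p - f p)); last by move=> p _; ring.
lra.
Qed.

(** Discriminant of a quadratic in [c]. It yields a Cauchy-Schwarz type bound when only a family of
    inequalities in [c] is at hand: near-minimality of a residual, or positivity of a weighted
    square. *)
Lemma quad_bound (b e q : R) : 0 <= q -> (forall c, 2 * c * b <= e + c ^+ 2 * q) ->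
  b ^+ 2 <= e * q.
Proof.
move=> q0 H; have [qe|qn] := eqVneq q 0.
  rewrite qe mulr0; have [->|bn] := eqVneq b 0; first by rewrite expr0n.
  have := H ((e + 1) / b); rewrite qe mulr0 addr0 -mulrA mulfVK//.
  by have := H 0; rewrite qe; lra.
have qp : 0 < q by rewrite lt_neqAle eq_sym qn.
have := H (b / q); rewrite -(ler_pM2r qp) -subr_ge0.
by rewrite [X in 0 <= X](_ : _ = e * q - b ^+ 2); [rewrite subr_ge0|field].
Qed.

Lemma cvg_sum_ord n (a : 'I_n -> nat -> R) (l : 'I_n -> R) :
  (forall i, a i k @[k --> \oo] --> l i) ->
  \sum_i a i k @[k --> \oo] --> \sum_i l i.
Proof.
elim: n a l => [|n IH] a l al.
  by under eq_fun do rewrite big_ord0; rewrite big_ord0; exact: cvg_cst.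
under eq_fun do rewrite big_ord_recr; rewrite big_ord_recr /=.
by apply: cvgD => //; apply: IH.
Qed.

(** * Orthogonal projection in a finite power of [L^2] *)

Section Projection.
Variable n : nat.
Implicit Types (U V s t : 'I_n -> R * R -> R).

Definition vip U V := \sum_i ip (U i) (V i).

Lemma vipBl U V t : (forall i, L2fun (U i)) -> (forall i, L2fun (V i)) ->
  (forall i, L2fun (t i)) -> vip (fun i p => U i p - V i p) t = vip U t - vip V t.
Proof.
by move=> U2 V2 t2; rewrite /vip -sumrB; apply: eq_bigr => i _; rewrite ipBl.
Qed.

Lemma vip_ge0 U : 0 <= vip U U.
Proof. by apply: sumr_ge0 => i _; rewrite -nsqE nsq_ge0. Qed.

Lemma vip_lin U t c : (forall i, L2fun (U i)) -> (forall i, L2fun (t i)) ->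
  let W := fun i p => U i p - c * t i p in
  vip W W = vip U U - 2 * c * vip U t + c ^+ 2 * vip t t.
Proof.
move=> U2 t2 W; rewrite /vip !mulr_sumr -sumrB -big_split /=; apply: eq_bigr => i _.
rewrite -!nsqE (nsqD (U2 i) (L2N (L2Z c (t2 i)))) nsqN nsqZ//.
by rewrite ipC ipNl; [rewrite ipZl// ipC; ring|exact: L2Z|].
Qed.

(** The subspace [S] need not be closed, so the projection is the limit of a minimizing sequence.
    Near-minimality makes the residuals almost orthogonal to [S], and this applied to the difference
    of two members of the sequence shows that it is Cauchy. *)
Lemma projection U (S : ('I_n -> R * R -> R) -> Prop) :
  (forall i, L2fun (U i)) -> (forall s, S s -> forall i, L2fun (s i)) ->
  S (fun _ _ => 0) ->
  (forall s t c, S s -> S t -> S (fun i p => s i p + c * t i p)) ->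
  exists V, [/\ forall i, L2fun (V i),
    exists s : nat -> 'I_n -> R * R -> R,
      (forall k, S (s k)) /\ forall i, L2cvg (fun k => s k i) (V i) &
    forall t, S t -> vip (fun i p => U i p - V i p) t = 0].
Proof.
move=> U2 S2 S0 SD.
pose r s := fun i p => U i p - s i p.
have r2 s i : S s -> L2fun (r s i) by move=> Ss; apply: L2B => //; exact: S2.
pose E := [set vip (r s) (r s) | s in S].
have Elb : has_lbound E by exists 0 => _ [s _ <-]; exact: vip_ge0.
have Ei : has_inf E by split => //; exists (vip (r (fun _ _ => 0)) (r (fun _ _ => 0))); exists (fun _ _ => 0).
have /choice [s sP] : forall k, exists s, S s /\ vip (r s) (r s) < inf E + k.+1%:R^-1.
  move=> k; have k0 : 0 < k.+1%:R^-1 :> R by rewrite invr_gt0.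
  by have [_ [s Ss <-] sk] := inf_adherent k0 Ei; exists s.
(* Comparing [s k] with [s k + c t] for every real [c] gives a quadratic inequality, whose
   discriminant is this bound. *)
have key k t : S t -> vip (r (s k)) t ^+ 2 <= k.+1%:R^-1 * vip t t.
  move=> St; apply: quad_bound (vip_ge0 _) _ => c.
  have [Ss sk] := sP k.
  have := ge_inf Elb (imageP _ (SD _ _ c Ss St)); rewrite /=.
  have -> : vip (r (fun i p => s k i p + c * t i p)) (r (fun i p => s k i p + c * t i p))
     = vip (r (s k)) (r (s k)) - 2 * c * vip (r (s k)) t + c ^+ 2 * vip t t.
    rewrite -(vip_lin c (fun i => r2 _ i Ss) (S2 _ St)) /vip.
    apply: eq_bigr => i _; apply: eq_ip => p _; rewrite /r; ring.
  move: sk; move: (inf E) (vip (r (s k)) (r (s k))) (vip (r (s k)) t) (vip t t) => i0 v b q.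
  move: (k.+1%:R^-1) => x h1 h2; lra.
pose t k l i p := s k i p + (-1) * s l i p.
have St k l : S (t k l) by apply: SD; [case: (sP k)|case: (sP l)].
have tb k l : vip (t k l) (t k l) <= 2 * (k.+1%:R^-1 + l.+1%:R^-1).
  (* The difference of the two residuals is [t k l] itself, so its norm is a difference of two
     pairings controlled by [key]. *)
  have e : vip (t k l) (t k l) = vip (r (s l)) (t k l) - vip (r (s k)) (t k l).
    rewrite -vipBl; [|by move=> i; apply: r2; case: (sP l)
      |by move=> i; apply: r2; case: (sP k)|exact: S2].
    by apply: eq_bigr => i _; apply: eq_ip => p _ //; rewrite /r /t; ring.
  have := key k _ (St k l); have := key l _ (St k l).
  have := vip_ge0 (t k l).
  set x := vip (t k l) (t k l) in e *; set y := vip (r (s l)) _ in e *.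
  set z := vip (r (s k)) _ in e *; set a := k.+1%:R^-1; set b := l.+1%:R^-1.
  have a0 : 0 < a by rewrite invr_gt0.
  have b0 : 0 < b by rewrite invr_gt0.
  move=> x0 hy hz; rewrite leNgt; apply/negP => xl.
  have xp : 0 < x by apply: lt_trans xl; rewrite mulr_gt0// addr_gt0.
  have : x * x <= 2 * (a + b) * x.
    have e2 : x * x = y ^+ 2 - 2 * y * z + z ^+ 2 by rewrite e; ring.
    by have := sqr_ge0 (y + z) => h; rewrite e2; nra.
  by rewrite ler_pM2r// leNgt xl.
have comp i k l : nsq (fun p => s k i p - s l i p) <= vip (t k l) (t k l).
  rewrite /vip (bigD1 i)//= (@eq_nsq _ _ (t k l i)); last by move=> p _; rewrite /t; ring.
  by rewrite nsqE lerDl sumr_ge0// => j _; rewrite -nsqE nsq_ge0.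
have /choice [V VP] : forall i, exists f, L2fun f /\ L2cvg (fun k => s k i) f.
  move=> i; apply: L2_complete; first by move=> k; apply: S2; case: (sP k).
  move=> e e0; have [N Ne] : exists N, forall k, (N <= k)%N -> k.+1%:R^-1 < e / 4.
    have := near_infty_natSinv_lt (PosNum (divr_gt0 e0 (ltr0n R 4))).
    by move=> [N _ NP]; exists N => k /NP.
  exists N => k l Nk Nl; apply: le_lt_trans (comp i k l) _.
  apply: le_lt_trans (tb k l) _; move: (Ne _ Nk) (Ne _ Nl).
  by move: (k.+1%:R^-1) (l.+1%:R^-1) => x y h1 h2; lra.
exists V; split; first by move=> i; case: (VP i).
  by exists s; split => [k|i]; [case: (sP k)|case: (VP i)].
move=> q Sq.
have c1 : vip (r (s k)) q @[k --> \oo] --> 0.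
  apply: cvg0_sqr; apply: (@cvg0_le _ (fun k => k.+1%:R^-1 * vip q q)).
    by move=> k; rewrite sqr_ge0 key.
  by rewrite -[0 in X in _ --> X](mul0r (vip q q)); apply: cvgMl; exact: cvg_harmonic.
have c2 : vip (r (s k)) q @[k --> \oo] --> vip (fun i p => U i p - V i p) q.
  have s2 k i : L2fun (s k i) by apply: S2; case: (sP k).
  rewrite vipBl//; [|by move=> i; case: (VP i)|exact: S2].
  have -> : (fun k => vip (r (s k)) q) = (fun k => vip U q - vip (s k) q).
    by apply/funext => k; rewrite vipBl//; exact: S2.
  apply: cvgB; first exact: cvg_cst.
  by apply: cvg_sum_ord => i; case: (VP i) => *; apply: L2cvg_ip => //; exact: S2.
by rewrite -(cvg_lim _ c1)// (cvg_lim _ c2).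
Qed.

End Projection.
End Limits.

(** * Smooth functions on the half-plane *)

Section Calculus.
Variable R : realType.
Implicit Types (f g : R * R -> R) (p q : R * R).

(** [px] is a total function with a default value where there is no derivative. [dX f p d] asserts
    both existence and value, so that the rules of calculus compose. *)
Definition dX f p (d : R) := is_derive p.1 (1 : R) (fun t : R => f (t, p.2)) d.
Definition dY f p (d : R) := is_derive p.2 (1 : R) (fun t : R => f (p.1, t)) d.

Lemma px_val f p d : dX f p d -> px f p = d.
Proof. by move=> h; rewrite /px derive1E; exact: (@derive_val _ _ _ _ _ _ _ h). Qed.

Lemma py_val f p d : dY f p d -> py f p = d.
Proof. by move=> h; rewrite /py derive1E; exact: (@derive_val _ _ _ _ _ _ _ h). Qed.

Lemma dX_px f p : derivable (fun t : R => f (t, p.2)) p.1 1 -> dX f p (px f p).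
Proof. by move=> h; apply: DeriveDef => //; rewrite /px derive1E. Qed.

Lemma dY_py f p : derivable (fun t : R => f (p.1, t)) p.2 1 -> dY f p (py f p).
Proof. by move=> h; apply: DeriveDef => //; rewrite /py derive1E. Qed.

Lemma dX_ex f p d : dX f p d -> derivable (fun t : R => f (t, p.2)) p.1 1.
Proof. by case. Qed.

Lemma dY_ex f p d : dY f p d -> derivable (fun t : R => f (p.1, t)) p.2 1.
Proof. by case. Qed.

Lemma open_Hp : open (@Hp R).
Proof.
rewrite (_ : Hp (R := R) = snd @^-1` [set t : R | 0 < t]) //.
by apply: open_comp; [move=> p _; exact: cvg_snd|exact: open_gt].
Qed.

Lemma near_Hp p : Hp p -> \forall q \near p, Hp q.
Proof. by move=> Hpp; apply: open_nbhs_nbhs; split => //; exact: open_Hp. Qed.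

Lemma nbhs2P p (P : R * R -> Prop) : (\forall q \near p, P q) <->
  exists2 e : R, 0 < e & forall q, `|q.1 - p.1| < e -> `|q.2 - p.2| < e -> P q.
Proof.
split.
  move=> /nbhs_ballP [e e0 eP]; exists e => // q q1 q2; apply: eP.
  by split; rewrite /ball /= distrC.
move=> [e e0 eP]; apply/nbhs_ballP; exists e => // q [q1 q2].
by apply: eP; rewrite distrC.
Qed.

Lemma near_hline p (P : R * R -> Prop) : (\forall q \near p, P q) ->
  \forall t \near p.1, P (t, p.2).
Proof.
move=> /nbhs2P [e e0 eP]; apply/nbhs_ballP; exists e => // t pt.
by apply: eP; [rewrite /= distrC|rewrite subrr normr0].
Qed.

Lemma near_vline p (P : R * R -> Prop) : (\forall q \near p, P q) ->
  \forall t \near p.2, P (p.1, t).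
Proof.
move=> /nbhs2P [e e0 eP]; apply/nbhs_ballP; exists e => // t pt.
by apply: eP; [rewrite subrr normr0|rewrite /= distrC].
Qed.

Lemma near_dX f g p d : (\forall q \near p, f q = g q) -> dX f p d -> dX g p d.
Proof. by move=> fg; apply: near_eq_is_derive; exact: (near_hline fg). Qed.

Lemma near_dY f g p d : (\forall q \near p, f q = g q) -> dY f p d -> dY g p d.
Proof. by move=> fg; apply: near_eq_is_derive; exact: (near_vline fg). Qed.

Lemma near_px f g p : (\forall q \near p, f q = g q) -> px f p = px g p.
Proof. by move=> fg; rewrite /px !derive1E; apply: near_eq_derive; exact: (near_hline fg). Qed.

Lemma near_py f g p : (\forall q \near p, f q = g q) -> py f p = py g p.
Proof. by move=> fg; rewrite /py !derive1E; apply: near_eq_derive; exact: (near_vline fg). Qed.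

Lemma near_near p (P : R * R -> Prop) : (\forall q \near p, P q) ->
  \forall q \near p, \forall r \near q, P r.
Proof. by move=> h; exact: near_join. Qed.

(** [px] and [py] depend on germs only, so regularity may be checked on a smooth function that
    agrees with [f] near the given point. *)
Lemma Ck_local n f : (forall p, Hp p -> exists g, Ck_on n g /\ \forall q \near p, g q = f q) ->
  Ck_on n f.
Proof.
elim: n f => [|n IH] f fl.
  move=> p Hpp; have [g [gc gf]] := fl _ Hpp.
  have := gc _ Hpp; rewrite /prop_for /continuous_at (nbhs_singleton gf).
  by apply: cvg_trans; exact: near_eq_cvg gf.
split; last split.
- move=> p Hpp; have [g [[gd _] gf]] := fl _ Hpp; have [g1 g2] := gd _ Hpp.
  by split; [apply: near_eq_derivable (near_hline gf) g1|apply: near_eq_derivable (near_vline gf) g2].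
- by apply: IH => p Hpp; have [g [[_ [gk _]] gf]] := fl _ Hpp; exists g.
- split; apply: IH => p Hpp; have [g [[_ [_ [gx gy]]] gf]] := fl _ Hpp.
    by exists (px g); split => //; apply: filterS (near_near gf) => q; exact: near_px.
  by exists (py g); split => //; apply: filterS (near_near gf) => q; exact: near_py.
Qed.

Lemma Ck_ext n f g : (forall p, Hp p -> f p = g p) -> Ck_on n f -> Ck_on n g.
Proof.
move=> fg fC; apply: Ck_local => p Hpp; exists f; split => //.
by apply: filterS (near_Hp Hpp); exact: fg.
Qed.

Lemma CkW n f : Ck_on n.+1 f -> Ck_on n f.
Proof. by case=> _ []. Qed.

Lemma Ck_dX n f p : Ck_on n.+1 f -> Hp p -> dX f p (px f p).
Proof. by move=> fC Hpp; apply: dX_px; exact: (fC.1 _ Hpp).1. Qed.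

Lemma Ck_dY n f p : Ck_on n.+1 f -> Hp p -> dY f p (py f p).
Proof. by move=> fC Hpp; apply: dY_py; exact: (fC.1 _ Hpp).2. Qed.

Lemma Ck_cont n f p : Ck_on n f -> Hp p -> {for p, continuous f}.
Proof. by elim: n => [|n IH] => [|/CkW]; [exact|exact: IH]. Qed.

Lemma dXD f g p a b : dX f p a -> dX g p b -> dX (fun q => f q + g q) p (a + b).
Proof. by move=> h k; exact: is_deriveD. Qed.
Lemma dYD f g p a b : dY f p a -> dY g p b -> dY (fun q => f q + g q) p (a + b).
Proof. by move=> h k; exact: is_deriveD. Qed.
Lemma dXN f p a : dX f p a -> dX (fun q => - f q) p (- a).
Proof. by move=> h; exact: is_deriveN. Qed.
Lemma dYN f p a : dY f p a -> dY (fun q => - f q) p (- a).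
Proof. by move=> h; exact: is_deriveN. Qed.
Lemma dXB f g p a b : dX f p a -> dX g p b -> dX (fun q => f q - g q) p (a - b).
Proof. by move=> h k; exact: is_deriveB. Qed.
Lemma dYB f g p a b : dY f p a -> dY g p b -> dY (fun q => f q - g q) p (a - b).
Proof. by move=> h k; exact: is_deriveB. Qed.
Lemma dX_eq f p a b : dX f p a -> a = b -> dX f p b.
Proof. by move=> h <-. Qed.
Lemma dY_eq f p a b : dY f p a -> a = b -> dY f p b.
Proof. by move=> h <-. Qed.
Lemma dXM f g p a b : dX f p a -> dX g p b ->
  dX (fun q => f q * g q) p (a * g p + f p * b).
Proof.
case: p => x y h k.
have H : dX (fun q => f q * g q) (x, y) (f (x, y) *: b + g (x, y) *: a) := is_deriveM h k.
by apply: dX_eq H _; rewrite addrC mulrC.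
Qed.
Lemma dYM f g p a b : dY f p a -> dY g p b ->
  dY (fun q => f q * g q) p (a * g p + f p * b).
Proof.
case: p => x y h k.
have H : dY (fun q => f q * g q) (x, y) (f (x, y) *: b + g (x, y) *: a) := is_deriveM h k.
by apply: dY_eq H _; rewrite addrC mulrC.
Qed.
Lemma dX_cst (c : R) p : dX (fun=> c) p 0.
Proof. exact: is_derive_cst. Qed.
Lemma dY_cst (c : R) p : dY (fun=> c) p 0.
Proof. exact: is_derive_cst. Qed.
Lemma dX_fst p : dX fst p 1.
Proof. exact: is_derive_id. Qed.
Lemma dY_fst p : dY fst p 0.
Proof. exact: is_derive_cst. Qed.
Lemma dX_snd p : dX snd p 0.
Proof. exact: is_derive_cst. Qed.
Lemma dY_snd p : dY snd p 1.
Proof. exact: is_derive_id. Qed.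
Lemma dXZ c f p a : dX f p a -> dX (fun q => c * f q) p (c * a).
Proof. by move=> h; have := dXM (dX_cst c p) h; rewrite mul0r add0r. Qed.
Lemma dYZ c f p a : dY f p a -> dY (fun q => c * f q) p (c * a).
Proof. by move=> h; have := dYM (dY_cst c p) h; rewrite mul0r add0r. Qed.
Lemma dXV f p a : f p != 0 -> dX f p a -> dX (fun q => (f q)^-1) p (- a * ((f p)^-1 * (f p)^-1)).
Proof.
case: p => x y f0 h.
have H : dX (fun q => (f q)^-1) (x, y) (- (f (x, y)) ^- 2 *: a) := @is_deriveV _ (fun t => f (t, y)) x a 1 f0 h.
by apply: dX_eq H _; rewrite /GRing.scale /= -exprVn; ring.
Qed.
Lemma dYV f p a : f p != 0 -> dY f p a -> dY (fun q => (f q)^-1) p (- a * ((f p)^-1 * (f p)^-1)).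
Proof.
case: p => x y f0 h.
have H : dY (fun q => (f q)^-1) (x, y) (- (f (x, y)) ^- 2 *: a) := @is_deriveV _ (fun t => f (x, t)) y a 1 f0 h.
by apply: dY_eq H _; rewrite /GRing.scale /= -exprVn; ring.
Qed.
Lemma dX_comp (h : R -> R) f p a b : is_derive (f p) 1 h b -> dX f p a ->
  dX (fun q => h (f q)) p (b * a).
Proof. by case: p => x y hd fd; exact: is_derive1_comp. Qed.
Lemma dY_comp (h : R -> R) f p a b : is_derive (f p) 1 h b -> dY f p a ->
  dY (fun q => h (f q)) p (b * a).
Proof. by case: p => x y hd fd; exact: is_derive1_comp. Qed.

Lemma Ck_cst n c : Ck_on n (fun _ : R * R => c).
Proof.
elim: n c => [|n IH] c; first by move=> p _; exact: cvg_cst.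
split; first by move=> p _; split; [exact: dX_ex (dX_cst c p)|exact: dY_ex (dY_cst c p)].
split => //; split; apply: Ck_ext (IH 0) => p _.
  by rewrite (px_val (dX_cst c p)).
by rewrite (py_val (dY_cst c p)).
Qed.

Lemma Ck_fst n : Ck_on n (@fst R R).
Proof.
elim: n => [|n IH]; first by move=> p _; exact: cvg_fst.
split; first by move=> p _; split; [exact: dX_ex (dX_fst p)|exact: dY_ex (dY_fst p)].
split => //; split; [apply: Ck_ext (Ck_cst _ 1)|apply: Ck_ext (Ck_cst _ 0)] => p _.
  by rewrite (px_val (dX_fst p)).
by rewrite (py_val (dY_fst p)).
Qed.

Lemma Ck_snd n : Ck_on n (@snd R R).
Proof.
elim: n => [|n IH]; first by move=> p _; exact: cvg_snd.
split; first by move=> p _; split; [exact: dX_ex (dX_snd p)|exact: dY_ex (dY_snd p)].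
split => //; split; [apply: Ck_ext (Ck_cst _ 0)|apply: Ck_ext (Ck_cst _ 1)] => p _.
  by rewrite (px_val (dX_snd p)).
by rewrite (py_val (dY_snd p)).
Qed.

Lemma CkD n f g : Ck_on n f -> Ck_on n g -> Ck_on n (fun p => f p + g p).
Proof.
elim: n f g => [|n IH] f g fC gC; first by move=> p Hpp; apply: cvgD; [exact: fC|exact: gC].
have X p (Hpp : Hp p) := dXD (Ck_dX fC Hpp) (Ck_dX gC Hpp).
have Y p (Hpp : Hp p) := dYD (Ck_dY fC Hpp) (Ck_dY gC Hpp).
case: fC => _ [fk [fx fy]]; case: gC => _ [gk [gx gy]].
split; first by move=> p Hpp; split; [exact: dX_ex (X p Hpp)|exact: dY_ex (Y p Hpp)].
split; first exact: IH.
split; [apply: Ck_ext (IH _ _ fx gx)|apply: Ck_ext (IH _ _ fy gy)] => p Hpp.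
  by rewrite (px_val (X p Hpp)).
by rewrite (py_val (Y p Hpp)).
Qed.

Lemma CkM n f g : Ck_on n f -> Ck_on n g -> Ck_on n (fun p => f p * g p).
Proof.
elim: n f g => [|n IH] f g fC gC; first by move=> p Hpp; apply: cvgM; [exact: fC|exact: gC].
have X p (Hpp : Hp p) := dXM (Ck_dX fC Hpp) (Ck_dX gC Hpp).
have Y p (Hpp : Hp p) := dYM (Ck_dY fC Hpp) (Ck_dY gC Hpp).
case: fC => _ [fk [fx fy]]; case: gC => _ [gk [gx gy]].
split; first by move=> p Hpp; split; [exact: dX_ex (X p Hpp)|exact: dY_ex (Y p Hpp)].
split; first exact: IH.
split; [apply: Ck_ext (CkD (IH _ _ fx gk) (IH _ _ fk gx))
       |apply: Ck_ext (CkD (IH _ _ fy gk) (IH _ _ fk gy))] => p Hpp.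
  by rewrite (px_val (X p Hpp)).
by rewrite (py_val (Y p Hpp)).
Qed.

Lemma CkZ n c f : Ck_on n f -> Ck_on n (fun p => c * f p).
Proof. by move=> fC; apply: CkM => //; exact: Ck_cst. Qed.

Lemma CkN n f : Ck_on n f -> Ck_on n (fun p => - f p).
Proof. by move=> /(CkZ (-1)); apply: Ck_ext => p _; rewrite mulN1r. Qed.

Lemma CkB n f g : Ck_on n f -> Ck_on n g -> Ck_on n (fun p => f p - g p).
Proof. by move=> fC /CkN; exact: CkD. Qed.

Lemma CkV n f : (forall p, Hp p -> f p != 0) -> Ck_on n f -> Ck_on n (fun p => (f p)^-1).
Proof.
move=> f0; elim: n => [|n IH] fC.
  by move=> p Hpp; apply: cvgV; [exact: f0|exact: fC].
have X p (Hpp : Hp p) := dXV (f0 _ Hpp) (Ck_dX fC Hpp).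
have Y p (Hpp : Hp p) := dYV (f0 _ Hpp) (Ck_dY fC Hpp).
case: fC => _ [fk [fx fy]]; have fi := IH fk.
split; first by move=> p Hpp; split; [exact: dX_ex (X p Hpp)|exact: dY_ex (Y p Hpp)].
split => //.
split; [apply: Ck_ext (CkM (CkN fx) (CkM fi fi))|apply: Ck_ext (CkM (CkN fy) (CkM fi fi))] => p Hpp.
  by rewrite (px_val (X p Hpp)).
by rewrite (py_val (Y p Hpp)).
Qed.

(** Functions of one variable are viewed as functions on the half-plane that do not depend on [y],
    which makes the calculus of [Ck_on] available to them. *)
Definition smooth1 (h : R -> R) := smooth_on (fun p : R * R => h p.1).

Lemma Hp1 (t : R) : Hp (t, 1 : R).
Proof. exact: ltr01. Qed.

Lemma smooth1_derive n (h : R -> R) (t : R) : Ck_on n.+1 (fun p : R * R => h p.1) ->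
  is_derive t (1 : R) h (derive1 h t).
Proof. by move=> hC; exact: (Ck_dX hC (Hp1 t)). Qed.

Lemma Ck_comp n (h : R -> R) f : Ck_on n (fun p : R * R => h p.1) -> Ck_on n f ->
  Ck_on n (fun p => h (f p)).
Proof.
elim: n h f => [|n IH] h f hC fC.
  move=> p Hpp; apply: (@continuous_comp _ _ _ f h); first exact: fC.
  have hc := hC _ (Hp1 (f p)).
  apply/cvgrPdist_lt => e e0; have /cvgrPdist_lt /(_ _ e0) := hc.
  exact: near_hline.
have X p (Hpp : Hp p) := dX_comp (smooth1_derive (f p) hC) (Ck_dX fC Hpp).
have Y p (Hpp : Hp p) := dY_comp (smooth1_derive (f p) hC) (Ck_dY fC Hpp).
case: fC => _ [fk [fx fy]]; case: hC => _ [hk [hx _]].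
split; first by move=> p Hpp; split; [exact: dX_ex (X p Hpp)|exact: dY_ex (Y p Hpp)].
split; first exact: IH.
split; [apply: Ck_ext (CkM (IH _ _ hx fk) fx)|apply: Ck_ext (CkM (IH _ _ hx fk) fy)] => p Hpp.
  by rewrite (px_val (X p Hpp)).
by rewrite (py_val (Y p Hpp)).
Qed.

Lemma smooth_px f : smooth_on f -> smooth_on (px f).
Proof. by move=> fC n; case: (fC n.+1) => _ [_ []]. Qed.
Lemma smooth_py f : smooth_on f -> smooth_on (py f).
Proof. by move=> fC n; case: (fC n.+1) => _ [_ []]. Qed.
Lemma smooth_dX f p : smooth_on f -> Hp p -> dX f p (px f p).
Proof. by move=> fC; exact: (Ck_dX (fC 1%N)). Qed.
Lemma smooth_dY f p : smooth_on f -> Hp p -> dY f p (py f p).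
Proof. by move=> fC; exact: (Ck_dY (fC 1%N)). Qed.

Lemma mean_value (h dh : R -> R) (a b : R) : a < b ->
  (forall t, a <= t <= b -> is_derive t (1 : R) h (dh t)) ->
  exists2 c, a <= c <= b & h b - h a = dh c * (b - a).
Proof.
move=> ab hd; have [||c] := @MVT _ h dh a b ab.
- by move=> t; rewrite in_itv /= => /andP[at' tb]; apply: hd; rewrite !ltW.
- apply: derivable_within_continuous => t; rewrite in_itv /= => tab.
  by have [] := hd _ tab.
by rewrite in_itv /= => /andP[ac cb] E; exists c => //; rewrite !ltW.
Qed.

Lemma mvt_bound (h dh : R -> R) (a b M : R) :
  (forall t, `|t - a| <= `|b - a| -> is_derive t (1 : R) h (dh t) /\ `|dh t| <= M) ->
  `|h b - h a| <= M * `|b - a|.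
Proof.
move=> H; have [ab|ba|->] := ltgtP a b; last by rewrite !subrr normr0 mulr0.
- have [|c /andP[ac cb] ->] := @mean_value h dh a b ab.
    move=> t /andP[at' tb]; apply: (H t _).1.
    by rewrite !ger0_norm ?subr_ge0// ?lerD2r// ltW.
  rewrite normrM ler_wpM2r//; apply: (H c _).2.
  by rewrite !ger0_norm ?subr_ge0// ?lerD2r// ltW.
- have [|c /andP[bc ca] E] := @mean_value h dh b a ba.
    move=> t /andP[bt ta]; apply: (H t _).1.
    by rewrite !ler0_norm ?subr_le0// ?lerN2 ?lerD2r// ltW.
  rewrite distrC E normrM (distrC b a) ler_wpM2r//; apply: (H c _).2.
  by rewrite !ler0_norm ?subr_le0// ?lerN2 ?lerD2r// ltW.
Qed.

(** Join the points by a horizontal and a vertical segment, both inside the square of half-side [e]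
    around [p], and apply the mean value inequality to each. *)
Lemma lip_of_partials f (M e : R) p q :
  (forall r, `|r.1 - p.1| < e -> `|r.2 - p.2| < e ->
     [/\ dX f r (px f r), dY f r (py f r), `|px f r| <= M & `|py f r| <= M]) ->
  `|q.1 - p.1| < e -> `|q.2 - p.2| < e ->
  `|f q - f p| <= M * (`|q.1 - p.1| + `|q.2 - p.2|).
Proof.
case: p q => [p1 p2] [q1 q2] /= H h1 h2.
have e0 : 0 < e by exact: le_lt_trans h1.
have -> : f (q1, q2) - f (p1, p2) =
   (f (q1, q2) - f (p1, q2)) + (f (p1, q2) - f (p1, p2)) by ring.
apply: le_trans (ler_normD _ _) _; rewrite mulrDr lerD//.
  apply: (@mvt_bound (fun t => f (t, q2)) (fun t => px f (t, q2))) => t tp.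
  by have [] := H (t, q2) (le_lt_trans tp h1) h2.
apply: (@mvt_bound (fun t => f (p1, t)) (fun t => py f (p1, t))) => t tp.
have pe : `|(p1, t).1 - p1| < e by rewrite subrr normr0.
by have [] := H (p1, t) pe (le_lt_trans tp h2).
Qed.

(** Derivability in each variable separately does not give continuity; a local bound on the partial
    derivatives does, through the Lipschitz estimate. *)
Lemma cont_of_partials f p (M : R) :
  (\forall q \near p, [/\ dX f q (px f q), dY f q (py f q), `|px f q| <= M & `|py f q| <= M]) ->
  {for p, continuous f}.
Proof.
move=> /nbhs2P [e e0 H]; apply/cvgrPdist_lt => d d0.
have M0 : 0 <= M.
  have [||_ _ + _] := H p; rewrite ?subrr ?normr0//.
  exact: le_trans.
pose k := Num.min e (d / (2 * (M + 1))).
have k0 : 0 < k by rewrite lt_min e0 divr_gt0// mulr_gt0// ltr_wpDl.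
apply/nbhs2P; exists k => // q h1 h2; rewrite distrC.
apply: (@le_lt_trans _ _ (M * (`|q.1 - p.1| + `|q.2 - p.2|))).
  apply: (@lip_of_partials _ _ e) => //.
    by apply: lt_le_trans h1 _; rewrite ge_min lexx.
  by apply: lt_le_trans h2 _; rewrite ge_min lexx.
have kd : k <= d / (2 * (M + 1)) by rewrite ge_min lexx orbT.
have : (M + 1) * (2 * (d / (2 * (M + 1)))) = d by field; rewrite gt_eqF// ltr_wpDl.
move: (normr_ge0 (q.1 - p.1)) (normr_ge0 (q.2 - p.2)) => n1 n2 E.
by nra.
Qed.

(** Continuous partial derivatives are locally bounded, so [f] is continuous; the lower orders that
    [Ck_on] asks of [f] follow by induction. Later inductions need only look at the derivatives. *)
Lemma Ck_partials n f : (forall p, Hp p -> dX f p (px f p) /\ dY f p (py f p)) ->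
  Ck_on n (px f) -> Ck_on n (py f) -> Ck_on n.+1 f.
Proof.
move=> fd; elim: n => [|n IH] fx fy.
  split; first by move=> p /fd[h k]; split; [exact: dX_ex h|exact: dY_ex k].
  split; last by split.
  move=> p Hpp; apply: (@cont_of_partials _ _ (`|px f p| + `|py f p| + 1)).
  have /cvgrPdist_lt /(_ _ ltr01) cx := fx _ Hpp.
  have /cvgrPdist_lt /(_ _ ltr01) cy := fy _ Hpp.
  apply: filterS3 (near_Hp Hpp) cx cy => q Hq hx hy.
  have [hX hY] := fd _ Hq; split => //.
    have := ler_normB (px f p) (px f p - px f q); rewrite opprB addrC subrK => /le_trans; apply.
    by rewrite -addrA lerD2l; have := normr_ge0 (py f p); lra.
  have := ler_normB (py f p) (py f p - py f q); rewrite opprB addrC subrK => /le_trans; apply.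
  by have := normr_ge0 (px f p); lra.
split; first by move=> p /fd[h k]; split; [exact: dX_ex h|exact: dY_ex k].
by split; [apply: IH; exact: CkW|split].
Qed.

(** The second difference of [f] over the square, evaluated by the mean value theorem first in [x]
    then in [y], and in the opposite order. *)
Lemma schwarz_box f fx fy fxy fyx (x y h : R) : 0 < h ->
  (forall s t, x <= s <= x + h -> y <= t <= y + h ->
    [/\ is_derive s (1 : R) (fun s => f (s, t)) (fx (s, t)),
        is_derive t (1 : R) (fun t => f (s, t)) (fy (s, t)),
        is_derive t (1 : R) (fun t => fx (s, t)) (fxy (s, t)) &
        is_derive s (1 : R) (fun s => fy (s, t)) (fyx (s, t))]) ->
  exists c c' k k', [/\ x <= c <= x + h, y <= c' <= y + h, x <= k <= x + h,
    y <= k' <= y + h & fxy (c, c') = fyx (k, k')].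
Proof.
move=> h0 H.
have xx : x <= x <= x + h by rewrite lexx lerDl ltW.
have yy : y <= y <= y + h by rewrite lexx lerDl ltW.
have xh : x <= x + h <= x + h by rewrite lexx lerDl ltW.
have yh : y <= y + h <= y + h by rewrite lexx lerDl ltW.
have xlt : x < x + h by rewrite ltrDl.
have ylt : y < y + h by rewrite ltrDl.
pose D := f (x + h, y + h) - f (x + h, y) - (f (x, y + h) - f (x, y)).
have [c hc Ec] : exists2 c, x <= c <= x + h &
    D = (fx (c, y + h) - fx (c, y)) * (x + h - x).
  apply: (@mean_value (fun s => f (s, y + h) - f (s, y)) (fun s => fx (s, y + h) - fx (s, y)) _ _ xlt) => s hs.
  have [h1 _ _ _] := H _ _ hs yh; have [h2 _ _ _] := H _ _ hs yy; exact: is_deriveB.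
have [c' hc' Ec'] : exists2 c', y <= c' <= y + h &
    fx (c, y + h) - fx (c, y) = fxy (c, c') * (y + h - y).
  apply: (@mean_value (fun t => fx (c, t)) (fun t => fxy (c, t)) _ _ ylt) => t ht.
  by have [] := H _ _ hc ht.
have [k' hk' Ek] : exists2 k, y <= k <= y + h &
    f (x + h, y + h) - f (x, y + h) - (f (x + h, y) - f (x, y)) =
    (fy (x + h, k) - fy (x, k)) * (y + h - y).
  apply: (@mean_value (fun t => f (x + h, t) - f (x, t)) (fun t => fy (x + h, t) - fy (x, t)) _ _ ylt) => t ht.
  have [_ h1 _ _] := H _ _ xh ht; have [_ h2 _ _] := H _ _ xx ht; exact: is_deriveB.
have [k hk Ek'] : exists2 k, x <= k <= x + h &
    fy (x + h, k') - fy (x, k') = fyx (k, k') * (x + h - x).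
  apply: (@mean_value (fun s => fy (s, k')) (fun s => fyx (s, k')) _ _ xlt) => s hs.
  by have [] := H _ _ hs hk'.
exists c, c', k, k'; split => //.
have hh : h * h != 0 by rewrite mulf_neq0// gt_eqF.
apply: (mulIf hh).
have e1 : D = fxy (c, c') * (h * h) by rewrite Ec Ec'; ring.
have e2 : D = fyx (k, k') * (h * h).
  transitivity (f (x + h, y + h) - f (x, y + h) - (f (x + h, y) - f (x, y))).
    by rewrite /D; ring.
  by rewrite Ek Ek'; ring.
by rewrite -e1 -e2.
Qed.

(** The squares of [schwarz_box] with corner [p] may be taken so small that both mixed derivatives
    are within [e] of their values at [p]. *)
Lemma schwarz f fx fy fxy fyx p :
  (\forall q \near p, [/\ dX f q (fx q), dY f q (fy q), dY fx q (fxy q) & dX fy q (fyx q)]) ->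
  {for p, continuous fxy} -> {for p, continuous fyx} -> fxy p = fyx p.
Proof.
move=> der cx cy.
suff H : forall e, 0 < e -> `|fxy p - fyx p| <= e + e.
  apply/eqP; rewrite -subr_eq0 -normr_le0; apply/ler_addgt0Pr => e e0.
  by rewrite add0r; apply: le_trans (H _ (divr_gt0 e0 (ltr0n R 2))) _; rewrite -splitr.
move=> e e0.
move: cx cy => /cvgrPdist_lt /(_ _ e0) cx /cvgrPdist_lt /(_ _ e0) cy.
have [d d0] := (nbhs2P _ _).1 (filterI der (filterI cx cy)).
case: p {der cx cy} => x y /= H.
pose h := d / 2; have h0 : 0 < h by rewrite divr_gt0.
have hd : h < d by rewrite /h ltr_pdivrMr// mulr_natr mulr2n ltrDl.
have box s t : x <= s <= x + h -> y <= t <= y + h -> `|s - x| < d /\ `|t - y| < d.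
  move=> /andP[s1 s2] /andP[t1 t2]; rewrite !ger0_norm ?subr_ge0//.
  by split; apply: le_lt_trans hd; rewrite lerBlDl.
have [|c [c' [k [k' [hc hc' hk hk' E]]]]] := @schwarz_box f fx fy fxy fyx x y h h0.
  by move=> s t hs ht; have [b1 b2] := box _ _ hs ht; have [] := H (s, t) b1 b2.
have [b1 b2] := box _ _ hc hc'; have [b3 b4] := box _ _ hk hk'.
have [_ [h1 _]] := H (c, c') b1 b2; have [_ [_ h2]] := H (k, k') b3 b4.
rewrite /= in h1 h2.
have -> : fxy (x, y) - fyx (x, y) =
  (fxy (x, y) - fxy (c, c')) - (fyx (x, y) - fyx (k, k')) by rewrite E; ring.
exact: (le_trans (ler_normB _ _) (lerD (ltW h1) (ltW h2))).
Qed.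

Lemma clairaut f p : Ck_on 2 f -> Hp p -> px (py f) p = py (px f) p.
Proof.
move=> fC Hpp; apply/esym.
have fx1 : Ck_on 1 (px f) := fC.2.2.1.
have fy1 : Ck_on 1 (py f) := fC.2.2.2.
apply: (@schwarz f (px f) (py f)).
- apply: filterS (near_Hp Hpp) => q Hq.
  split; [exact: Ck_dX fC Hq|exact: Ck_dY fC Hq|exact: Ck_dY fx1 Hq|exact: Ck_dX fy1 Hq].
- exact: (fx1.2.2.2 _ Hpp).
- exact: (fy1.2.2.1 _ Hpp).
Qed.

End Calculus.
#[global] Opaque Ck_on.

(** * Test functions, their supports and measurability *)

Section TestFunctions.
Variable R : realType.
Implicit Types (f g : R * R -> R) (p q : R * R) (a b : R).

(** For [0 < a] these rectangles are compact in the half-plane and exhaust it, so that two numbers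
    encode a compact support. *)
Definition box a b : set (R * R) := `[- b, b] `*` `[a, b].

Lemma boxP a b p : box a b p <-> (- b <= p.1 <= b) /\ (a <= p.2 <= b).
Proof. by rewrite /box /setX /= !in_itv. Qed.

Lemma compact_box a b : compact (box a b).
Proof. by apply: compact_setX; exact: segment_compact. Qed.

Lemma near_nbox a b p : ~ box a b p -> \forall q \near p, ~ box a b q.
Proof.
move=> np; apply: open_nbhs_nbhs; split => //.
apply: (@closed_openC _ (box a b)); apply: compact_closed; last exact: compact_box.
exact: norm_hausdorff.
Qed.

Lemma box_Hp a b p : 0 < a -> box a b p -> Hp p.
Proof. by move=> a0 /boxP[_ /andP[h _]]; exact: lt_le_trans h. Qed.

Lemma box_sub a b a' b' p : a' <= a -> b <= b' -> box a b p -> box a' b' p.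
Proof.
move=> aa bb /boxP[/andP[h1 h2] /andP[h3 h4]]; apply/boxP.
by split; apply/andP; split => //; lra.
Qed.

Definition supp_in f a b := forall p, ~ box a b p -> f p = 0.

(** Boundedness of the compact set gives [b]. Its projection to the second coordinate is compact and
    misses 0, which gives [a]. *)
Lemma tf_box f : test_fun f -> exists a b, [/\ 0 < a, 0 < b & supp_in f a b].
Proof.
move=> [_ [K [cK [KH fK]]]].
have [M [Mr MK]] := compact_bounded cK.
have cK' : compact (snd @` K).
  apply: continuous_compact => //; apply: continuous_subspaceT => p; exact: cvg_snd.
have oK' : open (~` (snd @` K)).
  by apply: closed_openC; apply: compact_closed cK'; exact: norm_hausdorff.
have n0 : (~` (snd @` K)) (0 : R).
  by move=> [q /KH]; rewrite /Hp /= => h E; move: h; rewrite E ltxx.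
have /nbhs_ballP [a a0 aP] : nbhs (0 : R) (~` (snd @` K)) by exact: open_nbhs_nbhs.
pose b := `|M| + 1.
have b0 : 0 < b by rewrite /b ltr_wpDl.
exists a, b; split => // p np; apply: fK => Kp; apply: np; apply/boxP.
have : `|p| <= b by apply: MK Kp; rewrite /b (le_lt_trans (ler_norm M))// ltrDl.
rewrite prod_normE ge_max => /andP[h1 h2].
split; first by rewrite -ler_norml.
apply/andP; split; last exact: le_trans (ler_norm _) h2.
rewrite leNgt; apply/negP => pa; have p0 : 0 < p.2 by exact: KH.
by apply: (aP p.2); [rewrite /ball /= sub0r normrN gtr0_norm|exists p].
Qed.

Lemma box_tf f a b : 0 < a -> smooth_on f -> supp_in f a b -> test_fun f.
Proof.
move=> a0 fC fs; split => //; exists (box a b); split; first exact: compact_box.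
by split => // p; exact: box_Hp.
Qed.

(** The support stays away from the boundary. Hence test functions are differentiable on the whole
    plane, and Fubini's theorem can be applied along entire lines. *)
Lemma tf_near0 f p : test_fun f -> ~ Hp p -> \forall q \near p, f q = 0.
Proof.
move=> /tf_box[a [b [a0 b0 fs]]] np.
have : \forall q \near p, ~ box a b q by apply: near_nbox => /(box_Hp a0).
by apply: filterS; exact: fs.
Qed.

Lemma tf_cont f p : test_fun f -> {for p, continuous f}.
Proof.
move=> tf; have [Hpp|nHp] := pselect (Hp p); first exact: (tf.1 0%N).
have f0 := tf_near0 tf nHp.
rewrite /prop_for /continuous_at (nbhs_singleton f0).
apply/cvgrPdist_lt => e e0; apply: filterS f0 => q ->.
by rewrite subrr normr0.
Qed.

Lemma near0_dX f p : (\forall q \near p, f q = 0) -> dX f p 0.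
Proof.
move=> f0; apply: near_dX (dX_cst 0 p); by apply: filterS f0 => q ->.
Qed.

Lemma near0_dY f p : (\forall q \near p, f q = 0) -> dY f p 0.
Proof.
move=> f0; apply: near_dY (dY_cst 0 p); by apply: filterS f0 => q ->.
Qed.

Lemma tf_dX f p : test_fun f -> dX f p (px f p).
Proof.
move=> tf; have [Hpp|nHp] := pselect (Hp p); first exact: smooth_dX tf.1 Hpp.
by have h := near0_dX (tf_near0 tf nHp); rewrite (px_val h).
Qed.

Lemma tf_dY f p : test_fun f -> dY f p (py f p).
Proof.
move=> tf; have [Hpp|nHp] := pselect (Hp p); first exact: smooth_dY tf.1 Hpp.
by have h := near0_dY (tf_near0 tf nHp); rewrite (py_val h).
Qed.

Lemma supp_px f a b : supp_in f a b -> supp_in (px f) a b.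
Proof.
move=> fs p np; apply: px_val; apply: near0_dX.
by apply: filterS (near_nbox np); exact: fs.
Qed.

Lemma supp_py f a b : supp_in f a b -> supp_in (py f) a b.
Proof.
move=> fs p np; apply: py_val; apply: near0_dY.
by apply: filterS (near_nbox np); exact: fs.
Qed.

Lemma tf_px f : test_fun f -> test_fun (px f).
Proof.
move=> tf; have [a [b [a0 b0 fs]]] := tf_box tf.
by apply: (box_tf a0 (smooth_px tf.1)); exact: supp_px fs.
Qed.

Lemma tf_py f : test_fun f -> test_fun (py f).
Proof.
move=> tf; have [a [b [a0 b0 fs]]] := tf_box tf.
by apply: (box_tf a0 (smooth_py tf.1)); exact: supp_py fs.
Qed.

Lemma smoothM_tf f g : smooth_on f -> test_fun g -> test_fun (fun p => f p * g p).
Proof.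
move=> fC tg; have [a [b [a0 b0 gs]]] := tf_box tg.
apply: (@box_tf _ a b) => //; first by move=> n; apply: CkM; [exact: fC|exact: tg.1].
by move=> p np; rewrite gs// mulr0.
Qed.

Lemma tf_eq f g : (forall p, f p = g p) -> test_fun f -> test_fun g.
Proof. by move=> /funext ->. Qed.

Lemma tfM f g : test_fun f -> test_fun g -> test_fun (fun p => f p * g p).
Proof. by case=> fC _; exact: smoothM_tf. Qed.

Lemma tfZ c f : test_fun f -> test_fun (fun p => c * f p).
Proof. by apply: smoothM_tf => n; exact: Ck_cst. Qed.

Lemma tfN f : test_fun f -> test_fun (fun p => - f p).
Proof. by move=> /(tfZ (-1)); apply: tf_eq => p; rewrite mulN1r. Qed.

Lemma supp_sub f a b a' b' : a' <= a -> b <= b' -> supp_in f a b -> supp_in f a' b'.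
Proof. by move=> aa bb fs p np; apply: fs => bp; apply: np; exact: box_sub bp. Qed.

Lemma tfD f g : test_fun f -> test_fun g -> test_fun (fun p => f p + g p).
Proof.
move=> tf tg; have [a [b [a0 b0 fs]]] := tf_box tf; have [c [d [c0 d0 gs]]] := tf_box tg.
apply: (@box_tf _ (Num.min a c) (Num.max b d)).
- by rewrite lt_min a0.
- by move=> n; apply: CkD; [exact: tf.1|exact: tg.1].
- move=> p np; rewrite (supp_sub _ _ fs np) ?(supp_sub _ _ gs np) ?addr0//.
  all: by rewrite ?ge_min ?le_max ?lexx ?orbT.
Qed.

Lemma tfB f g : test_fun f -> test_fun g -> test_fun (fun p => f p - g p).
Proof. by move=> tf /tfN; exact: tfD. Qed.

Lemma tf0 : test_fun (fun _ : R * R => 0 : R).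
Proof. by apply: (@box_tf _ 1 1) => // n; exact: Ck_cst. Qed.

Lemma tf_bounded f : test_fun f -> exists2 M, 0 < M & forall p, `|f p| <= M.
Proof.
move=> tf; have [a [b [a0 b0 fs]]] := tf_box tf.
have : compact (f @` box a b).
  apply: continuous_compact (@compact_box a b); apply: continuous_subspaceT => p.
  exact: tf_cont.
move=> /compact_bounded [M [_ MP]]; exists (`|M| + 1); first by rewrite ltr_wpDl.
have M1 : M < `|M| + 1 by rewrite (le_lt_trans (ler_norm M))// ltrDl.
move=> p; have [bp|np] := pselect (box a b p); first by apply: MP M1 _ _; exists p.
by rewrite fs// normr0 addr_ge0.
Qed.

(** An open set is a countable union of open squares with rational centre and half-side, and these
    are products of intervals. *)
Lemma open_RR_measurable (A : set (RR R)) : open (A : set (R * R)) -> measurable A.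
Proof.
move=> oA.
pose B (x : rat * rat * rat) : set (RR R) :=
  [set q : R * R | `|q.1 - ratr x.1.1| < ratr x.2 /\ `|q.2 - ratr x.1.2| < ratr x.2].
have mB x : measurable (B x).
  have -> : B x = `]ratr x.1.1 - ratr x.2, ratr x.1.1 + ratr x.2[%classic `*`
                  `]ratr x.1.2 - ratr x.2, ratr x.1.2 + ratr x.2[%classic.
    by apply/seteqP; split => q; rewrite /B /setX /= !in_itv /= !ltr_distl.
  by apply: measurableX; exact: measurable_itv.
pose C x := if pselect (B x `<=` A) then B x else set0.
have -> : A = \bigcup_x C x.
  apply/seteqP; split => [p Ap|p [x _]]; last first.
    by rewrite /C; case: pselect => // h; exact: h.
  have /nbhs2P [e e0 eA] : \forall q \near (p : R * R), A q by exact: open_nbhs_nbhs.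
  have e40 : 0 < e / 4 by rewrite divr_gt0.
  have [r1] := @rat_in_itvoo R (p.1 - e / 4) p.1 (ltac:(by rewrite ltrBlDr ltrDl)).
  have [r2] := @rat_in_itvoo R (p.2 - e / 4) p.2 (ltac:(by rewrite ltrBlDr ltrDl)).
  have [r3] := @rat_in_itvoo R (e / 4) (e / 2) (ltac:(by rewrite ltr_pM2l// ltf_pV2 ?posrE// ltr_nat)).
  rewrite !in_itv /= => /andP[h1 h2] /andP[h3 h4] /andP[h5 h6].
  have pB : B (r1, r2, r3) p by rewrite /B /= !ltr_norml; split; lra.
  exists (r1, r2, r3) => //; rewrite /C; case: pselect => // -[] q.
  rewrite /B /= !ltr_norml => -[/andP[k1 k2] /andP[k3 k4]]; apply: eA; rewrite ltr_norml; lra.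
apply: countable_bigcupT_measurable; first exact: countableP.
by move=> x; rewrite /C; case: (pselect (B x `<=` A)) => h; [exact: mB|exact: measurable0].
Qed.

Lemma cont_measH f : (forall p, Hp p -> {for p, continuous f}) -> measH f.
Proof.
move=> fc mD; apply: (measurability _ (RGenOInfty.measurableE R)) => //.
move=> /= _ [_ [x ->] <-]; apply: open_RR_measurable; rewrite openE => p [Hpp].
rewrite /= in_itv /= andbT => xf; apply: filterS2 (near_Hp Hpp) _; first by move=> q; exact: conj.
have /cvgrPdist_lt /(_ (f p - x)) := fc _ Hpp; rewrite subr_gt0 => /(_ xf).
by apply: filterS => q; rewrite /= in_itv /= andbT ltr_norml => /andP[_]; lra.
Qed.

Lemma smooth_measH f : smooth_on f -> measH f.
Proof. by move=> fC; apply: cont_measH => p; exact: (fC 0%N). Qed.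

Lemma cont_measT f : (forall p, {for p, continuous f}) ->
  measurable_fun [set: RR R] (f : RR R -> R).
Proof.
move=> fc mD; apply: (measurability _ (RGenOInfty.measurableE R)) => //.
move=> /= _ [_ [x ->] <-]; rewrite setTI; apply: open_RR_measurable; rewrite openE => p.
rewrite /= in_itv /= andbT => xf.
have /cvgrPdist_lt /(_ (f p - x)) := fc p; rewrite subr_gt0 => /(_ xf).
by apply: filterS => q; rewrite /= in_itv /= andbT ltr_norml => /andP[_]; lra.
Qed.

Lemma measurable_box a b : measurable (box a b : set (RR R)).
Proof. by apply: measurableX; exact: measurable_itv. Qed.

Lemma integrable_box a b : integrableH (\1_(box a b)).
Proof.
have mb := measurable_box a b.
apply/integrableP; split; first by apply: measH_EFin; exact: measurable_indic.
rewrite (eq_integral (fun p : RR R => (\1_(box a b : set (RR R)) p)%:E)); last first.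
  by move=> p _ /=; rewrite ger0_norm.
rewrite integral_indic//.
apply: (@le_lt_trans _ _ (@leb2 R (box a b : set (RR R)))); first by apply: le_measure; rewrite ?inE//; exact: measurableI.
rewrite /leb2 product_measure1E//; try exact: measurable_itv.
have fi (c d : R) : (@lebesgue_measure R `[c, d]%classic < +oo)%E.
  by rewrite lebesgue_measure_itv /=; case: ifP => _; rewrite -?EFinB ltry.
have ge (c d : R) : (0 <= @lebesgue_measure R `[c, d]%classic)%E by exact: measure_ge0.
apply: lte_mul_pinfty; [exact: ge| |exact: fi].
by rewrite ge0_fin_numE; [exact: fi|exact: ge].
Qed.

Lemma bounded_supp_int f a b M : measH f -> (forall p, Hp p -> `|f p| <= M) ->
  supp_in f a b -> integrableH f.
Proof.
move=> mf fM fs; apply: le_integrableH mf (integrableHZ M (integrable_box a b)) _.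
move=> p Hpp; rewrite indicE; have [bp|np] := pselect (box a b p).
  by rewrite mem_set// mulr1 fM.
by rewrite memNset// mulr0 fs// normr0.
Qed.

Lemma tf_int f : test_fun f -> integrableH f.
Proof.
move=> tf; have [a [b [a0 b0 fs]]] := tf_box tf; have [M M0 fM] := tf_bounded tf.
apply: (bounded_supp_int (smooth_measH tf.1) _ fs); by move=> p _; exact: fM.
Qed.

Lemma tf_L2 f : test_fun f -> L2fun f.
Proof.
move=> tf; apply: sqr_L2; first exact: smooth_measH tf.1.
by apply: eq_integrableH (tf_int (tfM tf tf)) => p _; rewrite expr2.
Qed.

End TestFunctions.

(** * Integration by parts *)

Section IntegrationByParts.
Variable R : realType.
Implicit Types (f g : R * R -> R) (p q : R * R).

Lemma cont_hline f (x y : R) : {for (x, y), continuous f} ->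
  {for x, continuous (fun t : R => f (t, y))}.
Proof.
move=> /cvgrPdist_lt fc; apply/cvgrPdist_lt => e e0 /=.
exact: (near_hline (fc _ e0)).
Qed.

Lemma cont_vline f (x y : R) : {for (x, y), continuous f} ->
  {for y, continuous (fun t : R => f (x, t))}.
Proof.
move=> /cvgrPdist_lt fc; apply/cvgrPdist_lt => e e0 /=.
exact: (near_vline (fc _ e0)).
Qed.

(** [F] and its derivative vanish outside [[-b, b]], so the integral is one over the larger segment
    [[-(b + 1), b + 1]], at whose ends [F] is 0. *)
Lemma integral_derive_supp (F dF : R -> R) (b : R) : 0 < b ->
  (forall t, is_derive t (1 : R) F (dF t)) -> continuous dF ->
  (forall t, b < `|t| -> F t = 0 /\ dF t = 0) ->
  (\int[@lebesgue_measure R]_t (dF t)%:E = 0)%E.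
Proof.
move=> b0 Fd dFc Fs.
have b1 : b < `|b + 1| by rewrite ger0_norm ?ltrDl// addr_ge0// ltW.
have b2 : b < `|- (b + 1)| by rewrite normrN.
pose D : set R := `[- (b + 1), b + 1]%classic.
have -> : (\int[@lebesgue_measure R]_t (dF t)%:E =
   \int[@lebesgue_measure R]_(t in D) (dF t)%:E)%E.
  rewrite [RHS]integral_mkcond; apply: eq_integral => t _; rewrite patchE.
  case: ifPn => // /negP; rewrite inE /D /= in_itv /= => nt; rewrite (Fs t _).2//.
  rewrite ltNge; apply/negP; rewrite ler_norml => /andP[h1 h2]; apply: nt.
  by apply/andP; split; lra.
rewrite /D (@continuous_FTC2 _ dF F).
- by rewrite (Fs _ b1).1 (Fs _ b2).1 -EFinB subrr.
- by rewrite gtrN// addr_gt0.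
- exact: continuous_subspaceT.
- have cF : continuous F.
    by move=> t; apply/differentiable_continuous/derivable1_diffP; case: (Fd t).
  split; first by move=> t _; case: (Fd t).
  + by apply: cvg_at_right_filter; exact: cF.
  + by apply: cvg_at_left_filter; exact: cF.
- by move=> t _; rewrite derive1E; case: (Fd t).
Qed.

Lemma tf_slice_x f y : test_fun f -> (\int[@lebesgue_measure R]_x (px f (x, y))%:E = 0)%E.
Proof.
move=> tf; have [a [b [a0 b0 fs]]] := tf_box tf.
apply: (@integral_derive_supp (fun t => f (t, y)) (fun t => px f (t, y)) b b0).
- by move=> t; exact: (tf_dX (t, y) tf).
- by move=> t; exact (cont_hline (tf_cont (p := (t, y)) (tf_px tf))).
- move=> t bt; have nb : ~ box a b (t, y).
    by move=> /boxP[/= h _]; move: bt; rewrite ltNge ler_norml h.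
  by rewrite fs// (supp_px fs).
Qed.

Lemma tf_slice_y f x : test_fun f -> (\int[@lebesgue_measure R]_y (py f (x, y))%:E = 0)%E.
Proof.
move=> tf; have [a [b [a0 b0 fs]]] := tf_box tf.
apply: (@integral_derive_supp (fun t => f (x, t)) (fun t => py f (x, t)) b b0).
- by move=> t; exact: (tf_dY (x, t) tf).
- by move=> t; exact (cont_vline (tf_cont (p := (x, t)) (tf_py tf))).
- move=> t bt; have nb : ~ box a b (x, t).
    move=> /boxP[_ /= /andP[h1 h2]]; move: bt; rewrite ltNge ler_norml h2 andbT.
    by move/negP; apply; lra.
  by rewrite fs// (supp_py fs).
Qed.

Lemma integralT_supp f : (forall p, ~ Hp p -> f p = 0) ->
  (\int[@leb2 R]_(p in @HH R) (f p)%:E = \int[@leb2 R]_p (f p)%:E)%E.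
Proof.
move=> fs; rewrite integral_mkcond; apply: eq_integral => p _; rewrite patchE.
by case: ifPn => // /negP; rewrite inE => /fs ->.
Qed.

Lemma integrableT_supp f : (forall p, ~ Hp p -> f p = 0) -> integrableH f ->
  (@leb2 R).-integrable setT (EFin \o f).
Proof.
move=> fs /(integrable_mkcond _ (@measurable_Hp R)).1; apply: eq_integrable => // p _.
by rewrite patchE; case: ifPn => // /negP; rewrite inE => /fs /= ->.
Qed.

Lemma tf_off f p : test_fun f -> ~ Hp p -> f p = 0.
Proof. by move=> tf np; have := nbhs_singleton (tf_near0 tf np). Qed.

(** Fubini's theorem with the inner integral along horizontal lines, each of which contributes 0. *)
Lemma I_px f : test_fun f -> I (px f) = 0.
Proof.
move=> tf; have tx := tf_px tf; have fs p := @tf_off _ p tx.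
rewrite /I /Rintegral (integralT_supp fs) /leb2.
rewrite -(integral21_prod_meas1 (integrableT_supp fs (tf_int tx))) /=.
rewrite (eq_integral (fun=> 0%E)) ?integral0// => y _.
by rewrite /fubini_G /=; exact: tf_slice_x.
Qed.

Lemma I_py f : test_fun f -> I (py f) = 0.
Proof.
move=> tf; have tx := tf_py tf; have fs p := @tf_off _ p tx.
rewrite /I /Rintegral (integralT_supp fs) /leb2.
rewrite -(integral12_prod_meas1 (integrableT_supp fs (tf_int tx))) /=.
rewrite (eq_integral (fun=> 0%E)) ?integral0// => y _.
by rewrite /fubini_F /=; exact: tf_slice_y.
Qed.

Lemma ibp_x f g : smooth_on f -> test_fun g -> ip (px f) g = - ip f (px g).
Proof.
move=> fC tg; have t1 := smoothM_tf fC tg.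
have t2 := smoothM_tf (smooth_px fC) tg; have t3 := smoothM_tf fC (tf_px tg).
apply/eqP; rewrite -addr_eq0 /ip -ID; [|exact: tf_int..].
rewrite -[X in _ == X](I_px t1); apply/eqP; apply: eq_I => p Hpp.
by rewrite (px_val (dXM (smooth_dX fC Hpp) (tf_dX p tg))).
Qed.

Lemma ibp_y f g : smooth_on f -> test_fun g -> ip (py f) g = - ip f (py g).
Proof.
move=> fC tg; have t1 := smoothM_tf fC tg.
have t2 := smoothM_tf (smooth_py fC) tg; have t3 := smoothM_tf fC (tf_py tg).
apply/eqP; rewrite -addr_eq0 /ip -ID; [|exact: tf_int..].
rewrite -[X in _ == X](I_py t1); apply/eqP; apply: eq_I => p Hpp.
by rewrite (py_val (dYM (smooth_dY fC Hpp) (tf_dY p tg))).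
Qed.

End IntegrationByParts.

(** * Cutoffs with bounded hyperbolic gradient *)

Section Bump.
Variable R : realType.
Implicit Types (f g : R * R -> R) (p q : R * R).

(** [flat 0] is the classical function [exp (-1/t)], flat at 0. The powers of [1/t] make the family
    stable under derivation, which turns smoothness into an induction over all [k] at once. *)
Definition flat (k : nat) (t : R) : R :=
  if 0 < t then (t^-1) ^+ k * expR (- t^-1) else 0.

Lemma is_derive_sq0 (h : R -> R) (C : R) : (forall t, `|h t| <= C * t ^+ 2) ->
  is_derive (0 : R) (1 : R) h 0.
Proof.
move=> hC; have h0 : h 0 = 0.
  by apply/eqP; rewrite -normr_le0 (le_trans (hC 0))// expr0n mulr0.
have C0 : 0 <= C by have := hC 1; rewrite expr1n mulr1; exact: le_trans.
have cv : (fun t : R => t^-1 *: (h (t *: 1 + 0) - h 0)) @ 0^' --> (0 : R).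
  apply/cvgrPdist_lt => e e0; near=> t.
  have tn : t != 0 by near: t; exact: nbhs_dnbhs_neq.
  rewrite sub0r normrN h0 subr0 addr0 [t *: 1]mulr1 normrM normfV.
  rewrite ltr_pdivrMl ?normr_gt0//; apply: le_lt_trans (hC t) _.
  rewrite -(real_normK (num_real t)) expr2 mulrA mulrC ltr_pM2l ?normr_gt0//.
  have te : `|t| < e / (C + 1).
    near: t; apply: dnbhs0_lt; first by rewrite divr_gt0// ltr_wpDl.
  have := ltr_wpDl C0 (@ltr01 R) => C1.
  by move: te; rewrite ltr_pdivlMr// => te; have := normr_ge0 t; nra.
apply: DeriveDef; first by apply/cvg_ex; exists 0.
by apply/cvg_lim.
Unshelve. all: end_near. Qed.

(** With [u = 1/t] the exponential series gives [u ^ (k + 2) / (k + 2)! <= exp u]. The resulting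
    factor [t ^ 2] is what makes the derivative at 0 vanish. *)
Lemma flat_le k t : `|flat k t| <= (k.+2)`!%:R * t ^+ 2.
Proof.
rewrite /flat; case: ifPn => t0; last by rewrite normr0 mulr_ge0// sqr_ge0.
set u := t^-1; have u0 : 0 < u by rewrite invr_gt0.
rewrite ger0_norm ?mulr_ge0 ?exprn_ge0 ?expR_ge0 ?(ltW u0)// expRN.
rewrite ler_pdivrMr ?expR_gt0//.
have F0 : 0 < (k.+2)`!%:R :> R by rewrite ltr0n fact_gt0.
have := @expR_ge1Dxn _ u k.+1 (ltW u0).
have -> : t ^+ 2 = (u ^+ 2)^-1 by rewrite /u exprVn invrK.
move=> H; rewrite -mulrA -ler_pdivrMl// mulrC.
rewrite ler_pdivlMl ?exprn_gt0// mulrA -exprD add2n.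
by apply: le_trans H; rewrite ler_wpDl.
Qed.

Lemma flat_derive k t : is_derive t (1 : R) (flat k) (- k%:R * flat k.+1 t + flat k.+2 t).
Proof.
have [t0|t0|->] := ltgtP t 0.
- rewrite /flat ltNge (ltW t0) /= mulr0 addr0.
  have hn : \forall s \near t, 0 = (if 0 < s then (s^-1) ^+ k * expR (- s^-1) else 0).
    by near=> s; rewrite ltNge ltW//=; near: s; exact: lt_nbhsl.
  exact: (near_eq_is_derive hn (dX_cst (0 : R) (t, 0))).
- have hn : \forall s \near t, (s^-1) ^+ k * expR (- s^-1) = flat k s.
    by near=> s; rewrite /flat ifT//; near: s; exact: lt_nbhsr.
  apply: (near_eq_is_derive hn).
  have tn : t != 0 by rewrite gt_eqF.
  have hV : is_derive t (1 : R) (fun s : R => s^-1) (- (t ^- 2)).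
    have := @is_deriveV _ id t 1 1 tn (is_derive_id _ _).
    by rewrite /GRing.scale /= mulr1.
  have hX : is_derive t (1 : R) (fun s : R => (s^-1) ^+ k) (k%:R * t^-1 ^+ k.-1 * - (t ^- 2)).
    have := is_deriveX k hV; rewrite /GRing.scale /= => h.
    rewrite (_ : (fun s : R => s^-1 ^+ k) = (fun s : R => s^-1) ^+ k)//.
    by apply/funext => s; elim: (k) => [|j IH]; rewrite ?expr0// !exprS IH.
  have hE : is_derive t (1 : R) (fun s : R => expR (- s^-1)) (expR (- t^-1) * (t ^- 2)).
    have := @is_derive1_comp _ expR (fun s : R => - s^-1) t _ _ (is_derive_expR _) (is_deriveN hV).
    by rewrite opprK.
  have := is_deriveM hX hE; rewrite /flat t0 /GRing.scale /= => h.
  apply: is_derive_eq h _; rewrite -exprVn; case: k {hX hn} => [|k] /=.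
    by rewrite !mul0r mulr0 addr0 oppr0 mul0r add0r expr0 mul1r mulrC.
  by rewrite !exprS; ring.
- rewrite /flat ltxx mulr0 addr0; exact: (is_derive_sq0 (flat_le k)).
Unshelve. all: end_near. Qed.

Lemma smooth1_flat k : smooth1 (flat k).
Proof.
move=> n; elim: n k => [|n IH] k.
  move=> p Hpp; apply: (@continuous_comp _ _ _ fst (flat k)); first exact: cvg_fst.
  apply/differentiable_continuous/derivable1_diffP.
  by case: (flat_derive k p.1).
have X p : dX (fun q : R * R => flat k q.1) p (- k%:R * flat k.+1 p.1 + flat k.+2 p.1).
  exact: flat_derive.
have Y p : dY (fun q : R * R => flat k q.1) p 0 := dY_cst (flat k p.1) p.
apply: Ck_partials.
- by move=> p Hpp; rewrite (px_val (X p)) (py_val (Y p)).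
- apply: (Ck_ext (f := fun p => - k%:R * flat k.+1 p.1 + flat k.+2 p.1)).
    by move=> p _; rewrite (px_val (X p)).
  by apply: CkD; [apply: CkZ; exact: IH|exact: IH].
- by apply: (Ck_ext (f := fun=> 0)); [move=> p _; rewrite (py_val (Y p))|exact: Ck_cst].
Qed.

Lemma flat_gt0 k t : 0 < t -> 0 < flat k t.
Proof. by move=> t0; rewrite /flat t0 mulr_gt0 ?expR_gt0// exprn_gt0 ?invr_gt0. Qed.

Lemma flat_ge0 k t : 0 <= flat k t.
Proof.
have [t0|t0] := ltP 0 t; first exact: ltW (flat_gt0 _ _).
by rewrite /flat ltNge t0.
Qed.

Lemma flat0 k t : t <= 0 -> flat k t = 0.
Proof. by rewrite /flat leNgt => /negbTE ->. Qed.

Definition step (t : R) : R := flat 0 (2 - t) / (flat 0 (2 - t) + flat 0 (t - 1)).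

Lemma step_den t : 0 < flat 0 (2 - t) + flat 0 (t - 1).
Proof.
have [h|h] := ltP t 2.
  by rewrite ltr_wpDr ?flat_ge0// flat_gt0// subr_gt0.
by rewrite ltr_wpDl ?flat_ge0// flat_gt0//; lra.
Qed.

Lemma step1 t : t <= 1 -> step t = 1.
Proof.
move=> t1; rewrite /step (@flat0 0 (t - 1)) ?addr0 ?subr_le0// divff// gt_eqF// flat_gt0//; lra.
Qed.

Lemma step0 t : 2 <= t -> step t = 0.
Proof. by move=> t2; rewrite /step flat0 ?mul0r// subr_le0. Qed.

Lemma step_ge0 t : 0 <= step t.
Proof. by rewrite divr_ge0 ?flat_ge0// ltW// step_den. Qed.

Lemma step_le1 t : step t <= 1.
Proof. by rewrite ler_pdivrMr ?step_den// mul1r lerDl flat_ge0. Qed.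

(** The derivative of [step], arranged so that its sign and its vanishing outside [[1, 2]] are
    visible; its opposite serves later as the profile of the mollifier. *)
Definition dstep (t : R) : R :=
  - (flat 2 (2 - t) * flat 0 (t - 1) + flat 0 (2 - t) * flat 2 (t - 1)) /
    (flat 0 (2 - t) + flat 0 (t - 1)) ^+ 2.

Lemma step_derive t : is_derive t (1 : R) step (dstep t).
Proof.
have dA : is_derive t (1 : R) (fun s => flat 0 (2 - s)) (- flat 2 (2 - t)).
  have h : is_derive t (1 : R) (fun s : R => 2 - s) (0 - 1) by exact: is_deriveB.
  have := @is_derive1_comp _ (flat 0) (fun s : R => 2 - s) t _ _ (flat_derive _ _) h.
  by move=> k; apply: is_derive_eq k _; ring.
have dB : is_derive t (1 : R) (fun s => flat 0 (s - 1)) (flat 2 (t - 1)).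
  have h : is_derive t (1 : R) (fun s : R => s - 1) (1 - 0) by exact: is_deriveB.
  have := @is_derive1_comp _ (flat 0) (fun s : R => s - 1) t _ _ (flat_derive _ _) h.
  by move=> k; apply: is_derive_eq k _; ring.
have n0 : flat 0 (2 - t) + flat 0 (t - 1) != 0 by rewrite gt_eqF// step_den.
have dC := is_deriveD dA dB.
have dV := @is_deriveV _ _ t _ _ n0 dC.
have := is_deriveM dA dV; rewrite /GRing.scale /= => h.
apply: is_derive_eq h _; rewrite /dstep.
by rewrite -[((fun s => _) + _) t]/(flat 0 (2 - t) + flat 0 (t - 1)); field.
Qed.

Lemma dstep_le0 t : dstep t <= 0.
Proof.
by rewrite /dstep mulNr oppr_le0 divr_ge0 ?sqr_ge0// addr_ge0// mulr_ge0 ?flat_ge0.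
Qed.

Lemma dstep0 t : (t <= 1) || (2 <= t) -> dstep t = 0.
Proof.
rewrite /dstep => /orP[h|h].
  by rewrite !(@flat0 _ (t - 1)) ?subr_le0// !mulr0 addr0 oppr0 mul0r.
by rewrite !(@flat0 _ (2 - t)) ?subr_le0// !mul0r addr0 oppr0 mul0r.
Qed.

Lemma smooth_affine (c d : R) : smooth_on (fun p : R * R => c * p.1 + d).
Proof. by move=> n; apply: CkD; [apply: CkZ; exact: Ck_fst|exact: Ck_cst]. Qed.

Lemma smooth1_affine (h : R -> R) (c d : R) : smooth1 h -> smooth1 (fun t => h (c * t + d)).
Proof. by move=> hC n; apply: (Ck_comp (hC n) (smooth_affine c d n)). Qed.

Lemma smooth1_flat2 k : smooth1 (fun t => flat k (2 - t)).
Proof.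
move=> n; apply: Ck_ext (smooth1_affine (-1) 2 (@smooth1_flat k) n) => p _.
by congr flat; ring.
Qed.

Lemma smooth1_flat1 k : smooth1 (fun t => flat k (t - 1)).
Proof.
move=> n; apply: Ck_ext (smooth1_affine 1 (-1) (@smooth1_flat k) n) => p _.
by congr flat; ring.
Qed.

Lemma smooth1_step : smooth1 step.
Proof.
move=> n; apply: CkM; first exact: smooth1_flat2.
apply: CkV; first by move=> p _; rewrite gt_eqF// step_den.
by apply: CkD; [exact: smooth1_flat2|exact: smooth1_flat1].
Qed.

Lemma smooth1_dstep : smooth1 dstep.
Proof.
have S2 k := @smooth1_flat2 k; have S1 k := @smooth1_flat1 k.
move=> n; apply: CkM.
  by apply: CkN; apply: CkD; apply: CkM; rewrite ?[Ck_on _ _]S1; first [exact: S1|exact: S2].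
apply: CkV; first by move=> p _; rewrite gt_eqF// exprn_gt0// step_den.
by apply: CkM; apply: CkD; first [exact: S1|exact: S2].
Qed.

Lemma dstep_bounded : exists2 M, 0 < M & forall t, `|dstep t| <= M.
Proof.
have dc : continuous dstep.
  move=> t; apply: (cont_hline (x := t) (y := 1) (f := fun q => dstep q.1)).
  exact: (@smooth1_dstep 0%N _ (Hp1 t)).
have : compact (dstep @` `[1, 2]).
  by apply: (@continuous_compact _ _ dstep); [exact: continuous_subspaceT|exact: segment_compact].
move=> /compact_bounded [M [_ MP]]; exists (`|M| + 1); first by rewrite ltr_wpDl.
have M1 : M < `|M| + 1 by rewrite (le_lt_trans (ler_norm M))// ltrDl.
move=> t; have [/andP[h1 h2]|] := boolP ((1 <= t) && (t <= 2)).
  by apply: MP M1 _ _; exists t => //=; rewrite in_itv /= h1.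
rewrite negb_and -!ltNge => h; rewrite dstep0 ?normr0 ?addr_ge0//.
by case/orP: h => /ltW ->; rewrite ?orbT.
Qed.

(** [rho p] is [2 cosh] of the distance from [p] to [(0, 1)] for the metric of curvature [-1]. Its
    gradient therefore satisfies [y^2 |grad rho|^2 = rho^2 - 4], so that it grows no faster than
    [rho]. *)
Definition rho p : R := (p.1 ^+ 2 + p.2 ^+ 2 + 1) / p.2.
(** Off the half-plane [rho] is at most 0, by sign or by the default value of division by 0, and
    [step] would be 1 there; the case distinction makes the cutoff vanish instead. *)
Definition cutoff (n : nat) p : R := if 0 < p.2 then step (rho p / n.+1%:R) else 0.

Lemma cut_ge0 n p : 0 <= cutoff n p.
Proof. by rewrite /cutoff; case: ifP => // _; exact: step_ge0. Qed.
Lemma cut_le1 n p : cutoff n p <= 1.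
Proof. by rewrite /cutoff; case: ifP => // _; exact: step_le1. Qed.
Lemma cut_norm n p : `|cutoff n p| <= 1.
Proof. by rewrite ger0_norm ?cut_ge0// cut_le1. Qed.
Lemma cut1 n p : Hp p -> rho p <= n.+1%:R -> cutoff n p = 1.
Proof. by rewrite /cutoff /Hp /= => -> h; rewrite step1// ler_pdivrMr// mul1r. Qed.

Lemma smooth_rho : smooth_on rho.
Proof.
move=> n; apply: CkM; last first.
  by apply: CkV; [move=> p; rewrite /Hp /= => h; rewrite gt_eqF|exact: Ck_snd].
by apply: CkD; [apply: CkD; apply: CkM; first [exact: Ck_fst|exact: Ck_snd]|exact: Ck_cst].
Qed.

Lemma smooth_cut n : smooth_on (cutoff n).
Proof.
move=> k; apply: (Ck_ext (f := fun p => step (n.+1%:R^-1 * rho p))).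
  by move=> p; rewrite /Hp /cutoff /= => ->; rewrite mulrC.
by apply: Ck_comp; [exact: smooth1_step|apply: CkZ; exact: smooth_rho].
Qed.

(** Sublevel sets of [rho] are hyperbolic balls: from [x^2 + y^2 + 1 < N y] follow [y < N],
    [1 < N y] and [x^2 < N^2]. *)
Lemma rho_box p (N : R) : Hp p -> rho p < N -> box N^-1 N p.
Proof.
case: p => x y; rewrite /Hp /rho /= => y0; rewrite ltr_pdivrMr// => h.
have N0 : 0 < N.
  rewrite ltNge; apply/negP => N0.
  by have := sqr_ge0 x; have := sqr_ge0 y; nra.
have yN : y <= N by rewrite leNgt; apply/negP => Ny; have := sqr_ge0 x; nra.
apply/boxP; rewrite /= yN andbT; split.
  rewrite -ler_norml leNgt; apply/negP => Nx.
  have : N ^+ 2 < x ^+ 2 by rewrite -[x ^+ 2](real_normK (num_real x)) ltr_pXn2r// nnegrE ltW.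
  by have := sqr_ge0 y; nra.
rewrite -[N^-1]mul1r ler_pdivrMr//; have := sqr_ge0 x; have := sqr_ge0 y; nra.
Qed.

Lemma box_rho (a b : R) : 0 < a -> exists n : nat, forall p, box a b p -> rho p <= n.+1%:R.
Proof.
move=> a0; pose X : R := (b ^+ 2 + b ^+ 2 + 1) / a.
have X0 : 0 <= X by rewrite divr_ge0 ?ltW// ltr_wpDl// addr_ge0// sqr_ge0.
exists (Num.truncn X) => p /boxP[h1 /andP[h2 h3]].
apply: le_trans (ltW (truncnS_gt X)); rewrite /rho /X.
have p0 : 0 < p.2 by exact: lt_le_trans h2.
apply: (@le_trans _ _ ((b ^+ 2 + b ^+ 2 + 1) / p.2)).
  rewrite ler_pM2r ?invr_gt0// lerD2r lerD//.
    rewrite -[p.1 ^+ 2](real_normK (num_real _)) ler_sqr ?nnegrE//; first by rewrite ler_norml.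
    by rewrite (le_trans _ h3)// ltW.
  by rewrite ler_sqr// nnegrE ?ltW// (lt_le_trans p0).
apply: ler_wpM2l; last by rewrite lef_pV2.
by rewrite ltW// ltr_wpDl// addr_ge0// sqr_ge0.
Qed.

Lemma cut_supp n : supp_in (cutoff n) (2 * n.+1%:R)^-1 (2 * n.+1%:R).
Proof.
move=> p np; rewrite /cutoff; case: ifPn => // p0; apply: step0.
rewrite leNgt; apply/negP; rewrite ltr_pdivrMr// => h; apply: np.
by apply: rho_box.
Qed.

Lemma tf_cut n : test_fun (cutoff n).
Proof. by apply: (box_tf _ (@smooth_cut n) (@cut_supp n)); rewrite invr_gt0 mulr_gt0. Qed.

Lemma dX_rho p : Hp p -> dX rho p (2 * p.1 / p.2).
Proof.
move=> Hpp; have p0 : p.2 != 0 by rewrite gt_eqF.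
have := dXM (dXD (dXD (dXM (dX_fst p) (dX_fst p)) (dXM (dX_snd p) (dX_snd p))) (dX_cst 1 p))
  (dXV p0 (dX_snd p)).
by move=> h; apply: dX_eq h _; rewrite /=; field.
Qed.

Lemma dY_rho p : Hp p -> dY rho p ((p.2 ^+ 2 - p.1 ^+ 2 - 1) / p.2 ^+ 2).
Proof.
move=> Hpp; have p0 : p.2 != 0 by rewrite gt_eqF.
have := dYM (dYD (dYD (dYM (dY_fst p) (dY_fst p)) (dYM (dY_snd p) (dY_snd p))) (dY_cst 1 p))
  (dYV p0 (dY_snd p)).
by move=> h; apply: dY_eq h _; rewrite /=; field.
Qed.

Lemma cut_near n p : Hp p -> \forall q \near p, step (n.+1%:R^-1 * rho q) = cutoff n q.
Proof.
move=> /near_Hp; apply: filterS => q; rewrite /Hp /cutoff /= => ->; by rewrite mulrC.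
Qed.

Lemma px_cut n p : Hp p -> px (cutoff n) p = dstep (n.+1%:R^-1 * rho p) * (n.+1%:R^-1 * (2 * p.1 / p.2)).
Proof.
move=> Hpp; apply: px_val; apply: near_dX (cut_near n Hpp) _.
by apply: dX_comp; [exact: step_derive|apply: dXZ; exact: dX_rho].
Qed.

Lemma py_cut n p : Hp p ->
  py (cutoff n) p = dstep (n.+1%:R^-1 * rho p) * (n.+1%:R^-1 * ((p.2 ^+ 2 - p.1 ^+ 2 - 1) / p.2 ^+ 2)).
Proof.
move=> Hpp; apply: py_val; apply: near_dY (cut_near n Hpp) _.
by apply: dY_comp; [exact: step_derive|apply: dYZ; exact: dY_rho].
Qed.

Lemma grad_cut0 n p : Hp p -> rho p <= n.+1%:R -> px (cutoff n) p = 0 /\ py (cutoff n) p = 0.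
Proof.
move=> Hpp h; rewrite px_cut// py_cut// dstep0 ?mul0r//.
by rewrite mulrC ler_pdivrMr// mul1r h.
Qed.

(** By [y^2 |grad rho|^2 = rho^2 - 4] the left-hand side is [dstep^2 ((rho / (n + 1))^2 - 4 / (n +
    1)^2)]. As [dstep] vanishes unless [rho / (n + 1) <= 2], it is at most [4 M^2], uniformly in
    [n]. *)
Lemma grad_cut_bound : exists2 C : R, 0 < C & forall n p, Hp p ->
  p.2 ^+ 2 * (px (cutoff n) p ^+ 2 + py (cutoff n) p ^+ 2) <= C.
Proof.
have [M M0 dM] := dstep_bounded; exists (4 * M ^+ 2); first by rewrite mulr_gt0// exprn_gt0.
move=> n p Hpp; rewrite px_cut// py_cut//; set N := n.+1%:R^-1.
have N0 : 0 < N by rewrite invr_gt0.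
have y0 : 0 < p.2 by [].
have y0' : p.2 != 0 by rewrite gt_eqF.
have r0 : 0 <= rho p by rewrite divr_ge0 ?ltW// ltr_wpDl// addr_ge0// sqr_ge0.
set d := dstep _.
have -> : p.2 ^+ 2 * ((d * (N * (2 * p.1 / p.2))) ^+ 2 +
    (d * (N * ((p.2 ^+ 2 - p.1 ^+ 2 - 1) / p.2 ^+ 2))) ^+ 2) =
  d ^+ 2 * ((N * rho p) ^+ 2 - 4 * N ^+ 2) by rewrite /rho; field.
have [h|h] := ltP 2 (N * rho p).
  rewrite /d dstep0; last by rewrite (ltW h) orbT.
  by rewrite expr0n mul0r mulr_ge0// sqr_ge0.
have d2 : d ^+ 2 <= M ^+ 2.
  by rewrite -(real_normK (num_real d)) ler_sqr ?nnegrE ?dM// ltW.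
have a0 : 0 <= N * rho p by rewrite mulr_ge0// ltW.
rewrite [X in _ <= X]mulrC; apply: le_trans (ler_wpM2r _ d2); last by [].
apply: ler_wpM2l; first exact: sqr_ge0.
have := sqr_ge0 N; move: h a0; move: (N * rho p) (N ^+ 2) => x y h1 h2 h3; nra.
Qed.

End Bump.

(** * Mollification *)

Section Mollifier.
Variable R : realType.
Implicit Types (f g k : R * R -> R) (p q c : R * R) (e : R).

Lemma integral_affine (G : R -> R) e (c : R) : 0 < e -> continuous G ->
  (forall x, 0 <= G x) ->
  (\int[@lebesgue_measure R]_x (G x)%:E = \int[@lebesgue_measure R]_x (G (e * x + c) * e)%:E)%E.
Proof.
move=> e0 cG G0; pose F := fun x : R => e * x + c.
have Fd x : is_derive x (1 : R) F e.
  have := dXD (dXZ e (dX_fst (x, 0))) (dX_cst c (x, 0)); rewrite mulr1 addr0.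
  exact.
have F' : derive1 F = cst e.
  by apply/funext => x; rewrite derive1E; exact: (@derive_val _ _ _ _ _ _ _ (Fd x)).
rewrite (@increasing_ge0_integration_by_substitutionT _ F G) ?F'//.
- by move=> x y xy; rewrite /F ltrD2r ltr_pM2l.
- by move=> x; exact: cvg_cst.
- exact: is_cvg_cst.
- exact: is_cvg_cst.
- apply/cvgrNyPle => A; have := nbhs_ninfty_le (num_real ((A - c) / e)).
  by apply: filterS => x; rewrite ler_pdivlMr// lerBrDr mulrC.
- apply/cvgryPge => A; have := nbhs_pinfty_ge (num_real ((A - c) / e)).
  by apply: filterS => x; rewrite ler_pdivrMr// lerBlDr mulrC.
Qed.

Definition hump (t : R) : R := - dstep t.
Definition d2 p q : R := (p.1 - q.1) ^+ 2 + (p.2 - q.2) ^+ 2.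
(** A radial mollifier of scale [e], normalized only up to the constant [kmass]. It lives where
    [e^2 < d2 c q < 2 e^2], and [-2 (q - c)] times it is the gradient of [step (d2 c q / e^2)];
    Weyl's lemma relies on this. *)
Definition kern e c q : R := hump (e ^- 2 * d2 c q) * e ^- 2.

Lemma hump_ge0 t : 0 <= hump t.
Proof. by rewrite oppr_ge0 dstep_le0. Qed.

Lemma smooth1_hump : smooth1 hump.
Proof. by move=> n; apply: CkN; exact: smooth1_dstep. Qed.

Lemma hump_cont : continuous hump.
Proof.
move=> t; have h : {for (t, 1 : R), continuous (fun q : R * R => hump q.1)} :=
  Ck_cont (@smooth1_hump 0%N) (Hp1 t).
exact (cont_hline h).
Qed.

Lemma kern_ge0 e c q : 0 <= kern e c q.
Proof. by rewrite mulr_ge0 ?hump_ge0// invr_ge0 sqr_ge0. Qed.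

Lemma d2C p q : d2 p q = d2 q p.
Proof. by rewrite /d2; ring. Qed.

Lemma kernC e p q : kern e p q = kern e q p.
Proof. by rewrite /kern d2C. Qed.

Lemma smooth_d2 c : smooth_on (d2 c).
Proof.
move=> n; apply: CkD; apply: CkM; apply: CkB; first [exact: Ck_cst|exact: Ck_fst|exact: Ck_snd].
Qed.

Lemma hump_supp e c q (h : R -> R) : 0 < e -> (forall t, 2 <= t -> h t = 0) ->
  h (e ^- 2 * d2 c q) != 0 -> `|q.1 - c.1| < 2 * e /\ `|q.2 - c.2| < 2 * e.
Proof.
move=> e0 h0 /eqP k0.
have : d2 c q < (2 * e) ^+ 2.
  rewrite ltNge; apply/negP => d; apply: k0; apply: h0.
  rewrite mulrC ler_pdivlMr ?exprn_gt0//; apply: le_trans d.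
  by rewrite exprMn ler_pM2r ?exprn_gt0// -natrX ler_nat.
rewrite /d2 => d; have e20 : 0 <= 2 * e by rewrite mulr_ge0// ltW.
split; rewrite -ltr_sqr ?nnegrE// real_normK ?num_real//; apply: le_lt_trans d.
  by rewrite -sqrrN opprB lerDl sqr_ge0.
by rewrite -[leLHS]sqrrN opprB lerDr sqr_ge0.
Qed.

Lemma kern_supp e c q : 0 < e -> kern e c q != 0 ->
  `|q.1 - c.1| < 2 * e /\ `|q.2 - c.2| < 2 * e.
Proof.
move=> e0; rewrite mulf_eq0 negb_or => /andP[k0 _]; move: k0; apply: hump_supp => //.
by move=> t t2; rewrite /hump dstep0 ?oppr0// t2 orbT.
Qed.

Lemma radial_tf e c (h : R -> R) : 0 < e -> 2 * e < c.2 -> smooth1 h ->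
  (forall t, 2 <= t -> h t = 0) -> test_fun (fun q => h (e ^- 2 * d2 c q)).
Proof.
move=> e0 ec hC h0.
apply: (@box_tf _ _ (c.2 - 2 * e) (`|c.1| + `|c.2| + 2 * e)); first by rewrite subr_gt0.
  by move=> n; apply: Ck_comp; [exact: hC|apply: CkZ; exact: smooth_d2].
move=> q nq; apply/eqP; apply/negPn/negP => /(hump_supp e0 h0); rewrite !ltr_norml.
move=> [/andP[h1 h2] /andP[h3 h4]]; apply: nq; apply/boxP.
have := ler_norm c.1; have := ler_norm (- c.1); rewrite normrN => h5 h6.
have := ler_norm c.2; have := normr_ge0 c.1; have := normr_ge0 c.2 => h7 h8 h9.
by split; apply/andP; split; lra.
Qed.

Lemma tf_kern e c : 0 < e -> 2 * e < c.2 -> test_fun (kern e c).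
Proof.
move=> e0 ec; have := tfZ (e ^- 2) (radial_tf e0 ec smooth1_hump _).
move=> H; apply: tf_eq (H _) => [q|t t2]; first by rewrite mulrC.
by rewrite /hump dstep0 ?oppr0// t2 orbT.
Qed.

(** The centre [(0, 3)] keeps the support of the kernel of scale 1 inside the half-plane, so that
    [I] sees its whole mass. *)
Definition kmass : R := I (kern 1 (0, 3)).

Lemma kern_contT e c p : {for p, continuous (kern e c)}.
Proof.
apply: cvgM; last exact: cvg_cst.
apply: (@continuous_comp _ _ _ (fun q => e ^- 2 * d2 c q) hump); last exact: hump_cont.
apply: cvgM; first exact: cvg_cst.
by apply: cvgD; apply: cvgM; apply: cvgB; first [exact: cvg_cst|exact: cvg_fst|exact: cvg_snd].
Qed.

Lemma kern_measT e c : measurable_fun [set: RR R] (kern e c : RR R -> R).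
Proof. by apply: cont_measT => p; exact: kern_contT. Qed.

(** One affine substitution in each variable, with Tonelli's theorem in between, removes scale and
    centre. All kernels thus have the same mass, which never has to be computed. *)
Lemma int_kern1 e (c : R * R) : 0 < e ->
  (\int[@leb2 R]_q (kern e c q)%:E =
   \int[@lebesgue_measure R]_y \int[@lebesgue_measure R]_x (hump (x ^+ 2 + y ^+ 2))%:E)%E.
Proof.
move=> e0; have ei : e != 0 by rewrite gt_eqF.
rewrite /leb2 fubini_tonelli1; last first.
- by move=> q; rewrite lee_fin kern_ge0.
- by apply/measurable_EFinP; exact: kern_measT.
rewrite /fubini_F /=.
have cont2 (h : R * R -> R) x : (forall p, {for p, continuous h}) -> continuous (fun y : R => h (x, y)).
  by move=> hc y; exact: (cont_vline (hc (x, y))).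
have cont1 (h : R * R -> R) y : (forall p, {for p, continuous h}) -> continuous (fun x : R => h (x, y)).
  by move=> hc x; exact: (cont_hline (hc (x, y))).
pose k1 q := hump (e ^- 2 * (c.1 - q.1) ^+ 2 + q.2 ^+ 2) * e^-1.
have k1c p : {for p, continuous k1}.
  apply: cvgM; last exact: cvg_cst.
  apply: (@continuous_comp _ _ _ (fun q => e ^- 2 * (c.1 - q.1) ^+ 2 + q.2 ^+ 2) hump); last exact: hump_cont.
  apply: cvgD; last by apply: cvgM; exact: cvg_snd.
  apply: cvgM; first exact: cvg_cst.
  by apply: cvgM; apply: cvgB; first [exact: cvg_cst|exact: cvg_fst].
have k10 q : 0 <= k1 q by rewrite mulr_ge0 ?hump_ge0// invr_ge0 ltW.
transitivity (\int[@lebesgue_measure R]_x \int[@lebesgue_measure R]_y (k1 (x, y))%:E)%E.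
  apply: eq_integral => x _.
  rewrite (@integral_affine (fun y => kern e c (x, y)) e c.2 e0).
  - apply: eq_integral => y _; congr EFin; rewrite /kern /k1 /d2 /= -mulrA.
    congr (hump _ * _); last by field.
    by field.
  - by apply: cont2 => p; exact: kern_contT.
  - by move=> y; exact: kern_ge0.
transitivity (\int[@lebesgue_measure R]_y \int[@lebesgue_measure R]_x (k1 (x, y))%:E)%E.
  apply: (@fubini_tonelli _ _ _ _ _ (@lebesgue_measure R) (@lebesgue_measure R) (fun q : RR R => (k1 q)%:E)).
  - by apply/measurable_EFinP; apply: cont_measT => p; exact: k1c.
  - by move=> q; rewrite lee_fin k10.
apply: eq_integral => y _.
rewrite (@integral_affine (fun x => k1 (x, y)) e c.1 e0).
- apply: eq_integral => x _; congr EFin; rewrite /k1 /= -mulrA mulVf// mulr1.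
  by congr hump; field.
- by apply: cont1 => p; exact: k1c.
- by move=> x; exact: k10.
Qed.

Lemma I_pos f p : test_fun f -> (forall q, 0 <= f q) -> Hp p -> 0 < f p -> 0 < I f.
Proof.
move=> tf f0 Hpp fp.
have fp2 : 0 < f p / 2 by rewrite divr_gt0.
have /cvgrPdist_lt /(_ _ fp2) := tf_cont (p := p) tf.
move=> /nbhs2P [d d0 H].
pose e := Num.min (d / 2) (p.2 / 2).
have e0 : 0 < e by rewrite lt_min !divr_gt0.
have ed : e < d by rewrite (@le_lt_trans _ _ (d / 2)) ?ge_min ?lexx// ltr_pdivrMr// mulr_natr mulr2n ltrDl.
have ep : e < p.2 by rewrite (@le_lt_trans _ _ (p.2 / 2)) ?ge_min ?lexx ?orbT// ltr_pdivrMr// mulr_natr mulr2n ltrDl.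
pose B : set (RR R) := `[p.1 - e, p.1 + e]%classic `*` `[p.2 - e, p.2 + e]%classic.
have mB : measurable B by apply: measurableX; exact: measurable_itv.
have BH : B `<=` @HH R.
  move=> q [_ /=]; rewrite in_itv /= => /andP[h _]; rewrite /HH /Hp /=.
  by apply: lt_le_trans h; rewrite subr_gt0.
have : ((f p / 2)%:E * (@leb2 R) B <= \int[@leb2 R]_(q in @HH R) (f q)%:E)%E.
  have -> : @leb2 R B = (\int[@leb2 R]_(q in @HH R) (\1_B q)%:E)%E.
    by rewrite integral_indic// setIidl.
  rewrite -ge0_integralZl//; last first.
  - by rewrite lee_fin ltW.
  - by apply: measH_EFin; exact: measurable_indic.
  apply: ge0_le_integral => //.
  - by move=> q _; rewrite mule_ge0// lee_fin// ltW.
  - apply/measurable_EFinP; apply: measurable_funM => //; exact: measurable_indic.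
  - by apply: measH_EFin; exact: smooth_measH tf.1.
  - move=> q _; rewrite -EFinM lee_fin indicE.
    have [qB|qB] := boolP (q \in B); last by rewrite mulr0 f0.
    move: qB; rewrite inE => -[/=]; rewrite !in_itv /= => /andP[h1 h2] /andP[h3 h4].
    have q1 : `|q.1 - p.1| < d by apply: le_lt_trans ed; rewrite ler_norml; lra.
    have q2 : `|q.2 - p.2| < d by apply: le_lt_trans ed; rewrite ler_norml; lra.
    have := H q q1 q2; rewrite ltr_norml => /andP[_]; rewrite mulr1 => h5; lra.
rewrite (integralEI (tf_int tf)) /leb2 product_measure1E//; try exact: measurable_itv.
rewrite -[X in (_ * (X * _) <= _)%E]/(@lebesgue_measure R `[p.1 - e, p.1 + e]%classic).
rewrite -[X in (_ * (_ * X) <= _)%E]/(@lebesgue_measure R `[p.2 - e, p.2 + e]%classic).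
rewrite !lebesgue_measure_itv /= !lte_fin !ltrD2l !gtrN// -!EFinB -!EFinM lee_fin.
apply: lt_le_trans; rewrite mulr_gt0// mulr_gt0//; lra.
Qed.

Lemma kmass_gt0 : 0 < kmass.
Proof.
have h3 : 2 * 1 < (0 : R, 3 : R).2 by rewrite /= mulr1 ltr_nat.
(* The squared distance from [(0, 3)] is [5/4], between 1 and 2, where [hump] is positive; at its
   centre the kernel is 0. *)
apply: (@I_pos _ (1, 7 / 2)).
- exact: tf_kern ltr01 h3.
- by move=> q; exact: kern_ge0.
- by rewrite /Hp /= divr_gt0.
- rewrite /kern /hump /dstep /d2 /= expr1n invr1 mulr1 mul1r.
  rewrite mulNr opprK divr_gt0 ?exprn_gt0 ?step_den// addr_gt0// mulr_gt0// flat_gt0//; lra.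
Qed.

Lemma int_kern e c : 0 < e -> (\int[@leb2 R]_q (kern e c q)%:E = kmass%:E)%E.
Proof.
have h3 : 2 * 1 < (0 : R, 3 : R).2 by rewrite /= mulr1 ltr_nat.
move=> e0; rewrite int_kern1// -(int_kern1 (0, 3) ltr01).
have tk := tf_kern ltr01 h3.
by rewrite -integralT_supp ?(integralEI (tf_int tk))// => p; exact: tf_off.
Qed.

(** Differences are based at [(0, 1)] rather than at the origin, around which no kernel is a test
    function of the half-plane. *)
Definition recenter p q : R * R := (p.1 - q.1, p.2 - q.2 + 1).
Definition convk k f p : R := I (fun q => f q * k (recenter p q)).

Lemma kern_shift e p q : kern e (0, 1) (recenter p q) = kern e p q.
Proof. by rewrite /kern /d2 /=; congr (hump (_ * _) * _); ring. Qed.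

Lemma shift_meas k p : test_fun k -> measH (fun q => k (recenter p q)).
Proof.
move=> tk; apply: cont_measH => q _.
apply: (@continuous_comp _ _ _ (recenter p) k); last exact: tf_cont.
apply/cvgrPdist_lt => e e0; apply/nbhs2P; exists e => // r r1 r2.
rewrite prod_normE gt_max /recenter /=; apply/andP; split.
  by rewrite (_ : _ - _ - _ = r.1 - q.1)//; ring.
by rewrite (_ : _ + 1 - _ = r.2 - q.2)//; ring.
Qed.

Lemma conv_int k f p : test_fun k -> integrableH f -> integrableH (fun q => f q * k (recenter p q)).
Proof.
move=> tk fi; have [M M0 kM] := tf_bounded tk.
have fi' : integrableH (fun q => M * `|f q|) by apply: integrableHZ; exact: integrable_norm fi.
apply: le_integrableH fi' _.
  by apply: measurable_funM; [exact: integrableH_meas fi|exact: shift_meas].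
by move=> q _; rewrite normrM mulrC ler_wpM2r.
Qed.

Lemma conv_bound k f p (M : R) : test_fun k -> integrableH f -> (forall q, `|k q| <= M) ->
  `|convk k f p| <= M * I (fun q => `|f q|).
Proof.
move=> tk fi kM; have ni : integrableH (fun q => `|f q|) by exact: integrable_norm fi.
rewrite /convk -IZ//; apply: le_trans (le_normr_Rintegral _ (conv_int p tk fi)) _ => //.
apply: le_I; [exact: (integrable_norm (conv_int p tk fi))|exact: integrableHZ|].
by move=> q _; rewrite normrM mulrC ler_wpM2r.
Qed.

Lemma derive_I (F dF : R -> RR R -> R) (G : RR R -> R) t0 :
  (forall t, integrableH (F t)) -> (forall t q, is_derive t (1 : R) (F ^~ q) (dF t q)) ->
  integrableH G -> (forall t q, `|dF t q| <= G q) ->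
  is_derive t0 (1 : R) (fun t => I (F t)) (I (dF t0)).
Proof.
move=> Fi Fd Gi dFG.
have p1F t q : partial1of2 F t q = dF t q.
  by rewrite partial1of2E; exact: (@derive_val _ _ _ _ _ _ _ (Fd t q)).
have I1 : `]t0 - 1, t0 + 1[%classic t0 by rewrite /= in_itv /= gtrBl ltrDl ltr01.
have hI t : `]t0 - 1, t0 + 1[%classic t -> (@leb2 R).-integrable (@HH R) (EFin \o F t).
  by move=> _; exact: Fi.
have hD (t : R) (q : RR R) : `]t0 - 1, t0 + 1[%classic t -> HH q -> derivable (F ^~ q) t 1.
  by move=> _ _; case: (Fd t q).
have hG q : 0 <= G q by exact: le_trans (dFG t0 q).
have hB (t : R) (q : RR R) : `]t0 - 1, t0 + 1[%classic t -> HH q -> `|partial1of2 F t q| <= G q.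
  by move=> _ _; rewrite p1F.
have D1 := derivable_under_integral (@measurable_Hp R) I1 hI hD hG Gi hB.
have D2 := differentiation_under_integral (@measurable_Hp R) I1 hI hD hG Gi hB.
apply: DeriveDef; first exact: D1.
rewrite -derive1E; rewrite /derive1 in D2 *; rewrite D2; apply: eq_Rintegral => q _.
by rewrite p1F.
Qed.

Lemma conv_dX k f p : test_fun k -> integrableH f -> dX (convk k f) p (convk (px k) f p).
Proof.
move=> tk fi; have [M M0 kM] := tf_bounded (tf_px tk).
apply: (@derive_I (fun t q => f q * k (recenter (t, p.2) q))
  (fun t q => f q * px k (recenter (t, p.2) q)) (fun q => M * `|f q|)).
- by move=> t; exact: conv_int.
- move=> t q; have h := tf_dX (recenter (t, p.2) q) tk.
  have ha : is_derive t (1 : R) (fun s : R => s - q.1) 1.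
    by have := dXB (dX_fst (t, 0 : R)) (dX_cst q.1 (t, 0 : R)); rewrite subr0.
  have hc := @is_derive1_comp _ (fun s => k (s, p.2 - q.2 + 1)) (fun s : R => s - q.1) t _ _ h ha.
  have := dXZ (f q) (hc : dX (fun z => k (z.1 - q.1, p.2 - q.2 + 1)) (t, 0 : R) _).
  by rewrite mulr1.
- by apply: integrableHZ; exact: integrable_norm fi.
- by move=> t q; rewrite normrM mulrC ler_wpM2r.
Qed.

Lemma conv_dY k f p : test_fun k -> integrableH f -> dY (convk k f) p (convk (py k) f p).
Proof.
move=> tk fi; have [M M0 kM] := tf_bounded (tf_py tk).
apply: (@derive_I (fun t q => f q * k (recenter (p.1, t) q))
  (fun t q => f q * py k (recenter (p.1, t) q)) (fun q => M * `|f q|)).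
- by move=> t; exact: conv_int.
- move=> t q; have h := tf_dY (recenter (p.1, t) q) tk.
  have ha : is_derive t (1 : R) (fun s : R => s - q.2 + 1) 1.
    have := dXD (dXB (dX_fst (t, 0 : R)) (dX_cst q.2 (t, 0 : R))) (dX_cst 1 (t, 0 : R)).
    by rewrite subr0 addr0.
  have hc := @is_derive1_comp _ (fun s => k (p.1 - q.1, s)) (fun s : R => s - q.2 + 1) t _ _ h ha.
  have := dXZ (f q) (hc : dX (fun z => k (p.1 - q.1, z.1 - q.2 + 1)) (t, 0 : R) _).
  by rewrite mulr1.
- by apply: integrableHZ; exact: integrable_norm fi.
- by move=> t q; rewrite normrM mulrC ler_wpM2r.
Qed.

(** Every derivative falls on the kernel, so the induction varies [k] and keeps [f] fixed;
    continuity comes from the bound on the partial derivatives. *)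
Lemma conv_smooth k f : test_fun k -> integrableH f -> smooth_on (convk k f).
Proof.
move=> tk fi n; elim: n k tk => [|n IH] k tk.
  move=> p Hpp; have [M1 M10 k1] := tf_bounded (tf_px tk).
  have [M2 M20 k2] := tf_bounded (tf_py tk).
  have N0 : 0 <= I (fun q => `|f q|) by exact: I_ge0.
  apply: (@cont_of_partials _ _ _ ((M1 + M2) * I (fun q => `|f q|))).
  apply: filterS (near_Hp Hpp) => q _.
  rewrite (px_val (conv_dX q tk fi)) (py_val (conv_dY q tk fi)).
  split; [exact: conv_dX|exact: conv_dY| |].
    apply: le_trans (conv_bound q (tf_px tk) fi k1) _; apply: ler_wpM2r => //.
    by rewrite lerDl ltW.
  apply: le_trans (conv_bound q (tf_py tk) fi k2) _; apply: ler_wpM2r => //.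
  by rewrite lerDr ltW.
apply: Ck_partials.
- by move=> p _; rewrite (px_val (conv_dX p tk fi)) (py_val (conv_dY p tk fi));
    split; [exact: conv_dX|exact: conv_dY].
- apply: (Ck_ext (f := convk (px k) f)); last exact: IH (tf_px tk).
  by move=> p _; rewrite (px_val (conv_dX p tk fi)).
- apply: (Ck_ext (f := convk (py k) f)); last exact: IH (tf_py tk).
  by move=> p _; rewrite (py_val (conv_dY p tk fi)).
Qed.

End Mollifier.

(** * Approximation in [L^2] by mollification *)

Section Regularization.
Variable R : realType.
Implicit Types (f g k : R * R -> R) (p q c : R * R) (e : R).

(** A copy of the plane measure that carries a sigma-finite structure, for Tonelli's theorem on
    pairs of points of the plane. *)
Definition mu2 : set (RR R) -> \bar R := @leb2 R.
HB.instance Definition _ := Measure.copy mu2 (@lebesgue_measure R \x @lebesgue_measure R)%E.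
Lemma mu2_sigma_finite : sigma_finite setT mu2.
Proof.
have [F TF Foo] := @sigma_finiteT _ _ _ (@lebesgue_measure R).
exists (fun n => let x := unpickle n in if x is Some (i, j) then F i `*` F j else set0).
  rewrite -setXTT TF predeqE => -[x y]; split.
    move=> [/= [n _ Fnx] [k _ Gky]]; exists (pickle (n, k)) => //=.
    by rewrite pickleK.
  move=> [n _]; case: unpickle => [[i j] [/= h k]|//]; split; [by exists i|by exists j].
move=> n; case: unpickle => [[i j]|] /=; last first.
  by split; [exact: measurable0|rewrite measure0].
have [? ?] := Foo i; have [? ?] := Foo j.
split; first exact: measurableX.
rewrite /mu2 /leb2 product_measure1E//.
apply: lte_mul_pinfty => //.
by rewrite ge0_fin_numE.
Qed.
HB.instance Definition _ := Measure_isSigmaFinite.Build _ _ _ mu2 mu2_sigma_finite.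

Definition moll e f p : R := (kmass R)^-1 * I (fun q => f q * kern e p q).

(** The condition [e < 1/2] keeps the kernel centred at [(0, 1)] inside the half-plane; it
    accompanies every use of [moll] as a convolution. *)
Lemma tf_kern0 e : 0 < e -> e < 1 / 2 -> test_fun (kern e (0, 1)).
Proof. by move=> e0 e2; apply: tf_kern => //=; lra. Qed.

Lemma moll_conv e f p : moll e f p = (kmass R)^-1 * convk (kern e (0, 1)) f p.
Proof.
rewrite /moll /convk (@eq_I _ _ (fun q => f q * kern e (0, 1) (recenter p q)))//.
by move=> q _; rewrite kern_shift.
Qed.

Lemma moll_smooth e f : 0 < e -> e < 1 / 2 -> integrableH f -> smooth_on (moll e f).
Proof.
move=> e0 e2 fi n.
apply: (Ck_ext (f := fun p => (kmass R)^-1 * convk (kern e (0, 1)) f p)).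
  by move=> p _; rewrite moll_conv.
by apply: CkZ; apply: conv_smooth => //; exact: tf_kern0.
Qed.

Lemma kernE e p : kern e p = fun q => kern e (0, 1) (recenter p q).
Proof. by apply/funext => q; rewrite kern_shift. Qed.

Lemma dX_recenter k p q : test_fun k ->
  dX (fun q => k (recenter p q)) q (- px k (recenter p q)).
Proof.
move=> tk.
have h : is_derive (p.1 - q.1) (1 : R) (fun s => k (s, p.2 - q.2 + 1))
  (px k (recenter p q)) := tf_dX (recenter p q) tk.
have ha : is_derive q.1 (1 : R) (fun s : R => p.1 - s) (-1).
  by have := dXB (dX_cst p.1 (q.1, 0 : R)) (dX_fst (q.1, 0 : R)); rewrite sub0r.
have hc := @is_derive1_comp _ (fun s => k (s, p.2 - q.2 + 1)) (fun s : R => p.1 - s) q.1 _ _ h ha.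
by rewrite -mulrN1; exact hc.
Qed.

Lemma dY_recenter k p q : test_fun k ->
  dY (fun q => k (recenter p q)) q (- py k (recenter p q)).
Proof.
move=> tk.
have h : is_derive (p.2 - q.2 + 1) (1 : R) (fun s => k (p.1 - q.1, s))
  (py k (recenter p q)) := tf_dY (recenter p q) tk.
have ha : is_derive q.2 (1 : R) (fun s : R => p.2 - s + 1) (-1).
  have := dXD (dXB (dX_cst p.2 (q.2, 0 : R)) (dX_fst (q.2, 0 : R))) (dX_cst 1 (q.2, 0 : R)).
  by rewrite sub0r addr0.
have hc := @is_derive1_comp _ (fun s => k (p.1 - q.1, s)) (fun s : R => p.2 - s + 1) q.2 _ _ h ha.
by rewrite -mulrN1; exact hc.
Qed.

Lemma px_kern_shift e p q : 0 < e -> e < 1 / 2 ->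
  px (kern e (0, 1)) (recenter p q) = - px (kern e p) q.
Proof.
by move=> e0 e2; rewrite (kernE e p) (px_val (dX_recenter p q (tf_kern0 e0 e2))) opprK.
Qed.

Lemma py_kern_shift e p q : 0 < e -> e < 1 / 2 ->
  py (kern e (0, 1)) (recenter p q) = - py (kern e p) q.
Proof.
by move=> e0 e2; rewrite (kernE e p) (py_val (dY_recenter p q (tf_kern0 e0 e2))) opprK.
Qed.

(** The kernel depends on [p - q] only, so a derivative in the centre is minus one in the
    integration variable. Written with [px (kern e p)], the formula fits weak equations tested
    against [kern e p]. *)
Lemma moll_dX e f p : 0 < e -> e < 1 / 2 -> integrableH f ->
  dX (moll e f) p (- (kmass R)^-1 * I (fun q => f q * px (kern e p) q)).
Proof.
move=> e0 e2 fi; have tk := tf_kern0 e0 e2.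
have -> : moll e f = fun p => (kmass R)^-1 * convk (kern e (0, 1)) f p.
  by apply/funext => q; exact: moll_conv.
apply: dX_eq (dXZ _ (conv_dX p tk fi)) _; rewrite mulNr -mulrN; congr (_ * _).
rewrite -IN; last first.
  apply: eq_integrableH (integrableHN (conv_int p (tf_px tk) fi)) => q _.
  by rewrite px_kern_shift// mulrN opprK.
by apply: eq_I => q _; rewrite px_kern_shift// mulrN.
Qed.

Lemma moll_dY e f p : 0 < e -> e < 1 / 2 -> integrableH f ->
  dY (moll e f) p (- (kmass R)^-1 * I (fun q => f q * py (kern e p) q)).
Proof.
move=> e0 e2 fi; have tk := tf_kern0 e0 e2.
have -> : moll e f = fun p => (kmass R)^-1 * convk (kern e (0, 1)) f p.
  by apply/funext => q; exact: moll_conv.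
apply: dY_eq (dYZ _ (conv_dY p tk fi)) _; rewrite mulNr -mulrN; congr (_ * _).
rewrite -IN; last first.
  apply: eq_integrableH (integrableHN (conv_int p (tf_py tk) fi)) => q _.
  by rewrite py_kern_shift// mulrN opprK.
by apply: eq_I => q _; rewrite py_kern_shift// mulrN.
Qed.

Lemma moll_dXX e f p : 0 < e -> e < 1 / 2 -> integrableH f ->
  dX (px (moll e f)) p ((kmass R)^-1 * I (fun q => f q * px (px (kern e p)) q)).
Proof.
move=> e0 e2 fi; have tk := tf_kern0 e0 e2.
have -> : px (moll e f) = fun p => (kmass R)^-1 * convk (px (kern e (0, 1))) f p.
  apply/funext => r; apply: px_val.
  have -> : moll e f = fun p => (kmass R)^-1 * convk (kern e (0, 1)) f p.
    by apply/funext => q; exact: moll_conv.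
  exact: dXZ _ (conv_dX r tk fi).
have E : px (kern e p) = fun q => - px (kern e (0, 1)) (recenter p q).
  by apply/funext => r; rewrite px_kern_shift// opprK.
rewrite (@eq_I _ _ (fun q => f q * px (px (kern e (0, 1))) (recenter p q))).
  exact: dXZ _ (conv_dX p (tf_px tk) fi).
by move=> q _; rewrite E (px_val (dXN (dX_recenter p q (tf_px tk)))) opprK.
Qed.

Lemma moll_dYY e f p : 0 < e -> e < 1 / 2 -> integrableH f ->
  dY (py (moll e f)) p ((kmass R)^-1 * I (fun q => f q * py (py (kern e p)) q)).
Proof.
move=> e0 e2 fi; have tk := tf_kern0 e0 e2.
have -> : py (moll e f) = fun p => (kmass R)^-1 * convk (py (kern e (0, 1))) f p.
  apply/funext => r; apply: py_val.
  have -> : moll e f = fun p => (kmass R)^-1 * convk (kern e (0, 1)) f p.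
    by apply/funext => q; exact: moll_conv.
  exact: dYZ _ (conv_dY r tk fi).
have E : py (kern e p) = fun q => - py (kern e (0, 1)) (recenter p q).
  by apply/funext => r; rewrite py_kern_shift// opprK.
rewrite (@eq_I _ _ (fun q => f q * py (py (kern e (0, 1))) (recenter p q))).
  exact: dYZ _ (conv_dY p (tf_py tk) fi).
by move=> q _; rewrite E (py_val (dYN (dY_recenter p q (tf_py tk)))) opprK.
Qed.

Lemma kern_int e p f : 0 < e -> e < 1 / 2 -> integrableH f ->
  integrableH (fun q => f q * kern e p q).
Proof.
move=> e0 e2 fi; apply: eq_integrableH (conv_int p (tf_kern0 e0 e2) fi) => q _.
by rewrite kern_shift.
Qed.

(** Close to the boundary a part of the kernel falls outside the half-plane, whence an inequality
    for the mass. *)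
Lemma kern_intH e p : 0 < e -> integrableH (kern e p) /\ I (kern e p) <= kmass R.
Proof.
move=> e0.
have key : (\int[@leb2 R]_(q in @HH R) (kern e p q)%:E <= (kmass R)%:E)%E.
  rewrite -(int_kern p e0); apply: ge0_subset_integral => //.
  - by apply/measurable_EFinP; exact: kern_measT.
  - by move=> q _; rewrite lee_fin kern_ge0.
have ki : integrableH (kern e p).
  apply/integrableP; split.
    by apply: measH_EFin; apply: cont_measH => q _; exact: kern_contT.
  rewrite (eq_integral (fun q : RR R => (kern e p q)%:E)); last first.
    by move=> q _ /=; rewrite ger0_norm ?kern_ge0.
  by apply: le_lt_trans key _; rewrite ltry.
by split => //; rewrite -lee_fin -integralEI.
Qed.

Lemma I_kern e p : 0 < e -> 2 * e < p.2 -> I (kern e p) = kmass R.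
Proof.
move=> e0 ep; have tk := tf_kern e0 ep.
apply: EFin_inj; rewrite -(integralEI (tf_int tk)) integralT_supp ?int_kern// => q.
exact: tf_off.
Qed.

(** Jensen's inequality for the averaging kernel, from positivity of the integral of [(f - c)^2]
    against it for every constant [c]. *)
Lemma moll_sqr e f p : 0 < e -> e < 1 / 2 -> integrableH f -> L2fun f ->
  moll e f p ^+ 2 <= (kmass R)^-1 * I (fun q => f q ^+ 2 * kern e p q).
Proof.
move=> e0 e2 fi f2; have m0 := kmass_gt0 R.
have fki := kern_int p e0 e2 fi; have f2ki := kern_int p e0 e2 (L2_sqr f2).
have [ki kle] := kern_intH p e0.
have : I (fun q => f q * kern e p q) ^+ 2 <= I (fun q => f q ^+ 2 * kern e p q) * kmass R.
  apply: quad_bound; first exact: ltW.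
  move=> c; have : 0 <= I (fun q => (f q - c) ^+ 2 * kern e p q).
    by apply: I_ge0 => q _; rewrite mulr_ge0 ?sqr_ge0 ?kern_ge0.
  have -> : I (fun q => (f q - c) ^+ 2 * kern e p q) =
      I (fun q => f q ^+ 2 * kern e p q) - 2 * c * I (fun q => f q * kern e p q) + c ^+ 2 * I (kern e p).
    rewrite -!IZ// -IB//; last exact: integrableHZ.
    rewrite -ID; [|by apply: integrableHB => //; exact: integrableHZ|exact: integrableHZ].
    by apply: eq_I => q _; ring.
  move=> h; have := ler_wpM2l (sqr_ge0 c) kle; lra.
move=> h; rewrite /moll exprMn expr2 -mulrA ler_pM2l ?invr_gt0//.
by rewrite ler_pdivrMl// mulrC.
Qed.

Lemma moll_meas e f : 0 < e -> e < 1 / 2 -> integrableH f -> measH (moll e f).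
Proof. by move=> e0 e2 fi; apply: smooth_measH; exact: moll_smooth. Qed.

Lemma d2_meas : measurable_fun [set: RR R * RR R] (fun z : RR R * RR R => d2 z.1 z.2).
Proof.
apply: measurable_funD; apply: measurable_funX; apply: measurable_funB;
  (apply: measurableT_comp; [first [exact: measurable_fst|exact: measurable_snd]|
  first [exact: measurable_fst|exact: measurable_snd]]).
Qed.

Lemma kern_meas2 e : measurable_fun [set: RR R * RR R] (fun z : RR R * RR R => kern e z.1 z.2).
Proof.
apply: measurable_funM => //; apply: (measurableT_comp (f := @hump R)).
  by apply: continuous_measurable_fun; exact: hump_cont.
by apply: measurable_funM => //; exact: d2_meas.
Qed.

(** Integrate [moll_sqr] in [p] and exchange the integrals. The kernel is symmetric in its two
    points, so the inner integral becomes [kmass]. *)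
Lemma young e f : 0 < e -> e < 1 / 2 -> integrableH f -> L2fun f ->
  L2fun (moll e f) /\ nsq (moll e f) <= nsq f.
Proof.
move=> e0 e2 fi f2; have m0 := kmass_gt0 R; have mm := moll_meas e0 e2 fi.
(* The square of [f] extended by 0, so that Tonelli's theorem runs over the full plane in both
   variables. *)
pose g : RR R -> R := fun q => (f \_ (@HH R)) q ^+ 2.
have mg : measurable_fun [set: RR R] g.
  apply: measurable_funX; apply/(measurable_restrictT _ (@measurable_Hp R)).
  by case: f2.
have g0 q : 0 <= g q by exact: sqr_ge0.
have gE q : HH q -> g q = f q ^+ 2 by move=> h; rewrite /g patchE mem_set.
have gN q : ~ HH q -> g q = 0 by move=> h; rewrite /g patchE memNset// expr0n.
have inner p : (\int[@leb2 R]_q (g q * kern e p q)%:E = (I (fun q => f q ^+ 2 * kern e p q))%:E)%E.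
  rewrite -(integralEI (kern_int p e0 e2 (L2_sqr f2))) integral_mkcond.
  rewrite [RHS]integral_mkcond; apply: eq_integral => q _; rewrite !patchE mem_setT.
  case: ifPn => [|/negP]; rewrite inE => h; first by rewrite gE.
  by rewrite gN// mul0r.
have mF : measurable_fun [set: RR R * RR R] (fun z : RR R * RR R => (g z.2 * kern e z.1 z.2)%:E).
  apply/measurable_EFinP; apply: measurable_funM; last exact: kern_meas2.
  by apply: (measurableT_comp mg); exact: measurable_snd.
have F0 z : (0 <= (g z.2 * kern e z.1 z.2)%:E)%E.
  by rewrite lee_fin mulr_ge0 ?kern_ge0.
have hI p : (0 <= (kmass R)^-1%:E * \int[@leb2 R]_q (g q * kern e p q)%:E)%E.
  rewrite mule_ge0// ?lee_fin ?invr_ge0 ?(ltW m0)//.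
  by apply: integral_ge0 => q _; exact: (F0 (p, q)).
have hM : measurable_fun [set: RR R] (fun p : RR R =>
    (kmass R)^-1%:E * \int[@leb2 R]_q (g q * kern e p q)%:E)%E.
  apply: measurable_funeM => //.
  exact (@measurable_fun_fubini_tonelli_F _ _ _ _ _ mu2 _ mF F0).
have key : (\int[@leb2 R]_(p in @HH R) (moll e f p ^+ 2)%:E <= (nsq f)%:E)%E.
  apply: (@le_trans _ _ (\int[@leb2 R]_(p in @HH R)
      ((kmass R)^-1%:E * \int[@leb2 R]_q (g q * kern e p q)%:E))%E).
    apply: ge0_le_integral; first exact: measurable_Hp.
    - by move=> p _; rewrite lee_fin sqr_ge0.
    - by apply: measH_EFin; exact: measurable_funX.
    - exact: measurable_funTS.
    - by move=> p _; rewrite inner -EFinM lee_fin moll_sqr.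
  apply: (@le_trans _ _ (\int[@leb2 R]_p
      ((kmass R)^-1%:E * \int[@leb2 R]_q (g q * kern e p q)%:E))%E).
    apply: ge0_subset_integral; [exact: measurable_Hp|exact: measurableT|exact: hM| |by []].
    by move=> p _; exact: hI.
  rewrite ge0_integralZl//; last first.
  - by rewrite lee_fin invr_ge0 ltW.
  - by move=> p _; apply: integral_ge0 => q _; exact: (F0 (p, q)).
  - exact (@measurable_fun_fubini_tonelli_F _ _ _ _ _ mu2 _ mF F0).
  have -> : (\int[@leb2 R]_p \int[@leb2 R]_q (g q * kern e p q)%:E =
      \int[@leb2 R]_q \int[@leb2 R]_p (g q * kern e p q)%:E)%E.
    exact (@fubini_tonelli _ _ _ _ _ mu2 mu2 _ mF F0).
  rewrite (eq_integral (fun q : RR R => (kmass R)%:E * (g q)%:E)%E); last first.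
    move=> q _; rewrite -(int_kern q e0) muleC -ge0_integralZl; first last.
    - by rewrite lee_fin.
    - by move=> p _; rewrite lee_fin kern_ge0.
    - by apply/measurable_EFinP; exact: kern_measT.
    - exact: measurableT.
    by apply: eq_integral => p _; rewrite -EFinM kernC.
  rewrite ge0_integralZl//; last first.
  - by rewrite lee_fin ltW.
  - by move=> q _; rewrite lee_fin.
  - exact/measurable_EFinP.
  rewrite muleA -EFinM mulVf ?gt_eqF// mul1e.
  rewrite -(integralEI (L2_sqr f2)) [leRHS]integral_mkcond.
  rewrite le_eqVlt; apply/orP; left; apply/eqP; apply: eq_integral => q _.
  rewrite patchE; case: ifPn => [|/negP]; rewrite inE => h; first by rewrite gE.
  by rewrite gN.
have m2 : L2fun (moll e f).
  by split => //; apply: le_lt_trans key _; rewrite ltry.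
by split => //; rewrite -lee_fin -(integralEI (L2_sqr m2)).
Qed.

(** A test function is Lipschitz, which controls the error pointwise; the cutoff on the right
    records its compact support, so that the bound can be squared and integrated. *)
Lemma moll_test f : test_fun f -> exists C e1 (n : nat), [/\ 0 < C, 0 < e1 &
  forall e, 0 < e -> e < e1 -> forall p, Hp p -> `|moll e f p - f p| <= C * e * cutoff n p].
Proof.
move=> tf; have m0 := kmass_gt0 R.
have [a [b [a0 b0 fs]]] := tf_box tf.
have [M1 M10 k1] := tf_bounded (tf_px tf); have [M2 M20 k2] := tf_bounded (tf_py tf).
pose L := M1 + M2; have L0 : 0 < L by rewrite addr_gt0.
have lip p q : `|f q - f p| <= L * (`|q.1 - p.1| + `|q.2 - p.2|).
  apply: (@lip_of_partials _ _ _ (`|q.1 - p.1| + `|q.2 - p.2| + 1)).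
  - move=> r _ _; split; [exact: tf_dX|exact: tf_dY| |].
      by apply: le_trans (k1 r) _; rewrite lerDl ltW.
    by apply: le_trans (k2 r) _; rewrite lerDr ltW.
  - by rewrite -addrA ltrDl ltr_wpDl.
  - by rewrite addrAC ltrDr ltr_wpDl.
have a2 : 0 < a / 2 by rewrite divr_gt0.
have [n nP] := @box_rho R (a / 2) (b + 1) a2.
(* The kernel moves each coordinate by less than [2 e], hence the factor 4. Scales below [a/8] and
   [1/4] keep the mollification supported in [box (a / 2) (b + 1)], where the cutoff is 1. *)
exists (4 * L), (Num.min (a / 8) (1 / 4)), n; split.
- by rewrite mulr_gt0.
- by rewrite lt_min !divr_gt0.
move=> e e0; rewrite lt_min => /andP[ea e4] p Hpp.
have e2 : e < 1 / 2 by lra.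
have fi := tf_int tf; have fki := kern_int p e0 e2 fi.
have [bp|np] := pselect (box (a / 2) (b + 1) p); last first.
  have fp : f p = 0.
    by apply: fs => bp; apply: np; apply: box_sub bp; [rewrite ler_pdivrMr// ler_peMr ?ler1n// ltW|rewrite lerDl].
  rewrite fp subr0 /moll (_ : I _ = 0) ?mulr0 ?normr0; last first.
    rewrite -[RHS](I0 R); apply: eq_I => q _.
    have [bq|nq] := pselect (box a b q); last by rewrite fs// mul0r.
    have [->|kq] := eqVneq (kern e p q) 0; first by rewrite mulr0.
    have [] := kern_supp e0 kq; rewrite !ltr_norml => /andP[h1 h2] /andP[h3 h4].
    move: bq => /boxP[/andP[h5 h6] /andP[h7 h8]].
    by exfalso; apply: np; apply/boxP; split; apply/andP; split; lra.
  by rewrite mulr_ge0 ?cut_ge0// mulr_ge0 ?mulr_ge0 ?(ltW L0)// ltW.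
rewrite (@cut1 _ n p Hpp (nP _ bp)) mulr1.
have ep : 2 * e < p.2 by move: bp => /boxP[_ /andP[h _]]; lra.
have [ki _] := kern_intH p e0.
have -> : moll e f p - f p = (kmass R)^-1 * I (fun q => (f q - f p) * kern e p q).
  rewrite (_ : I (fun q => (f q - f p) * kern e p q) =
    I (fun q => f q * kern e p q) - f p * kmass R).
    by rewrite mulrBr mulrCA mulVf ?mulr1 ?gt_eqF.
  rewrite -(I_kern e0 ep) -IZ// -IB//; last exact: integrableHZ.
  by apply: eq_I => q _; rewrite mulrBl.
have di : integrableH (fun q => (f q - f p) * kern e p q).
  apply: eq_integrableH (integrableHB fki (integrableHZ (f p) ki)) => q _.
  by rewrite mulrBl.
rewrite normrM ger0_norm ?invr_ge0 ?(ltW m0)// ler_pdivrMl//.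
apply: le_trans (le_normr_Rintegral _ di) _ => //.
rewrite mulrC -(I_kern e0 ep) -IZ//.
apply: le_I; [exact: (integrable_norm di)|exact: integrableHZ|].
move=> q _; have [->|kq] := eqVneq (kern e p q) 0; first by rewrite !mulr0 normr0.
rewrite normrM (ger0_norm (kern_ge0 _ _ _)) ler_wpM2r ?kern_ge0//.
apply: le_trans (lip p q) _; have [h1 h2] := kern_supp e0 kq.
by rewrite -mulrA mulrCA ler_pM2l//; lra.
Qed.

Lemma mollB e f g p : 0 < e -> e < 1 / 2 -> integrableH f -> integrableH g ->
  moll e (fun q => f q - g q) p = moll e f p - moll e g p.
Proof.
move=> e0 e2 fi gi; rewrite /moll -mulrBr -IB; [|exact: kern_int..].
by congr (_ * _); apply: eq_I => q _; rewrite mulrBl.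
Qed.

(** Compare with one test function close to [g]: mollification contracts the difference by [young]
    and barely moves the test function by [moll_test]. The approximating sequence is a hypothesis,
    which forms in the closure of the test forms bring along. *)
Lemma moll_cvg (F : nat -> R * R -> R) g : (forall n, test_fun (F n)) ->
  L2fun g -> integrableH g -> L2cvg F g ->
  forall d, 0 < d -> exists2 e1, 0 < e1 & forall e, 0 < e -> e < e1 ->
    nsq (fun p => moll e g p - g p) < d.
Proof.
have aux (x y z t w d : R) : 0 < d -> y <= d / 16 -> z <= w -> x <= 2 * z + 2 * t -> t <= 2 * y + 2 * w ->
    w < d / 16 -> x < d by move=> h0 h1 h2 h3 h4 h5; lra.
move=> tF g2 gi Fg d d0.
have [N NP] := cvg0_epsE Fg (divr_gt0 d0 (ltr0n R 16)).
have := NP N (leqnn _); rewrite ger0_norm ?nsq_ge0// => hN.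
set f := F N in hN; have tf : test_fun f by exact: tF.
have f2 := tf_L2 tf; have fi := tf_int tf.
have [C [e1 [n [C0 e10 H]]]] := moll_test tf.
have c2 := tf_L2 (tf_cut R n).
pose X := C ^+ 2 * nsq (@cutoff R n) + 1.
have X0 : 0 < X by rewrite ltr_wpDl// mulr_ge0 ?nsq_ge0// sqr_ge0.
(* For [e < 1] one has [e^2 <= e < e3], so the mollification error of the test function is at most
   [X * e3 = d / 16]. *)
pose e3 := d / (16 * X); have e30 : 0 < e3 by rewrite divr_gt0// mulr_gt0.
exists (Num.min e1 (Num.min (1 / 2) (Num.min e3 1))).
  by rewrite !lt_min e10 e30 ltr01 divr_gt0.
move=> e e0; rewrite !lt_min => /and4P[h1 h2 h3 h4].
have [mf2 _] := young e0 h2 fi f2; have [mg2 _] := young e0 h2 gi g2.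
have d2 := L2B g2 f2; have di := integrableHB gi fi.
have [md2 mdle] := young e0 h2 di d2.
have A : nsq (fun p => moll e f p - f p) <= d / 16.
  apply: (@le_trans _ _ (nsq (fun p => (C * e) * cutoff n p))).
    apply: le_nsq; [exact: L2B|exact: L2Z|].
    move=> p Hpp; have := H e e0 h1 p Hpp.
    rewrite -[X in _ -> X <= _](real_normK (num_real _)) => h; rewrite ler_sqr ?nnegrE//.
    by apply: mulr_ge0; [apply: mulr_ge0; exact: ltW|exact: cut_ge0].
  rewrite nsqZ// exprMn mulrAC.
  have s1 : C ^+ 2 * nsq (@cutoff R n) <= X by rewrite /X lerDl.
  have s2 : e ^+ 2 <= e3.
    by apply: le_trans (ltW h3); rewrite expr2 ler_piMr// ltW.
  have s3 : X * e3 = d / 16 by rewrite /e3; field; rewrite gt_eqF.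
  by rewrite -s3 ler_pM// ?sqr_ge0// mulr_ge0 ?nsq_ge0// sqr_ge0.
have B : nsq (fun p => moll e g p - moll e f p) <= nsq (fun p => g p - f p).
  by apply: le_trans mdle; rewrite le_eqVlt; apply/orP; left; apply/eqP;
    apply: eq_nsq => p _; rewrite mollB.
have E1 : nsq (fun p => moll e g p - g p) <= 2 * nsq (fun p => moll e g p - moll e f p) +
    2 * nsq (fun p => moll e f p - g p).
  rewrite (@eq_nsq _ _ (fun p => (moll e g p - moll e f p) + (moll e f p - g p))).
    by apply: nsqD_le; exact: L2B.
  by move=> p _; ring.
have E2 : nsq (fun p => moll e f p - g p) <= 2 * nsq (fun p => moll e f p - f p) +
    2 * nsq (fun p => f p - g p).
  rewrite (@eq_nsq _ _ (fun p => (moll e f p - f p) + (f p - g p))).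
    by apply: nsqD_le; exact: L2B.
  by move=> p _; ring.
rewrite (nsqBC g f) in B; exact: aux d0 A B E1 E2 hN.
Qed.

Lemma moll_cvg_seq (F : nat -> R * R -> R) g e0 : (forall n, test_fun (F n)) ->
  L2fun g -> integrableH g -> L2cvg F g -> 0 < e0 ->
  L2cvg (fun n : nat => moll (e0 / n.+1%:R) g) g.
Proof.
move=> tF g2 gi Fg e00; apply: cvg0_eps => [n|d d0]; first exact: nsq_ge0.
have [e1 e10 H] := moll_cvg tF g2 gi Fg d0.
exists (Num.truncn (e0 / e1)) => n Nn; apply: H; first by rewrite divr_gt0.
rewrite ltr_pdivrMr// mulrC -ltr_pdivrMr//; apply: lt_le_trans (truncnS_gt _) _.
by rewrite ler_nat.
Qed.

(** Kernels of small scale centred in [box a b] live in a larger box on which one fixed cutoff is 1.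
    A function in [L^2] can be multiplied by that cutoff, which makes it integrable, without
    changing its averages over [box a b]. *)
Lemma kern_nest a b : 0 < a -> exists m e0, [/\ 0 < e0, e0 < 1 / 2,
  forall e p, 0 < e -> e < e0 -> box a b p ->
    2 * e < p.2 /\ supp_in (kern e p) (a / 2) (b + 1) &
  forall q, box (a / 2) (b + 1) q -> cutoff m q = 1 :> R].
Proof.
move=> a0; have a2 : 0 < a / 2 by rewrite divr_gt0.
have [m mP] := @box_rho R (a / 2) (b + 1) a2.
exists m, (Num.min (a / 8) (1 / 4)); split.
- by rewrite lt_min !divr_gt0.
- by rewrite gt_min; apply/orP; right; lra.
- move=> e p e0; rewrite lt_min => /andP[ea e4] /boxP[/andP[h1 h2] /andP[h3 h4]].
  split; first lra.
  move=> q nq; apply/eqP; apply: contraT => kq; exfalso; apply: nq.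
  have [] := kern_supp e0 kq; rewrite !ltr_norml => /andP[g1 g2] /andP[g3 g4].
  by apply/boxP; split; apply/andP; split; lra.
- by move=> q bq; apply: cut1; [exact: box_Hp bq|exact: mP].
Qed.

End Regularization.

(** * Deformation tensors and the Bochner identity *)

Section Forms.
Variable R : realType.
Implicit Types (f g psi : R * R -> R) (p q : R * R) (u v w th : oneform R) (D E : sym2 R).

(** The density of [|D|^2 Vol] involves [y] times the components of [D], so tensors are measured
    through [ym]; [yd] puts the inverse weight on the test functions paired with them. *)
Definition ym f p : R := p.2 * f p.
Definition yd f p : R := f p / p.2.

Lemma smooth_snd : smooth_on (@snd R R).
Proof. by move=> n; exact: Ck_snd. Qed.

Lemma smooth_sndV : smooth_on (fun p : R * R => p.2^-1).
Proof. by move=> n; apply: CkV; [move=> p Hpp; rewrite gt_eqF|exact: Ck_snd]. Qed.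

Lemma Hp_neq0 p : Hp p -> p.2 != 0.
Proof. by move=> Hpp; rewrite gt_eqF. Qed.

Lemma tf_ym f : test_fun f -> test_fun (ym f).
Proof. exact: smoothM_tf smooth_snd. Qed.

Lemma tf_yd f : test_fun f -> test_fun (yd f).
Proof.
by move=> tf; apply: tf_eq (smoothM_tf smooth_sndV tf) => p; rewrite mulrC.
Qed.

Lemma smooth_ym f : smooth_on f -> smooth_on (ym f).
Proof. by move=> fC n; apply: CkM; [exact: smooth_snd|exact: fC]. Qed.

Lemma smooth_yd f : smooth_on f -> smooth_on (yd f).
Proof. by move=> fC n; apply: CkM; [exact: fC|exact: smooth_sndV]. Qed.

Lemma measH_ym f : measH f -> measH (ym f).
Proof. by apply: measurable_funM; exact: smooth_measH smooth_snd. Qed.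

Lemma measH_ymV f : measH (ym f) -> measH f.
Proof.
move=> mf; have := measurable_funM (smooth_measH smooth_sndV) mf.
apply: eq_measurable_fun => p; rewrite inE => Hpp.
by rewrite /= /ym mulrA mulVf ?mul1r// Hp_neq0.
Qed.

Lemma ym_yd f p : Hp p -> ym (yd f) p = f p.
Proof. by move=> /Hp_neq0 h; rewrite /ym /yd mulrC divfK. Qed.

Lemma yd_ym f p : Hp p -> yd (ym f) p = f p.
Proof. by move=> /Hp_neq0 h; rewrite /ym /yd mulrAC divff// mul1r. Qed.

Definition L2D3 D := [/\ L2fun (ym (s11 D)), L2fun (ym (s12 D)) & L2fun (ym (s22 D))].

Lemma tensqE a D p : tensq a D p =
  a ^+ 2 * (ym (s11 D) p ^+ 2 + 2 * ym (s12 D) p ^+ 2 + ym (s22 D) p ^+ 2).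
Proof. by rewrite /tensq /ym; ring. Qed.

Lemma tensq_int a D : L2D3 D -> integrableH (tensq a D) /\
  I (tensq a D) = a ^+ 2 * (nsq (ym (s11 D)) + 2 * nsq (ym (s12 D)) + nsq (ym (s22 D))).
Proof.
move=> [/L2_sqr h1 /L2_sqr h2 /L2_sqr h3]; have h22 := integrableHZ 2 h2.
have hs := integrableHD (integrableHD h1 h22) h3.
split.
  by apply: eq_integrableH (integrableHZ (a ^+ 2) hs) => p _; rewrite tensqE.
rewrite /nsq -IZ// -ID// -ID//; last exact: integrableHD.
by rewrite -IZ//; apply: eq_I => p _; rewrite tensqE.
Qed.

Lemma L2symP a D : 0 < a -> L2sym a D <-> L2D3 D.
Proof.
move=> a0; have a2 : 0 < a ^+ 2 by exact: exprn_gt0.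
split=> [[m1 m2 m3 fin]|D3].
  have mt : measH (tensq a D).
    by apply: measurable_funM; [apply: measurable_funM => //; apply: measurable_funX;
      exact: smooth_measH smooth_snd|apply: measurable_funD; [apply: measurable_funD;
      [|apply: measurable_funM => //]|]; apply: measurable_funX].
  have t0 p : 0 <= tensq a D p.
    rewrite tensqE; apply: mulr_ge0; first exact: sqr_ge0.
    by have := sqr_ge0 (ym (s11 D) p); have := sqr_ge0 (ym (s12 D) p); have := sqr_ge0 (ym (s22 D) p); lra.
  have ti : integrableH (tensq a D).
    apply/integrableP; split; first exact: measH_EFin.
    apply: le_lt_trans fin; rewrite le_eqVlt; apply/orP; left; apply/eqP.
    by apply: eq_integral => p _ /=; rewrite ger0_norm.
  have aux f : measH f -> (forall p, ym f p ^+ 2 <= a ^- 2 * tensq a D p) -> L2fun (ym f).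
    move=> mf fle; apply: sqr_L2; first exact: measH_ym.
    apply: le_integrableH (integrableHZ (a ^- 2) ti) _.
      by apply: measurable_funX; exact: measH_ym.
    by move=> p _; rewrite ger0_norm ?sqr_ge0.
  have le3 p : (ym (s11 D) p ^+ 2 + 2 * ym (s12 D) p ^+ 2 + ym (s22 D) p ^+ 2) = a ^- 2 * tensq a D p.
    have an : a ^+ 2 != 0 by rewrite gt_eqF.
    by rewrite tensqE mulKf.
  split; apply: aux => // p; rewrite -le3;
  by have := sqr_ge0 (ym (s11 D) p); have := sqr_ge0 (ym (s12 D) p); have := sqr_ge0 (ym (s22 D) p); lra.
have [ti _] := tensq_int a D3; case: D3 => d1 d2 d3; split.
- by apply: measH_ymV; case: d1.
- by apply: measH_ymV; case: d2.
- by apply: measH_ymV; case: d3.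
- by rewrite integralEI// ltry.
Qed.

Lemma formsq_int u : L2form u -> integrableH (formsq u) /\
  I (formsq u) = nsq (fm1 u) + nsq (fm2 u).
Proof.
move=> [/L2_sqr h1 /L2_sqr h2]; split; first exact: integrableHD.
by rewrite /nsq -ID.
Qed.

Lemma L2form_sub u v : L2form u -> L2form v -> L2form (form_sub u v).
Proof. by move=> [u1 u2] [v1 v2]; split; exact: L2B. Qed.

Lemma ymB f g p : ym (fun q => f q - g q) p = ym f p - ym g p.
Proof. by rewrite /ym mulrBr. Qed.

Lemma L2D3_sub D E : L2D3 D -> L2D3 E -> L2D3 (sym_sub D E).
Proof.
move=> [d1 d2 d3] [e1 e2 e3].
by split; [apply: eq_L2 (L2B d1 e1)|apply: eq_L2 (L2B d2 e2)|apply: eq_L2 (L2B d3 e3)] => p _;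
  rewrite /= ymB.
Qed.

Lemma tf_form_L2 th : test_form th -> L2form th.
Proof. by move=> [t1 t2]; split; exact: tf_L2. Qed.

Lemma tf_Def th : test_form th ->
  [/\ test_fun (s11 (Def_smooth th)), test_fun (s12 (Def_smooth th)) & test_fun (s22 (Def_smooth th))].
Proof.
move=> [t1 t2]; split.
- by apply: tfB; [exact: tf_px|exact: tf_yd].
- apply: tfD; last exact: tf_yd.
  apply: tf_eq (tfZ 2^-1 (tfD (tf_py t1) (tf_px t2))) => p; by rewrite mulrC.
- by apply: tfD; [exact: tf_py|exact: tf_yd].
Qed.

Lemma tf_Def_L2 th : test_form th -> L2D3 (Def_smooth th).
Proof. by move=> /tf_Def[h1 h2 h3]; split; apply: tf_L2; exact: tf_ym. Qed.

Definition H1n (a : R) u D : R := nsq (fm1 u) + nsq (fm2 u) +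
  2 * (a ^+ 2 * (nsq (ym (s11 D)) + 2 * nsq (ym (s12 D)) + nsq (ym (s22 D)))).

Lemma H1dist2E a u D th : L2form u -> L2D3 D -> test_form th ->
  H1dist2 a u D th = (H1n a (form_sub u th) (sym_sub D (Def_smooth th)))%:E.
Proof.
move=> u2 d3 tt; have [i1 e1] := formsq_int (L2form_sub u2 (tf_form_L2 tt)).
have [i2 e2] := tensq_int a (L2D3_sub d3 (tf_Def_L2 tt)).
by rewrite /H1dist2 !integralEI// e1 e2 -EFinM -EFinD.
Qed.

(* [Jf] embeds pairs [(u, Def u)] isometrically into the square of the [H^1]
   norm: the entries of [Def u] carry the weights of [2 * tensq]. *)
Definition Jf (a : R) u D (i : 'I_5) : R * R -> R :=
  let s := Num.sqrt 2 * a in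
  nth (fun=> 0) [:: fm1 u; fm2 u; (fun p => s * ym (s11 D) p);
    (fun p => 2 * a * ym (s12 D) p); (fun p => s * ym (s22 D) p)] i.

Lemma Jf_L2 a u D i : L2form u -> L2D3 D -> L2fun (Jf a u D i).
Proof.
move=> [u1 u2] [d1 d2 d3]; rewrite /Jf.
by case: i => -[|[|[|[|[|//]]]]] /= _ //; exact: L2Z.
Qed.

Lemma sum5 (F : 'I_5 -> R) : \sum_i F i =
  F (@Ordinal 5 0 isT) + F (@Ordinal 5 1 isT) + F (@Ordinal 5 2 isT) + F (@Ordinal 5 3 isT) + F (@Ordinal 5 4 isT).
Proof.
rewrite !big_ord_recl big_ord0 addr0 !addrA.
by do !congr (_ + _); congr F; exact: val_inj.
Qed.

Lemma H1n_Jf a u D : L2form u -> L2D3 D -> \sum_i nsq (Jf a u D i) = H1n a u D.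
Proof.
move=> u2 [d1 d2 d3]; rewrite sum5 /Jf /= !nsqZ// /H1n.
by rewrite !exprMn sqr_sqrtr//; ring.
Qed.

Lemma Jf_sub a u D v E i p :
  Jf a (form_sub u v) (sym_sub D E) i p = Jf a u D i p - Jf a v E i p.
Proof.
rewrite /Jf; case: i => -[|[|[|[|[|//]]]]] /= _ //; by rewrite /ym /=; ring.
Qed.

(** Approximation up to [eps] becomes convergence of one sequence in each of the five coordinates of
    [Jf], the form needed for projecting and for passing to limits. *)
Lemma closureP a (S : set (oneform R)) u : 0 < a -> (forall th, S th -> test_form th) ->
  H1_closure a S u <-> exists D, [/\ L2form u, weak_Def u D, L2D3 D &
    exists th : nat -> oneform R, (forall n, S (th n)) /\
      forall i, L2cvg (fun n => Jf a (th n) (Def_smooth (th n)) i) (Jf a u D i)].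
Proof.
move=> a0 St; split.
  move=> [u2 [D [wD [/(L2symP _ a0) d3 H]]]]; exists D; split => //.
  have /choice [th thP] : forall n : nat, exists th, S th /\
      H1n a (form_sub u th) (sym_sub D (Def_smooth th)) < n.+1%:R^-1.
    move=> n; have n0 : 0 < n.+1%:R^-1 :> R by rewrite invr_gt0.
    have [th Sth] := H _ n0; rewrite H1dist2E ?lte_fin//; last exact: St.
    by exists th.
  exists th; split => [n|i]; first by case: (thP n).
  apply: (@cvg0_le _ _ (fun n => n.+1%:R^-1)); last exact: cvg_harmonic.
  move=> n; rewrite nsq_ge0 /=; have [Sth h] := thP n; have tt := St _ Sth.
  apply: le_trans (ltW h); rewrite -H1n_Jf; last first.
  - by apply: L2D3_sub => //; exact: tf_Def_L2.
  - by apply: L2form_sub => //; exact: tf_form_L2.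
  rewrite nsqBC (@eq_nsq _ _ (Jf a (form_sub u (th n)) (sym_sub D (Def_smooth (th n))) i)).
    by rewrite (bigD1 i)//= lerDl sumr_ge0// => j _; exact: nsq_ge0.
  by move=> p _; rewrite Jf_sub.
move=> [D [u2 wD d3 [th [Sth H]]]]; split => //; exists D; split => //; split; first exact/L2symP.
move=> e e0.
have : (fun n => \sum_i nsq (fun p => Jf a (th n) (Def_smooth (th n)) i p - Jf a u D i p)) n
    @[n --> \oo] --> \sum_(i < 5) (0 : R).
  by apply: cvg_sum_ord => i; exact: H.
rewrite big1// => /cvg0_epsE /(_ e0) [N NP]; exists (th N) => //.
have tt := St _ (Sth N).
rewrite H1dist2E// lte_fin -H1n_Jf; last first.
- by apply: L2D3_sub => //; exact: tf_Def_L2.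
- by apply: L2form_sub => //; exact: tf_form_L2.
have := NP N (leqnn _); apply: le_lt_trans; apply: le_trans (ler_norm _).
apply: ler_sum => i _; rewrite nsqBC le_eqVlt; apply/orP; left; apply/eqP.
by apply: eq_nsq => p _; rewrite Jf_sub.
Qed.

(** The equations of [weak_Def] written as pairings of [L^2] functions: the factors [y] and [1/y]
    are distributed so that [D] occurs only through [ym]. *)
Definition weakD u D psi := [/\
  ip (ym (s11 D)) (yd psi) + ip (fm2 u) (yd psi) = - ip (fm1 u) (px psi),
  ip (ym (s12 D)) (yd psi) - ip (fm1 u) (yd psi) =
    - (ip (fm1 u) (py psi) + ip (fm2 u) (px psi)) / 2 &
  ip (ym (s22 D)) (yd psi) - ip (fm2 u) (yd psi) = - ip (fm2 u) (py psi)].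

Lemma weakDP u D : L2form u -> L2D3 D ->
  (weak_Def u D <-> forall psi, test_fun psi -> weakD u D psi).
Proof.
move=> [u1 u2] [d1 d2 d3].
have key psi : test_fun psi -> [/\
  (\int[@leb2 R]_(p in @HH R) ((s11 D p + fm2 u p / p.2) * psi p)%:E =
     (ip (ym (s11 D)) (yd psi) + ip (fm2 u) (yd psi))%:E)%E,
  (\int[@leb2 R]_(p in @HH R) (fm1 u p * px psi p)%:E = (ip (fm1 u) (px psi))%:E)%E,
  (\int[@leb2 R]_(p in @HH R) ((s12 D p - fm1 u p / p.2) * psi p)%:E =
     (ip (ym (s12 D)) (yd psi) - ip (fm1 u) (yd psi))%:E)%E &
  [/\ (\int[@leb2 R]_(p in @HH R) ((fm1 u p * py psi p + fm2 u p * px psi p) / 2)%:E =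
     ((ip (fm1 u) (py psi) + ip (fm2 u) (px psi)) / 2)%:E)%E,
  (\int[@leb2 R]_(p in @HH R) ((s22 D p - fm2 u p / p.2) * psi p)%:E =
     (ip (ym (s22 D)) (yd psi) - ip (fm2 u) (yd psi))%:E)%E &
  (\int[@leb2 R]_(p in @HH R) (fm2 u p * py psi p)%:E = (ip (fm2 u) (py psi))%:E)%E]].
  move=> tp; have y2 := tf_L2 (tf_yd tp); have x2 := tf_L2 (tf_px tp); have z2 := tf_L2 (tf_py tp).
  have i1 := L2M d1 y2; have i2 := L2M d2 y2; have i3 := L2M d3 y2.
  have j1 := L2M u1 y2; have j2 := L2M u2 y2.
  have k1 := L2M u1 x2; have k2 := L2M u2 x2; have l1 := L2M u1 z2; have l2 := L2M u2 z2.
  have E f g p : Hp p -> (f p + g p / p.2) * psi p = ym f p * yd psi p + g p * yd psi p.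
    by move=> /Hp_neq0 h; rewrite /ym /yd; field.
  have E' f g p : Hp p -> (f p - g p / p.2) * psi p = ym f p * yd psi p - g p * yd psi p.
    by move=> /Hp_neq0 h; rewrite /ym /yd; field.
  split; last split.
  - rewrite /ip -ID// -integralEI; last exact: integrableHD.
    by apply: eq_integral => p; rewrite inE => Hpp; rewrite E.
  - by rewrite (integralEI k1).
  - rewrite /ip -IB// -integralEI; last exact: integrableHB.
    by apply: eq_integral => p; rewrite inE => Hpp; rewrite E'.
  - rewrite /ip -ID// mulrC -IZ; last exact: integrableHD.
    rewrite -integralEI; last by apply: integrableHZ; exact: integrableHD.
    by apply: eq_integral => p _; rewrite mulrC.
  - rewrite /ip -IB// -integralEI; last exact: integrableHB.
    by apply: eq_integral => p; rewrite inE => Hpp; rewrite E'.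
  - by rewrite (integralEI l2).
split=> H psi tp; have [e1 e2 e3 [e4 e5 e6]] := key psi tp; have := H psi tp.
  move=> [h1 h2 h3]; split; apply: EFin_inj.
  - by rewrite -e1 h1 e2.
  - by rewrite -e3 h2 e4 -EFinN mulNr.
  - by rewrite -e5 h3 e6.
move=> [h1 h2 h3]; split.
- by rewrite e1 e2 h1.
- by rewrite e3 e4 h2 mulNr.
- by rewrite e5 e6 h3.
Qed.

Lemma weak_dstar0P u : L2form u ->
  (weak_dstar0 u <-> forall phi, test_fun phi -> ip (fm1 u) (px phi) + ip (fm2 u) (py phi) = 0).
Proof.
move=> [u1 u2].
have key phi : test_fun phi ->
  (\int[@leb2 R]_(p in @HH R) (fm1 u p * px phi p + fm2 u p * py phi p)%:E =
    (ip (fm1 u) (px phi) + ip (fm2 u) (py phi))%:E)%E.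
  move=> tp; have x2 := tf_L2 (tf_px tp); have z2 := tf_L2 (tf_py tp).
  rewrite /ip -ID; [|exact: L2M..].
  by rewrite (integralEI (integrableHD (L2M u1 x2) (L2M u2 z2))).
split=> H phi tp; last by rewrite key// H.
by have := H phi tp; rewrite key// => e; exact: EFin_inj e.
Qed.

Definition smooth_form u := smooth_on (fm1 u) /\ smooth_on (fm2 u).

Lemma smooth_weakD u psi : smooth_form u -> test_fun psi -> weakD u (Def_smooth u) psi.
Proof.
move=> [c1 c2] tp.
have x1 := ibp_x c1 tp; have y1 := ibp_y c1 tp; have x2 := ibp_x c2 tp; have y2 := ibp_y c2 tp.
have ti f : smooth_on f -> integrableH (fun p => f p * psi p) by move=> fC; apply: tf_int; exact: smoothM_tf.
have i1 f : smooth_on f -> integrableH (fun p => f p * yd psi p).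
  by move=> fC; apply: tf_int; apply: smoothM_tf => //; exact: tf_yd.
have sx f := @smooth_px _ f; have sy f := @smooth_py _ f.
have sD1 : smooth_on (ym (s11 (Def_smooth u))).
  by apply: smooth_ym => n; apply: CkB; [exact: (sx _ c1)|exact: (smooth_yd c2)].
have sD2 : smooth_on (ym (s12 (Def_smooth u))).
  apply: smooth_ym => n; apply: CkD; last exact: (smooth_yd c1).
  by apply: CkM; [apply: CkD; [exact: (sy _ c1)|exact: (sx _ c2)]|exact: Ck_cst].
have sD3 : smooth_on (ym (s22 (Def_smooth u))).
  by apply: smooth_ym => n; apply: CkD; [exact: (sy _ c2)|exact: (smooth_yd c2)].
split.
- rewrite -x1 /ip -ID; [|exact: i1..]; apply: eq_I => p /Hp_neq0 h.
  by rewrite /ym /yd /=; field.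
- have k1 := ti _ (sy _ c1); have k2 := ti _ (sx _ c2).
  have k12 := integrableHD k1 k2.
  have -> : - (ip (fm1 u) (py psi) + ip (fm2 u) (px psi)) / 2 =
      2^-1 * (ip (py (fm1 u)) psi + ip (px (fm2 u)) psi) 
    by rewrite y1 x2; move: (ip _ (py psi)) (ip _ (px psi)) => s t; ring.
  rewrite /ip -(ID k1 k2) -(IZ _ k12) -IB; [|exact: i1..].
  by apply: eq_I => p /Hp_neq0 h; rewrite /ym /yd /=; field.
- rewrite -y2 /ip -IB; [|exact: i1..]; apply: eq_I => p /Hp_neq0 h.
  by rewrite /ym /yd /=; field.
Qed.

(** In flat coordinates the squared norms of [d th] and [d^* th] are [a ^ 2] times [nsq] of
    [ym (curl th)] and of [ym (dive th)]. *)
Definition curl th p : R := px (fm2 th) p - py (fm1 th) p.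
Definition dive th p : R := px (fm1 th) p + py (fm2 th) p.

Lemma tf_curl th : test_form th -> test_fun (curl th).
Proof. by move=> [t1 t2]; apply: tfB; [exact: tf_px|exact: tf_py]. Qed.
Lemma tf_dive th : test_form th -> test_fun (dive th).
Proof. by move=> [t1 t2]; apply: tfD; [exact: tf_px|exact: tf_py]. Qed.

(* Integrated Bochner identity [2 Def^* Def = d^* d + 2 d d^* - 2 Ric]: with
   [th = (f, g)], the integrands differ by the divergence of
   [(4y^2 f_y g + 4y f g, 2y f^2 + 2y g^2 - 4y^2 f_x g)]. *)
Lemma energy_identity th : test_form th ->
  2 * (nsq (ym (s11 (Def_smooth th))) + 2 * nsq (ym (s12 (Def_smooth th))) + nsq (ym (s22 (Def_smooth th)))) =
  nsq (ym (curl th)) + 2 * nsq (ym (dive th)) + 2 * (nsq (fm1 th) + nsq (fm2 th)).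
Proof.
move=> tt; have [e1 e2 e3] := tf_Def tt; have tc := tf_curl tt; have td := tf_dive tt.
move: (tt) => [tf tg]; set f := fm1 th in tf *; set g := fm2 th in tg *.
have Q h : test_fun h -> integrableH (fun p => h p ^+ 2) by move=> th'; apply: L2_sqr; exact: tf_L2.
have q1 := Q _ (tf_ym e1); have q2 := Q _ (tf_ym e2); have q3 := Q _ (tf_ym e3).
have q4 := Q _ (tf_ym tc); have q5 := Q _ (tf_ym td); have q6 := Q _ tf; have q7 := Q _ tg.
pose A := fun p => 4 * (ym (ym (fun q => py f q * g q)) p + ym (fun q => f q * g q) p).
pose B := fun p => 2 * (ym (fun q => f q * f q) p + ym (fun q => g q * g q) p)
   - 4 * ym (ym (fun q => px f q * g q)) p.
have tA : test_fun A.
  by apply: tfZ; apply: tfD; apply: tf_ym; [apply: tf_ym; apply: tfM => //; exact: tf_py|exact: tfM].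
have tB : test_fun B.
  apply: tfB; apply: tfZ; first by apply: tfD; apply: tf_ym; exact: tfM.
  by do 2 apply: tf_ym; apply: tfM => //; exact: tf_px.
have iA := tf_int (tf_px tA); have iB := tf_int (tf_py tB).
have iAB := integrableHD iA iB.
have E p : Hp p -> px A p + py B p =
   2 * (ym (s11 (Def_smooth th)) p ^+ 2 + 2 * ym (s12 (Def_smooth th)) p ^+ 2 + ym (s22 (Def_smooth th)) p ^+ 2)
   - (ym (curl th) p ^+ 2 + 2 * ym (dive th) p ^+ 2 + 2 * (f p ^+ 2 + g p ^+ 2)).
  move=> Hpp; have p0 := Hp_neq0 Hpp.
  have cl : px (py f) p = py (px f) p by exact: (clairaut (tf.1 2%N) Hpp).
  have fX := tf_dX p tf; have fY := tf_dY p tf; have gX := tf_dX p tg; have gY := tf_dY p tg.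
  have fyX := tf_dX p (tf_py tf); have fxY := tf_dY p (tf_px tf).
  have sX := dX_snd p; have sY := dY_snd p.
  have AX := dXZ 4 (dXD (dXM sX (dXM sX (dXM fyX gX))) (dXM sX (dXM fX gX))).
  have BY := dYB (dYZ 2 (dYD (dYM sY (dYM fY fY)) (dYM sY (dYM gY gY))))
    (dYZ 4 (dYM sY (dYM sY (dYM fxY gY)))).
  rewrite (px_val AX) (py_val BY) cl /ym /curl /dive /= -/f -/g.
  by field.
have z2 := integrableHZ 2 q2; have z5 := integrableHZ 2 q5.
have d12 := integrableHD q1 z2; have d123 := integrableHD d12 q3.
have d45 := integrableHD q4 z5; have d67 := integrableHD q6 q7.
have zl := integrableHZ 2 d123; have z67 := integrableHZ 2 d67.
have dr := integrableHD d45 z67.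
have := ID iA iB; rewrite (I_px tA) (I_py tB) addr0 (eq_I E).
rewrite (IB zl dr) (IZ 2 d123) (ID d12 q3) (ID q1 z2) (IZ 2 q2).
rewrite (ID d45 z67) (ID q4 z5) (IZ 2 q5) (IZ 2 d67) (ID q6 q7).
by move/eqP; rewrite subr_eq0 => /eqP.
Qed.

End Forms.

(** * Harmonic fields belong to the closure of test forms *)

Section HarmonicForms.
Variable R : realType.
Implicit Types (f g h psi : R * R -> R) (p q : R * R) (u v w th : oneform R) (D E : sym2 R).

Lemma rho_le_nat p : exists N, forall n, (N <= n)%N -> rho p <= n.+1%:R.
Proof.
exists (Num.truncn `|rho p|) => n Nn; apply: le_trans (ler_norm _) _.
by apply: le_trans (ltW (truncnS_gt _)) _; rewrite ler_nat.
Qed.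

Lemma L2cvgZ c (F : nat -> R * R -> R) f : (forall n, L2fun (F n)) -> L2fun f ->
  L2cvg F f -> L2cvg (fun n p => c * F n p) (fun p => c * f p).
Proof.
move=> F2 f2 Ff; rewrite /L2cvg (_ : (fun n => _) = fun n => c ^+ 2 * nsq (fun p => F n p - f p)).
  by rewrite -(mulr0 (c ^+ 2)); apply: cvgM => //; exact: cvg_cst.
apply/funext => n; rewrite -nsqZ; last exact: L2B.
by apply: eq_nsq => p _; rewrite mulrBr.
Qed.

Lemma L2cvg_eq (F G : nat -> R * R -> R) f g : (forall n p, Hp p -> F n p = G n p) ->
  (forall p, Hp p -> f p = g p) -> L2cvg F f -> L2cvg G g.
Proof.
move=> FG fg; rewrite /L2cvg (_ : (fun n => _) = fun n => nsq (fun p => G n p - g p))//.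
by apply/funext => n; apply: eq_nsq => p Hpp; rewrite FG ?fg.
Qed.

(** Dominated convergence for sequences that are eventually equal to their limit at each point,
    which is how expressions in the cutoffs converge. *)
Lemma L2cvg_ev (F : nat -> R * R -> R) f h : (forall n, L2fun (F n)) -> L2fun f -> integrableH h ->
  (forall n p, Hp p -> (F n p - f p) ^+ 2 <= h p) ->
  (forall p, Hp p -> exists N, forall n, (N <= n)%N -> F n p = f p) -> L2cvg F f.
Proof.
move=> F2 f2 hi Fh Ff.
have [_] := @dct R (fun n p => (F n p - f p) ^+ 2) (fun=> 0) h
  (fun n => measurable_funX _ (L2B (F2 n) f2).1) (measurable_cst _) hi
  (fun n p Hpp => ltac:(rewrite ger0_norm ?sqr_ge0//; exact: Fh)) (fun p Hpp => ltac:(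
    have [N NP] := Ff p Hpp; apply: cvg_near_cst; exists N => // n /NP /= ->; rewrite subrr expr0n //)).
by rewrite I0.
Qed.

(** The shape of the deformation of [cutform n w]: the remainder [r] collects the derivatives of the
    cutoff, which vanish on ever larger balls. *)
Lemma L2cvg_cut h f (r : nat -> R * R -> R) : integrableH h -> L2fun f ->
  (forall n, L2fun (r n)) -> (forall n p, Hp p -> r n p ^+ 2 <= h p) ->
  (forall n p, Hp p -> rho p <= n.+1%:R -> r n p = 0) ->
  L2cvg (fun n p => cutoff n p * f p + r n p) f.
Proof.
move=> hi f2 r2 rh r0.
apply: (@L2cvg_ev _ _ (fun p => 2 * f p ^+ 2 + 2 * h p)) => //.
- move=> n; apply: L2D => //; apply: (@L2_bdM _ 1) => //.
  + exact: smooth_measH (tf_cut R n).1.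
  + by move=> p _; exact: cut_norm.
- by apply: integrableHD; apply: integrableHZ => //; exact: L2_sqr.
- move=> n p Hpp; have := rh n p Hpp; move: (cut_ge0 n p) (cut_le1 n p).
  move: (cutoff n p) (r n p) (f p) (h p) => c s t z c0 c1 sz.
  have e : (c * t + s - t) ^+ 2 <= 2 * ((1 - c) ^+ 2 * t ^+ 2) + 2 * s ^+ 2.
    by have := sqr_ge0 ((1 - c) * t + s); nra.
  have e2 : (1 - c) ^+ 2 * t ^+ 2 <= t ^+ 2.
    by rewrite ler_piMl ?sqr_ge0// exprn_ile1//; lra.
  lra.
- move=> p Hpp; have [N NP] := rho_le_nat p; exists N => n /NP h1.
  by rewrite cut1// r0// mul1r addr0.
Qed.

Definition cutform n w : oneform R := fun p => (fm1 w p * cutoff n p, fm2 w p * cutoff n p).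

Lemma tf_cutform n w : smooth_form w -> test_form (cutform n w).
Proof. by move=> [w1 w2]; split; apply: smoothM_tf => //; exact: tf_cut. Qed.

(** [r11], [r12], [r22] are [y] times the components of the symmetrized product of [w] with the
    differential of the cutoff, the commutator of [Def] with multiplication by the cutoff. *)
Definition r11 n w p : R := p.2 * (fm1 w p * px (cutoff n) p).
Definition r12 n w p : R := p.2 * ((fm1 w p * py (cutoff n) p + fm2 w p * px (cutoff n) p) / 2).
Definition r22 n w p : R := p.2 * (fm2 w p * py (cutoff n) p).

Lemma smooth_cutX f n p : smooth_on f -> Hp p ->
  px (fun q => f q * cutoff n q) p = px f p * cutoff n p + f p * px (cutoff n) p.
Proof.
move=> fC Hpp; rewrite (px_val (dXM (smooth_dX fC Hpp) (tf_dX p (tf_cut R n)))).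
by move: (px f p) (px (cutoff n) p) => s t; ring.
Qed.

Lemma smooth_cutY f n p : smooth_on f -> Hp p ->
  py (fun q => f q * cutoff n q) p = py f p * cutoff n p + f p * py (cutoff n) p.
Proof.
move=> fC Hpp; rewrite (py_val (dYM (smooth_dY fC Hpp) (tf_dY p (tf_cut R n)))).
by move: (py f p) (py (cutoff n) p) => s t; ring.
Qed.

Lemma Def_cutform n w p : smooth_form w -> Hp p -> [/\
  ym (s11 (Def_smooth (cutform n w))) p = cutoff n p * ym (s11 (Def_smooth w)) p + r11 n w p,
  ym (s12 (Def_smooth (cutform n w))) p = cutoff n p * ym (s12 (Def_smooth w)) p + r12 n w p &
  ym (s22 (Def_smooth (cutform n w))) p = cutoff n p * ym (s22 (Def_smooth w)) p + r22 n w p].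
Proof.
move=> [w1 w2] Hpp; have y0 := Hp_neq0 Hpp.
have x1 := smooth_cutX n w1 Hpp; have x2 := smooth_cutX n w2 Hpp.
have y1 := smooth_cutY n w1 Hpp; have y2 := smooth_cutY n w2 Hpp.
rewrite /ym /r11 /r12 /r22 /Def_smooth /= -[px (fm1 (cutform n w)) p]/(px (fun q => fm1 w q * cutoff n q) p).
rewrite -[px (fm2 (cutform n w)) p]/(px (fun q => fm2 w q * cutoff n q) p).
rewrite -[py (fm1 (cutform n w)) p]/(py (fun q => fm1 w q * cutoff n q) p).
rewrite -[py (fm2 (cutform n w)) p]/(py (fun q => fm2 w q * cutoff n q) p).
rewrite x1 x2 y1 y2 /fm1 /fm2 /cutform /= -/(fm1 w p) -/(fm2 w p).
move: (px (fm1 w) p) (px (fm2 w) p) (py (fm1 w) p) (py (fm2 w) p) (px (cutoff n) p) (py (cutoff n) p)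
  (cutoff n p) (fm1 w p) (fm2 w p) => s1 s2 s3 s4 s5 s6 s7 s8 s9.
by split; field.
Qed.

Lemma r_zero n w p : Hp p -> rho p <= n.+1%:R -> [/\ r11 n w p = 0, r12 n w p = 0 & r22 n w p = 0].
Proof.
move=> Hpp h; have [h1 h2] := grad_cut0 Hpp h.
by rewrite /r11 /r12 /r22 h1 h2 !mulr0 addr0 mul0r mulr0.
Qed.

(** Cauchy-Schwarz in the plane. The last two quantities are the weighted curl and divergence of
    [cutform n w] when [w] is closed and coclosed. *)
Lemma r_bound w C n p : p.2 ^+ 2 * (px (cutoff n) p ^+ 2 + py (cutoff n) p ^+ 2) <= C ->
  let h := C * (fm1 w p ^+ 2 + fm2 w p ^+ 2) in
  [/\ r11 n w p ^+ 2 <= h, r12 n w p ^+ 2 <= h, r22 n w p ^+ 2 <= h,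
   (p.2 * (fm2 w p * px (cutoff n) p - fm1 w p * py (cutoff n) p)) ^+ 2 <= h &
   (p.2 * (fm1 w p * px (cutoff n) p + fm2 w p * py (cutoff n) p)) ^+ 2 <= h].
Proof.
move=> hC h.
have key s : s ^+ 2 <= (px (cutoff n) p ^+ 2 + py (cutoff n) p ^+ 2) * (fm1 w p ^+ 2 + fm2 w p ^+ 2) ->
    (p.2 * s) ^+ 2 <= h.
  move=> hs; rewrite exprMn; apply: (@le_trans _ _ (p.2 ^+ 2 *
    (px (cutoff n) p ^+ 2 + py (cutoff n) p ^+ 2) * (fm1 w p ^+ 2 + fm2 w p ^+ 2))).
    by rewrite -mulrA ler_wpM2l ?sqr_ge0.
  by rewrite ler_wpM2r// addr_ge0 ?sqr_ge0.
rewrite /r11 /r12 /r22; split; apply: key; move: (px (cutoff n) p) (py (cutoff n) p) (fm1 w p) (fm2 w p) => a b s t.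
- have := sqr_ge0 (a * t); have := sqr_ge0 (b * s); have := sqr_ge0 (b * t); rewrite !exprMn; lra.
- have := sqr_ge0 (a * s - b * t); have := sqr_ge0 (s * b + t * a); have := sqr_ge0 (s * b - t * a).
  have := sqr_ge0 (a * s + b * t); nra.
- have := sqr_ge0 (a * t); have := sqr_ge0 (b * s); have := sqr_ge0 (a * s); rewrite !exprMn; lra.
- have := sqr_ge0 (a * s + b * t); nra.
- have := sqr_ge0 (a * t - b * s); nra.
Qed.

Definition closed_form w := forall p, Hp p -> py (fm1 w) p = px (fm2 w) p.
Definition coclosed_form w := forall p, Hp p -> px (fm1 w) p + py (fm2 w) p = 0.

Section ClosedCoclosed.
Variable w : oneform R.
Hypotheses (wC : smooth_form w) (w2 : L2form w) (wcl : closed_form w) (wco : coclosed_form w).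

Let smooth_ymDef : [/\ smooth_on (ym (s11 (Def_smooth w))), smooth_on (ym (s12 (Def_smooth w))) &
  smooth_on (ym (s22 (Def_smooth w)))].
Proof.
move: wC => [c1 c2].
have x1 := smooth_px c1; have x2 := smooth_px c2; have y1 := smooth_py c1; have y2 := smooth_py c2.
have z1 := smooth_yd c1; have z2 := smooth_yd c2.
split; apply: smooth_ym => n.
- by apply: CkB; [exact: x1|exact: z2].
- by apply: CkD; [apply: CkM; [apply: CkD; [exact: y1|exact: x2]|exact: Ck_cst]|exact: z1].
- by apply: CkD; [exact: y2|exact: z2].
Qed.

(** For closed and coclosed [w] the curl and divergence of the truncated form contain only
    derivatives of the cutoff. All terms on the right of [energy_identity] are then bounded by the
    norm of [w], uniformly in [n]. *)
Lemma cut_energy : exists M, forall n,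
  nsq (ym (s11 (Def_smooth (cutform n w)))) + 2 * nsq (ym (s12 (Def_smooth (cutform n w)))) +
  nsq (ym (s22 (Def_smooth (cutform n w)))) <= M.
Proof.
have [C C0 CP] := grad_cut_bound R; move: (wC) (w2) => [c1 c2] [l1 l2].
pose K := C * (nsq (fm1 w) + nsq (fm2 w)).
(* The identity reads [2 S = curl + 2 div + 2 |w_n|^2], where the curl and divergence terms are each
   at most [K] before their factors 1 and 2. *)
exists (3 / 2 * K + (nsq (fm1 w) + nsq (fm2 w))) => n.
have tt := tf_cutform n wC; have := energy_identity tt.
have hi : integrableH (fun p => C * (fm1 w p ^+ 2 + fm2 w p ^+ 2)).
  by apply: integrableHZ; apply: integrableHD; exact: L2_sqr.
have hI : I (fun p => C * (fm1 w p ^+ 2 + fm2 w p ^+ 2)) = K.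
  rewrite IZ; last by apply: integrableHD; exact: L2_sqr.
  by rewrite ID//; exact: L2_sqr.
have bd f (g : R * R -> R) : test_fun f -> (forall p, Hp p -> f p = g p) ->
    (forall p, Hp p -> g p ^+ 2 <= C * (fm1 w p ^+ 2 + fm2 w p ^+ 2)) -> nsq f <= K.
  move=> tf fg gb; rewrite -hI; apply: le_I => //; first by apply: L2_sqr; exact: tf_L2.
  by move=> p Hpp; rewrite fg// gb.
have k1 : nsq (ym (curl (cutform n w))) <= K.
  apply: (bd _ (fun p => p.2 * (fm2 w p * px (cutoff n) p - fm1 w p * py (cutoff n) p))).
  - by apply: tf_ym; exact: tf_curl.
  - move=> p Hpp; rewrite /ym /curl.
    have := smooth_cutX n c2 Hpp; have := smooth_cutY n c1 Hpp.
    rewrite -[px (fm2 (cutform n w)) p]/(px (fun q => fm2 w q * cutoff n q) p).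
    rewrite -[py (fm1 (cutform n w)) p]/(py (fun q => fm1 w q * cutoff n q) p).
    move=> -> ->; rewrite wcl//; move: (px (fm2 w) p) (px (cutoff n) p) (py (cutoff n) p) => s t r; ring.
  - by move=> p Hpp; have [] := r_bound w (CP n p Hpp).
have k2 : nsq (ym (dive (cutform n w))) <= K.
  apply: (bd _ (fun p => p.2 * (fm1 w p * px (cutoff n) p + fm2 w p * py (cutoff n) p))).
  - by apply: tf_ym; exact: tf_dive.
  - move=> p Hpp; rewrite /ym /dive.
    have := smooth_cutX n c1 Hpp; have := smooth_cutY n c2 Hpp.
    rewrite -[px (fm1 (cutform n w)) p]/(px (fun q => fm1 w q * cutoff n q) p).
    rewrite -[py (fm2 (cutform n w)) p]/(py (fun q => fm2 w q * cutoff n q) p).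
    move=> -> ->; have := wco Hpp.
    move: (px (fm1 w) p) (py (fm2 w) p) (px (cutoff n) p) (py (cutoff n) p) => s s' t r ss.
    have -> : s' = - s by lra.
    ring.
  - by move=> p Hpp; have [] := r_bound w (CP n p Hpp).
have cb f : L2fun f -> smooth_on f -> nsq (fun p => f p * cutoff n p) <= nsq f.
  move=> f2 fC; apply: le_nsq => //; first by apply: tf_L2; apply: smoothM_tf => //; exact: tf_cut.
  move=> p _; rewrite exprMn ler_piMr ?sqr_ge0// exprn_ile1 ?cut_ge0 ?cut_le1//.
have k3 := cb _ l1 c1; have k4 := cb _ l2 c2.
rewrite -[nsq (fm1 (cutform n w))]/(nsq (fun p => fm1 w p * cutoff n p)).
rewrite -[nsq (fm2 (cutform n w))]/(nsq (fun p => fm2 w p * cutoff n p)).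
move=> en; lra.
Qed.

(** At a given point the truncated form has the same deformation as [w] once [rho <= n + 1], so
    Fatou's lemma transfers the bound of [cut_energy]. *)
Lemma CR_Def_L2 : L2D3 (Def_smooth w).
Proof.
have [M MP] := cut_energy; have [s1 s2 s3] := smooth_ymDef.
have tt n := tf_cutform n wC; have dl n := tf_Def_L2 (tt n).
have key (F : nat -> R * R -> R) f : (forall n, L2fun (F n)) -> smooth_on f ->
    (forall n p, Hp p -> rho p <= n.+1%:R -> F n p = f p) -> (forall n, nsq (F n) <= M) -> L2fun f.
  move=> F2 fC Ff FM; have [] // := @fatou_sq _ F f M F2 (smooth_measH fC) _ FM.
  apply: aeW => p Hpp; have [N NP] := rho_le_nat p.
  by apply: cvg_near_cst; exists N => // n /NP; exact: Ff.
have h n p := @Def_cutform n w p wC.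
have nn f := nsq_ge0 f.
split.
- apply: (key (fun n => ym (s11 (Def_smooth (cutform n w))))) => //.
  + by move=> n; case: (dl n).
  + by move=> n p Hpp hr; have [-> _ _] := h n p Hpp; have [-> _ _] := r_zero w Hpp hr; rewrite cut1// mul1r addr0.
  + move=> n; have := MP n; have := nn (ym (s12 (Def_smooth (cutform n w)))).
    have := nn (ym (s22 (Def_smooth (cutform n w)))); lra.
- apply: (key (fun n => ym (s12 (Def_smooth (cutform n w))))) => //.
  + by move=> n; case: (dl n).
  + by move=> n p Hpp hr; have [_ -> _] := h n p Hpp; have [_ -> _] := r_zero w Hpp hr; rewrite cut1// mul1r addr0.
  + move=> n; have := MP n; have := nn (ym (s11 (Def_smooth (cutform n w)))); have := nn (ym (s12 (Def_smooth (cutform n w)))).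
    have := nn (ym (s22 (Def_smooth (cutform n w)))); lra.
- apply: (key (fun n => ym (s22 (Def_smooth (cutform n w))))) => //.
  + by move=> n; case: (dl n).
  + by move=> n p Hpp hr; have [_ _ ->] := h n p Hpp; have [_ _ ->] := r_zero w Hpp hr; rewrite cut1// mul1r addr0.
  + move=> n; have := MP n; have := nn (ym (s12 (Def_smooth (cutform n w)))).
    have := nn (ym (s11 (Def_smooth (cutform n w)))); lra.
Qed.

Lemma CR_H10 (a : R) : 0 < a -> H10 a w.
Proof.
move=> a0; apply/closureP => //; exists (Def_smooth w); have d3 := CR_Def_L2.
split => //; first by apply/weakDP => // psi tp; exact: smooth_weakD.
exists (fun n => cutform n w); split; first by move=> n; exact: tf_cutform.
have [C C0 CP] := grad_cut_bound R; move: (wC) (w2) (d3) => [c1 c2] [l1 l2] [m1 m2 m3].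
have tt n := tf_cutform n wC; have dl n := tf_Def_L2 (tt n).
have hi : integrableH (fun p => C * (fm1 w p ^+ 2 + fm2 w p ^+ 2)).
  by apply: integrableHZ; apply: integrableHD; exact: L2_sqr.
have cvgf f : L2fun f -> L2cvg (fun n p => f p * cutoff n p) f.
  move=> f2; apply: (@L2cvg_eq (fun n p => cutoff n p * f p + 0) _ f) => //.
    by move=> n p _; rewrite addr0 mulrC.
  apply: (@L2cvg_cut (fun=> 0)) => //; first exact: integrableH0.
  - by move=> n; exact: L2_0.
  - by move=> n p _; rewrite expr0n.
have cL2 f n : L2fun f -> L2fun (fun p => cutoff n p * f p).
  move=> f2; apply: (@L2_bdM _ 1) => //.
  + exact: smooth_measH (tf_cut R n).1.
  + by move=> p _; exact: cut_norm.
have cvgD (F r : nat -> R * R -> R) f : (forall n, L2fun (F n)) -> L2fun f ->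
    (forall n p, Hp p -> F n p = cutoff n p * f p + r n p) ->
    (forall n p, Hp p -> r n p ^+ 2 <= C * (fm1 w p ^+ 2 + fm2 w p ^+ 2)) ->
    (forall n p, Hp p -> rho p <= n.+1%:R -> r n p = 0) -> L2cvg F f.
  move=> F2 f2 FE rb r0.
  apply: (@L2cvg_eq (fun n p => cutoff n p * f p + r n p) _ f) => //.
    by move=> n p Hpp; rewrite FE.
  apply: (L2cvg_cut hi) => // n; apply: eq_L2 (L2B (F2 n) (cL2 _ n f2)) => p Hpp.
  by rewrite FE// addrC addKr.
have D1 n : L2fun (ym (s11 (Def_smooth (cutform n w)))) by case: (dl n).
have D2 n : L2fun (ym (s12 (Def_smooth (cutform n w)))) by case: (dl n).
have D3 n : L2fun (ym (s22 (Def_smooth (cutform n w)))) by case: (dl n).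
have E n p (Hpp : Hp p) := Def_cutform n wC Hpp.
have B n p (Hpp : Hp p) := r_bound w (CP n p Hpp).
have Z n p (Hpp : Hp p) (hr : rho p <= n.+1%:R) := r_zero w Hpp hr.
case=> -[|[|[|[|[|//]]]]] Hi.
- exact (cvgf _ l1).
- exact (cvgf _ l2).
- apply: (L2cvgZ _ D1 m1); apply: (cvgD _ (fun n => r11 n w) _ D1 m1).
  + by move=> n p Hpp; case: (E n p Hpp).
  + by move=> n p Hpp; have [h _ _ _ _] := B n p Hpp; exact h.
  + by move=> n p Hpp hr; case: (Z n p Hpp hr).
- apply: (L2cvgZ _ D2 m2); apply: (cvgD _ (fun n => r12 n w) _ D2 m2).
  + by move=> n p Hpp; case: (E n p Hpp).
  + by move=> n p Hpp; have [_ h _ _ _] := B n p Hpp; exact h.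
  + by move=> n p Hpp hr; case: (Z n p Hpp hr).
- apply: (L2cvgZ _ D3 m3); apply: (cvgD _ (fun n => r22 n w) _ D3 m3).
  + by move=> n p Hpp; case: (E n p Hpp).
  + by move=> n p Hpp; have [_ _ h _ _] := B n p Hpp; exact h.
  + by move=> n p Hpp hr; case: (Z n p Hpp hr).
Qed.

Lemma CR_dstar0 : weak_dstar0 w.
Proof.
apply/weak_dstar0P => // phi tp; move: wC => [c1 c2].
have := ibp_x c1 tp; have := ibp_y c2 tp => e2 e1.
have i1 : integrableH (fun p => px (fm1 w) p * phi p) by apply: tf_int; apply: smoothM_tf => //; exact: smooth_px.
have i2 : integrableH (fun p => py (fm2 w) p * phi p) by apply: tf_int; apply: smoothM_tf => //; exact: smooth_py.
have : ip (px (fm1 w)) phi + ip (py (fm2 w)) phi = 0.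
  rewrite /ip -ID// -[RHS](I0 R); apply: eq_I => p Hpp.
  by rewrite -mulrDl wco// mul0r.
by rewrite e1 e2 -opprD => /eqP; rewrite oppr_eq0 => /eqP.
Qed.

End ClosedCoclosed.

Lemma dfun_CR (a : R) (F : R * R -> R) : 0 < a -> Defs.harmonic a F ->
  [/\ smooth_form (dfun F), closed_form (dfun F) & coclosed_form (dfun F)].
Proof.
move=> a0 [FC Fh]; split.
- by split; [exact: (smooth_px FC)|exact: (smooth_py FC)].
- by move=> p Hpp; symmetry; apply: (clairaut (FC 2%N) Hpp).
- move=> p Hpp; have := Fh p Hpp; move/eqP; rewrite mulf_eq0 => /orP[/eqP h|/eqP//].
  by have : 0 < a ^+ 2 * p.2 ^+ 2; [by rewrite mulr_gt0// exprn_gt0|rewrite h ltxx].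
Qed.

Lemma weak_dstar0_lim u (th : nat -> oneform R) : L2form u -> (forall n, L2form (th n)) ->
  (forall n, weak_dstar0 (th n)) -> L2cvg (fun n => fm1 (th n)) (fm1 u) ->
  L2cvg (fun n => fm2 (th n)) (fm2 u) -> weak_dstar0 u.
Proof.
move=> u2 t2 tw c1 c2; apply/weak_dstar0P => // phi tp.
have h1 := L2cvg_ip (fun n => (t2 n).1) u2.1 (tf_L2 (tf_px tp)) c1.
have h2 := L2cvg_ip (fun n => (t2 n).2) u2.2 (tf_L2 (tf_py tp)) c2.
have h : (fun n => ip (fm1 (th n)) (px phi) + ip (fm2 (th n)) (py phi)) @ \oo -->
    ip (fm1 u) (px phi) + ip (fm2 u) (py phi) by exact: cvgD h1 h2.
have : (fun n => ip (fm1 (th n)) (px phi) + ip (fm2 (th n)) (py phi)) @ \oo --> (0 : R).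
  rewrite (_ : (fun n => _) = fun=> 0); first exact: cvg_cst.
  by apply/funext => n; exact: ((weak_dstar0P (t2 n)).1 (tw n) phi tp).
by move=> h0; rewrite -(cvg_lim (@Rhausdorff R) h) (cvg_lim (@Rhausdorff R) h0).
Qed.

Lemma test_dstar0 (a : R) th : 0 < a -> Lc_sigma a th -> weak_dstar0 th.
Proof.
move=> a0 [tt td]; apply/weak_dstar0P; first exact: tf_form_L2.
move=> phi tp; move: (tt) => [t1 t2].
have e1 := ibp_x t1.1 tp; have e2 := ibp_y t2.1 tp.
have i1 : integrableH (fun p => px (fm1 th) p * phi p) by apply: tf_int; apply: tfM => //; exact: tf_px.
have i2 : integrableH (fun p => py (fm2 th) p * phi p) by apply: tf_int; apply: tfM => //; exact: tf_py.
have : ip (px (fm1 th)) phi + ip (py (fm2 th)) phi = 0.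
  rewrite /ip -ID// -[RHS](I0 R); apply: eq_I => p Hpp.
  rewrite -mulrDl; have := td p Hpp; rewrite /dstar_smooth => /eqP.
  rewrite mulf_eq0 oppr_eq0 => /orP[/eqP h|/eqP ->]; last by rewrite mul0r.
  by have : 0 < a ^+ 2 * p.2 ^+ 2; [by rewrite mulr_gt0// exprn_gt0|rewrite h ltxx].
by rewrite e1 e2 -opprD => /eqP; rewrite oppr_eq0 => /eqP.
Qed.

Lemma Vbold_Vtilde (a : R) v : 0 < a -> Vbold a v -> Vtilde a v.
Proof.
move=> a0 /closureP H; have Lt th : Lc_sigma a th -> test_form th by case.
have [D [v2 wD d3 [th [St ct]]]] := H a0 Lt; split.
  by apply/closureP => //; exists D; split => //; exists th; split => // n; exact: Lt.
apply: (weak_dstar0_lim v2 (th := th)).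
- by move=> n; apply: tf_form_L2; exact: Lt.
- by move=> n; exact: test_dstar0 (St n).
- exact: (ct (@Ordinal 5 0 isT)).
- exact: (ct (@Ordinal 5 1 isT)).
Qed.

End HarmonicForms.

(** * Vanishing of the curl *)

Section Helmholtz.
Variable R : realType.
Implicit Types (f g h psi t : R * R -> R) (p q : R * R).

Definition lap f p : R := px (px f) p + py (py f) p.

Lemma tf_lap f : test_fun f -> test_fun (lap f).
Proof. by move=> tf; apply: tfD; [exact: tf_px (tf_px tf)|exact: tf_py (tf_py tf)]. Qed.

Lemma tf_mul_L2 t h : test_fun t -> L2fun h -> L2fun (fun p => t p * h p).
Proof.
move=> tt h2; have [M _ tM] := tf_bounded tt.
by apply: (L2_bdM (smooth_measH tt.1) _ h2) => p _; exact: tM.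
Qed.

Lemma tf_mul_cvg t (F : nat -> R * R -> R) f : test_fun t -> (forall n, L2fun (F n)) ->
  L2fun f -> L2cvg F f -> L2cvg (fun n p => t p * F n p) (fun p => t p * f p).
Proof.
move=> tt F2 f2 Ff; have [M _ tM] := tf_bounded tt.
by apply: (L2cvg_bdM (smooth_measH tt.1) _ F2 f2 Ff) => p _; exact: tM.
Qed.

Lemma L2cvg_nsq (F : nat -> R * R -> R) f : (forall n, L2fun (F n)) -> L2fun f ->
  L2cvg F f -> nsq (F n) @[n --> \oo] --> nsq f.
Proof.
move=> F2 f2 Ff; rewrite nsqE (_ : (fun n => _) = fun n => ip (F n) (F n)).
  exact: L2cvg_ip2.
by apply/funext => n; rewrite nsqE.
Qed.

(* [chi^2 G Lap G + |grad (chi G)|^2 - G^2 |grad chi|^2] is the divergence of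
   [chi^2 G grad G]. *)
Lemma caccioppoli chi G L : test_fun chi -> smooth_on G ->
  (forall p, Hp p -> chi p * lap G p = chi p * L p) ->
  ip (fun p => chi p * G p) (fun p => chi p * L p) <=
    nsq (fun p => px chi p * G p) + nsq (fun p => py chi p * G p).
Proof.
have aux (x y1 y2 z1 z2 : R) : 0 <= y1 -> 0 <= y2 -> x + (y1 + y2) - (z1 + z2) = 0 -> x <= z1 + z2.
  by move=> h1 h2 h3; lra.
move=> tc GC GL; have cx := tf_px tc; have cy := tf_py tc.
have Gx := smooth_px GC; have Gy := smooth_py GC.
have GM f : test_fun f -> test_fun (fun p => f p * G p).
  by move=> tf; apply: tf_eq (smoothM_tf GC tf) => p; rewrite mulrC.
have tu := GM _ tc.
have GGx : smooth_on (fun p => G p * px G p) by move=> n; apply: CkM; [exact: GC|exact: Gx].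
have GGy : smooth_on (fun p => G p * py G p) by move=> n; apply: CkM; [exact: GC|exact: Gy].
have tcc := tfM tc tc.
have tA := smoothM_tf GGx tcc; have tB := smoothM_tf GGy tcc.
have E p : Hp p -> px (fun q => G q * px G q * (chi q * chi q)) p +
    py (fun q => G q * py G q * (chi q * chi q)) p =
    (chi p * G p) * (chi p * L p) + (px (fun q => chi q * G q) p ^+ 2 + py (fun q => chi q * G q) p ^+ 2) -
    ((px chi p * G p) ^+ 2 + (py chi p * G p) ^+ 2).
  move=> Hpp; rewrite -(GL p Hpp) /lap.
  have cX := tf_dX p tc; have cY := tf_dY p tc.
  have gX := smooth_dX GC Hpp; have gY := smooth_dY GC Hpp.
  have gXX := smooth_dX Gx Hpp; have gYY := smooth_dY Gy Hpp.
  rewrite (px_val (dXM (dXM gX gXX) (dXM cX cX))) (py_val (dYM (dYM gY gYY) (dYM cY cY))).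
  rewrite (px_val (dXM cX gX)) (py_val (dYM cY gY)).
  move: (px (px G) p) (py (py G) p) (px G p) (py G p) (px chi p) (py chi p) (chi p) (G p).
  by move=> s1 s2 s3 s4 s5 s6 s7 s8; ring.
have Q f : test_fun f -> integrableH (fun p => f p ^+ 2) by move=> tf; apply: L2_sqr; exact: tf_L2.
have q1 := Q _ (tf_px tu); have q2 := Q _ (tf_py tu); have q3 := Q _ (GM _ cx); have q4 := Q _ (GM _ cy).
have iA := tf_int (tf_px tA); have iB := tf_int (tf_py tB).
have q12 := integrableHD q1 q2; have q34 := integrableHD q3 q4.
have i0 : integrableH (fun p => (chi p * G p) * (chi p * L p)).
  apply: eq_integrableH (integrableHD (integrableHB (integrableHD iA iB) q12) q34) => p Hpp.
  rewrite E//; move: (px _ p ^+ 2) (py _ p ^+ 2) (_ * L p) => a b c; ring.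
have e1 : I (fun p => (chi p * G p) * (chi p * L p) +
    (px (fun q => chi q * G q) p ^+ 2 + py (fun q => chi q * G q) p ^+ 2) -
    ((px chi p * G p) ^+ 2 + (py chi p * G p) ^+ 2)) = 0.
  apply: etrans (esym (eq_I E)) _; apply: etrans (ID iA iB) _.
  exact: etrans (f_equal2 +%R (I_px tA) (I_py tB)) (addr0 0).
have e2 := IB (integrableHD i0 q12) q34.
have e3 := ID i0 q12; have e4 := ID q1 q2; have e5 := ID q3 q4.
have n1 : 0 <= I (fun p => px (fun q => chi q * G q) p ^+ 2) by apply: I_ge0 => p _; exact: sqr_ge0.
have n2 : 0 <= I (fun p => py (fun q => chi q * G q) p ^+ 2) by apply: I_ge0 => p _; exact: sqr_ge0.
have e6 := f_equal2 (fun x y => x - y) (etrans e3 (f_equal2 +%R (erefl _) e4)) e5.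
exact (aux _ _ _ _ _ n1 n2 (etrans (esym e6) (etrans (esym e2) e1))).
Qed.

Lemma le_lim3 (x y z : nat -> R) (X Y Z c : R) : x n @[n --> \oo] --> X ->
  y n @[n --> \oo] --> Y -> z n @[n --> \oo] --> Z ->
  (forall n, c * x n <= y n + z n) -> c * X <= Y + Z.
Proof.
move=> hx hy hz H.
have h1 : (fun n => c * x n) @ \oo --> c * X by apply: cvgM => //; exact: cvg_cst.
have h2 : (fun n => y n + z n) @ \oo --> Y + Z by exact: cvgD.
by apply: (ler_cvg_to h1 h2); apply: nearW.
Qed.

Lemma lap_moll e f p : 0 < e -> e < 1 / 2 -> integrableH f -> 2 * e < p.2 ->
  lap (moll e f) p = (kmass R)^-1 * I (fun q => f q * lap (kern e p) q).
Proof.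
move=> e0 e2 fi ep; have tk := tf_kern e0 ep.
rewrite /lap (px_val (moll_dXX p e0 e2 fi)) (py_val (moll_dYY p e0 e2 fi)) -mulrDr; congr (_ * _).
have bI g : test_fun g -> integrableH (fun q => f q * g q).
  move=> tg; have [M M0 gM] := tf_bounded tg.
  have mf : measH f by exact: integrableH_meas.
  apply: le_integrableH (integrableHZ M (integrable_norm fi)) _.
    by apply: measurable_funM => //; exact: smooth_measH tg.1.
  by move=> q _; rewrite normrM mulrC /= ler_wpM2r.
rewrite -ID; [|by apply: bI; exact: tf_px (tf_px tk)|by apply: bI; exact: tf_py (tf_py tk)].
by apply: eq_I => q _; rewrite mulrDr.
Qed.

(** The hypothesis says weakly that [lap (ym h) = c0 * yd h]. Here [f] and [g] are the two sides
    multiplied by an outer cutoff [kap]. At small scales their mollifications satisfy the equation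
    pointwise on the support of [chi]; [caccioppoli] applies to them, and the scale is sent to 0. *)
Lemma helmholtz_local c0 h (hn : nat -> R * R -> R) n : 0 < c0 -> L2fun h ->
  (forall k, test_fun (hn k)) -> L2cvg hn h ->
  (forall psi, test_fun psi -> ip h (fun p => c0 * yd psi p - ym (lap psi) p) = 0) ->
  c0 * nsq (fun p => cutoff n p * h p) <=
    nsq (fun p => ym (px (cutoff n)) p * h p) + nsq (fun p => ym (py (cutoff n)) p * h p).
Proof.
move=> c00 h2 thn hnh H; have tc := tf_cut R n; set chi := @cutoff R n in tc *.
have [a [b [a0 b0 cs]]] := tf_box tc.
have [m [e0 [e00 e02 kn k1]]] := kern_nest b a0.
have tk := tf_cut R m; set kap := @cutoff R m in tk k1.
have t1 := tf_ym tk; have t2 := tfZ c0 (tf_yd tk).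
pose f := fun p => ym kap p * h p; pose g := fun p => (c0 * yd kap p) * h p.
have f2 : L2fun f by exact: tf_mul_L2. have g2 : L2fun g by exact: tf_mul_L2.
have fi : integrableH f := L2M (tf_L2 t1) h2. have gi : integrableH g := L2M (tf_L2 t2) h2.
have thn2 k := tf_L2 (thn k).
have fc : L2cvg (fun k p => ym kap p * hn k p) f := tf_mul_cvg t1 thn2 h2 hnh.
have gc : L2cvg (fun k p => (c0 * yd kap p) * hn k p) g := tf_mul_cvg t2 thn2 h2 hnh.
have e30 : 0 < e0 / 2 by rewrite divr_gt0.
pose e (k : nat) : R := e0 / 2 / k.+1%:R.
have ek0 k : 0 < e k by rewrite divr_gt0.
have eke k : e k < e0.
  apply: (@le_lt_trans _ _ (e0 / 2)); last by lra.
  by rewrite ler_pdivrMr// ler_peMr ?ler1n// ltW.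
have ek2 k : e k < 1 / 2 by exact: lt_trans (eke k) e02.
have mf := moll_cvg_seq (fun k => tfM t1 (thn k)) f2 fi fc e30.
have mg := moll_cvg_seq (fun k => tfM t2 (thn k)) g2 gi gc e30.
have mf2 k : L2fun (moll (e k) f) by case: (young (ek0 k) (ek2 k) fi f2).
have mg2 k : L2fun (moll (e k) g) by case: (young (ek0 k) (ek2 k) gi g2).
(* Off the support of [chi] both sides are 0. On it, the kernel centred at [p] is an admissible test
   function on whose support [kap] is 1, and the weak equation tested against it is the claim. *)
have PDE k p : Hp p -> chi p * lap (moll (e k) f) p = chi p * moll (e k) g p.
  move=> Hpp; have [bp|np] := pselect (box a b p); last by rewrite (cs p np) !mul0r.
  have [ep sk] := kn (e k) p (ek0 k) (eke k) bp.
  rewrite (lap_moll (ek0 k) (ek2 k) fi ep) /moll; congr (_ * (_ * _)).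
  have tke := tf_kern (ek0 k) ep.
  have sl : supp_in (lap (kern (e k) p)) (a / 2) (b + 1).
    by move=> q nq; rewrite /lap (supp_px (supp_px sk) nq) (supp_py (supp_py sk) nq) addr0.
  have := H _ tke; have u1 := L2M h2 (tf_L2 (tfZ c0 (tf_yd tke))).
  have u2 := L2M h2 (tf_L2 (tf_ym (tf_lap tke))).
  rewrite /ip (@eq_I _ _ (fun q => h q * (c0 * yd (kern (e k) p) q) - h q * ym (lap (kern (e k) p)) q)); last first.
    by move=> q _; rewrite mulrBr.
  rewrite (IB u1 u2) => /eqP; rewrite subr_eq0 => /eqP E.
  rewrite (@eq_I _ _ (fun q => h q * ym (lap (kern (e k) p)) q)); last first.
    move=> q _; have [bq|nq] := pselect (box (a / 2) (b + 1) q).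
      by rewrite /f /ym k1//; ring.
    by rewrite /ym sl// !mulr0.
  rewrite -E; apply: eq_I => q _; have [bq|nq] := pselect (box (a / 2) (b + 1) q).
    by rewrite /g /yd k1//; ring.
  by rewrite /yd sk// mul0r !mulr0.
have key k := caccioppoli tc (moll_smooth (ek0 k) (ek2 k) fi) (PDE k).
have tx := tf_px tc; have ty := tf_py tc.
have l1 := L2cvg_ip2 (fun k => tf_mul_L2 tc (mf2 k)) (fun k => tf_mul_L2 tc (mg2 k))
  (tf_mul_L2 tc f2) (tf_mul_L2 tc g2) (tf_mul_cvg tc mf2 f2 mf) (tf_mul_cvg tc mg2 g2 mg).
have l2 := L2cvg_nsq (fun k => tf_mul_L2 tx (mf2 k)) (tf_mul_L2 tx f2) (tf_mul_cvg tx mf2 f2 mf).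
have l3 := L2cvg_nsq (fun k => tf_mul_L2 ty (mf2 k)) (tf_mul_L2 ty f2) (tf_mul_cvg ty mf2 f2 mf).
have : ip (fun p => chi p * f p) (fun p => chi p * g p) <=
    nsq (fun p => px chi p * f p) + nsq (fun p => py chi p * f p).
  by rewrite -[X in X <= _]mul1r; apply: (le_lim3 l1 l2 l3) => k; rewrite mul1r.
have k1' p : box a b p -> kap p = 1.
  by move=> bp; apply: k1; apply: box_sub bp; [rewrite ler_pdivrMr// ler_peMr ?ler1n// ltW|rewrite lerDl].
(* The weight [y] of [f] and the weight [1/y] of [g] cancel, which leaves the unweighted norm of
   [chi h]. *)
have -> : ip (fun p => chi p * f p) (fun p => chi p * g p) = c0 * nsq (fun p => chi p * h p).
  rewrite /nsq -IZ; last by apply: L2_sqr; exact: tf_mul_L2.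
  apply: eq_I => p Hpp; have [bp|np] := pselect (box a b p); last by rewrite (cs p np) !mul0r expr0n /= mulr0.
  by have := Hp_neq0 Hpp; rewrite /f /g /ym /yd k1'// => y0; field.
have -> : nsq (fun p => px chi p * f p) = nsq (fun p => ym (px chi) p * h p).
  apply: eq_nsq => p Hpp; have [bp|np] := pselect (box a b p).
    by rewrite /f /ym k1'//; ring.
  by rewrite /ym (supp_px cs np) mulr0 !mul0r.
have -> // : nsq (fun p => py chi p * f p) = nsq (fun p => ym (py chi) p * h p).
apply: eq_nsq => p Hpp; have [bp|np] := pselect (box a b p).
  by rewrite /f /ym k1'//; ring.
by rewrite /ym (supp_py cs np) mulr0 !mul0r.
Qed.

(** As [n] grows the left-hand side of [helmholtz_local] tends to [c0 * nsq h]. The right-hand side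
    tends to 0 by dominated convergence, since the weighted gradient of the cutoff is bounded in [n]
    and eventually 0 at each point. *)
Lemma helmholtz0 c0 h (hn : nat -> R * R -> R) : 0 < c0 -> L2fun h ->
  (forall k, test_fun (hn k)) -> L2cvg hn h ->
  (forall psi, test_fun psi -> ip h (fun p => c0 * yd psi p - ym (lap psi) p) = 0) ->
  nsq h = 0.
Proof.
move=> c00 h2 thn hnh H; have key n := helmholtz_local n c00 h2 thn hnh H.
have [C C0 CP] := grad_cut_bound R.
have tx n := tf_ym (tf_px (tf_cut R n)); have ty n := tf_ym (tf_py (tf_cut R n)).
have Ci := integrableHZ C (L2_sqr h2).
have z2 := L2_0 R.
have ev p : Hp p -> exists N, forall n, (N <= n)%N ->
    ym (px (cutoff n)) p * h p = 0 /\ ym (py (cutoff n)) p * h p = 0.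
  move=> Hpp; have [N NP] := rho_le_nat p; exists N => n /NP hr.
  by have [h1 h3] := grad_cut0 Hpp hr; rewrite /ym h1 h3 mulr0 mul0r.
have lx : L2cvg (fun n p => ym (px (cutoff n)) p * h p) (fun=> 0).
  apply: (L2cvg_ev (fun n => tf_mul_L2 (tx n) h2) z2 Ci).
    move=> n p Hpp; rewrite subr0 exprMn ler_wpM2r ?sqr_ge0//.
    apply: le_trans (CP n p Hpp); rewrite /ym exprMn ler_wpM2l ?sqr_ge0//.
    by rewrite lerDl sqr_ge0.
  by move=> p Hpp; have [N NP] := ev p Hpp; exists N => n /NP[-> _].
have ly : L2cvg (fun n p => ym (py (cutoff n)) p * h p) (fun=> 0).
  apply: (L2cvg_ev (fun n => tf_mul_L2 (ty n) h2) z2 Ci).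
    move=> n p Hpp; rewrite subr0 exprMn ler_wpM2r ?sqr_ge0//.
    apply: le_trans (CP n p Hpp); rewrite /ym exprMn ler_wpM2l ?sqr_ge0//.
    by rewrite lerDr sqr_ge0.
  by move=> p Hpp; have [N NP] := ev p Hpp; exists N => n /NP[_ ->].
have lc : L2cvg (fun n p => cutoff n p * h p) h.
  apply: (@L2cvg_eq _ (fun n p => cutoff n p * h p + 0) _ h) => //.
    by move=> n p _; rewrite addr0.
  apply: (@L2cvg_cut _ (fun=> 0)) => //; first exact: integrableH0.
  by move=> n p _; rewrite expr0n.
have m1 := L2cvg_nsq (fun n => tf_mul_L2 (tx n) h2) z2 lx.
have m2 := L2cvg_nsq (fun n => tf_mul_L2 (ty n) h2) z2 ly.
have m3 := L2cvg_nsq (fun n => tf_mul_L2 (tf_cut R n) h2) h2 lc.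
have n0 : nsq (fun _ : R * R => 0 : R) = 0.
  by rewrite /nsq (@eq_I _ _ (fun=> 0)) ?I0// => p _; rewrite expr0n.
have := le_lim3 m3 m1 m2 key.
rewrite n0 addr0 pmulr_rle0// => le0; apply/eqP; rewrite eq_le le0; exact: nsq_ge0.
Qed.

End Helmholtz.

(** * Weyl's lemma *)

Section Weyl.
Variable R : realType.
Implicit Types (f g h psi t : R * R -> R) (p q c : R * R) (e d : R).

(** A radial primitive of the kernel: the gradient of the difference [annulus] is [2 (q - c)] times
    a difference of two kernels. *)
Definition bump e c q : R := step (e ^- 2 * d2 c q).
Definition annulus e d c q : R := bump e c q - bump d c q.
Definition den e c q : R := d2 c q + step (e ^- 2 * (2 * d2 c q)).
(* [annulus e d c] vanishes near [c] and [den] equals [d2 c] elsewhere, so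
   [potential e d c] is the smooth version of [annulus e d c / d2 c]. *)
Definition potential e d c q : R := annulus e d c q * (den (Num.min e d) c q)^-1.

Lemma d2_ge0 c q : 0 <= d2 c q.
Proof. by rewrite addr_ge0 ?sqr_ge0. Qed.

Lemma den_gt0 e c q : 0 < e -> 0 < den e c q.
Proof.
move=> e0; rewrite /den; have := d2_ge0 c q; rewrite le_eqVlt => /orP[/eqP <-|h].
  by rewrite !mulr0 step1 ?ltr_wpDl.
by rewrite ltr_pwDl// step_ge0.
Qed.

Lemma smooth_den e c : smooth_on (den e c).
Proof.
move=> n; apply: CkD; first exact: smooth_d2.
by apply: Ck_comp; [exact: smooth1_step|apply: CkZ; apply: CkZ; exact: smooth_d2].
Qed.

Lemma bump1 e c q : 0 < e -> d2 c q <= e ^+ 2 -> bump e c q = 1.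
Proof. by move=> e0 h; rewrite /bump step1// mulrC ler_pdivrMr ?exprn_gt0// mul1r. Qed.

(** Within distance [m = min e d] of the centre both bumps are 1 and both sides vanish. Farther out
    the correction term of [den] is 0, thanks to the factor 2 in its argument. *)
Lemma potential_d2 e d c q : 0 < e -> 0 < d ->
  potential e d c q * d2 c q = annulus e d c q.
Proof.
move=> e0 d0; rewrite /potential; set m := Num.min e d.
have m0 : 0 < m by rewrite lt_min e0.
have [h|h] := leP (d2 c q) (m ^+ 2).
  have s (x : R) : 0 < x -> m <= x -> bump x c q = 1.
    move=> x0 mx; apply: bump1 => //; apply: le_trans h _.
    by rewrite ler_sqr ?nnegrE ?(ltW x0) ?(ltW m0).
  by rewrite /annulus !s ?subrr ?mul0r// ge_min lexx ?orbT.
have dp : 0 < d2 c q by apply: lt_trans h; exact: exprn_gt0.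
have -> : den m c q = d2 c q.
  rewrite /den step0 ?addr0// mulrC ler_pdivlMr ?exprn_gt0//.
  by rewrite ler_pM2l// ltW.
by rewrite divfK// gt_eqF.
Qed.

Lemma potential_c e d c : 0 < e -> 0 < d -> potential e d c c = 0.
Proof.
move=> e0 d0; rewrite /potential /annulus !bump1 ?subrr ?mul0r//;
by rewrite /d2 !subrr expr0n addr0 sqr_ge0.
Qed.

Lemma tf_annulus e d c : 0 < e -> 0 < d -> 2 * e < c.2 -> 2 * d < c.2 -> test_fun (annulus e d c).
Proof.
move=> e0 d0 ec dc.
by apply: tfB; apply: radial_tf => //; [exact: smooth1_step|exact: step0|exact: smooth1_step|exact: step0].
Qed.

Lemma tf_potential e d c : 0 < e -> 0 < d -> 2 * e < c.2 -> 2 * d < c.2 -> test_fun (potential e d c).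
Proof.
move=> e0 d0 ec dc; have m0 : 0 < Num.min e d by rewrite lt_min e0.
have C : smooth_on (fun q => (den (Num.min e d) c q)^-1).
  by move=> n; apply: CkV; [move=> p _; rewrite gt_eqF// den_gt0|exact: smooth_den].
by apply: tf_eq (smoothM_tf C (tf_annulus e0 d0 ec dc)) => q; rewrite mulrC.
Qed.

Lemma dX_d2 c q : dX (d2 c) q (2 * (q.1 - c.1)).
Proof.
have h : dX (fun p : R * R => c.1 - p.1) q (0 - 1) := dXB (dX_cst c.1 q) (dX_fst q).
have k : dX (fun p : R * R => c.2 - p.2) q (0 - 0) := dXB (dX_cst c.2 q) (dX_snd q).
by apply: dX_eq (dXD (dXM h h) (dXM k k)) _; ring.
Qed.

Lemma dY_d2 c q : dY (d2 c) q (2 * (q.2 - c.2)).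
Proof.
have h : dY (fun p : R * R => c.1 - p.1) q (0 - 0) := dYB (dY_cst c.1 q) (dY_fst q).
have k : dY (fun p : R * R => c.2 - p.2) q (0 - 1) := dYB (dY_cst c.2 q) (dY_snd q).
by apply: dY_eq (dYD (dYM h h) (dYM k k)) _; ring.
Qed.

Lemma px_annulus e d c q : px (annulus e d c) q = 2 * (q.1 - c.1) * (kern d c q - kern e c q).
Proof.
apply: px_val; have h x := dX_comp (step_derive (x ^- 2 * d2 c q)) (dXZ (x ^- 2) (dX_d2 c q)).
by apply: dX_eq (dXB (h e) (h d)) _; rewrite /kern /hump; ring.
Qed.

Lemma py_annulus e d c q : py (annulus e d c) q = 2 * (q.2 - c.2) * (kern d c q - kern e c q).
Proof.
apply: py_val; have h x := dY_comp (step_derive (x ^- 2 * d2 c q)) (dYZ (x ^- 2) (dY_d2 c q)).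
by apply: dY_eq (dYB (h e) (h d)) _; rewrite /kern /hump; ring.
Qed.

Lemma kern_c e c : kern e c c = 0.
Proof. by rewrite /kern /d2 !subrr expr0n addr0 mulr0 /hump dstep0 ?oppr0 ?mul0r// ler01. Qed.

Definition relX c q : R := q.1 - c.1.
Definition relY c q : R := q.2 - c.2.

Lemma smooth_relX c : smooth_on (relX c).
Proof. by move=> n; apply: CkB; [exact: Ck_fst|exact: Ck_cst]. Qed.
Lemma smooth_relY c : smooth_on (relY c).
Proof. by move=> n; apply: CkB; [exact: Ck_snd|exact: Ck_cst]. Qed.

Lemma d2_eq0 c q : d2 c q = 0 -> relX c q = 0 /\ relY c q = 0.
Proof.
have -> : d2 c q = relX c q ^+ 2 + relY c q ^+ 2 by rewrite /d2 /relX /relY; ring.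
by move/eqP; rewrite paddr_eq0 ?sqr_ge0// !sqrf_eq0 => /andP[/eqP -> /eqP ->].
Qed.

(* The conjugate potentials [relX * M] and [relY * M], [M = potential e d c],
   satisfy the inhomogeneous Cauchy-Riemann system whose right-hand side is a
   difference of two mollifiers. *)
Lemma potential_CR e d c : 0 < e -> 0 < d -> 2 * e < c.2 -> 2 * d < c.2 ->
  let phi := fun q => relX c q * potential e d c q in
  let psi := fun q => relY c q * potential e d c q in
  [/\ test_fun phi, test_fun psi,
    forall q, px phi q + py psi q = 2 * (kern d c q - kern e c q) &
    forall q, py phi q = px psi q].
Proof.
have aux (x y a b D k : R) : D != 0 -> a * D = 2 * x * k -> b * D = 2 * y * k -> x * b = y * a.
  by move=> Dn h1 h2; apply: (mulIf Dn); rewrite -!mulrA h1 h2; ring.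
move=> e0 d0 ec dc phi psi; have tM := tf_potential e0 d0 ec dc.
have tp : test_fun phi by apply: smoothM_tf => //; exact: smooth_relX.
have ts : test_fun psi by apply: smoothM_tf => //; exact: smooth_relY.
have Md q : px (potential e d c) q * d2 c q = 2 * relX c q * (kern d c q - kern e c q - potential e d c q) /\
    py (potential e d c) q * d2 c q = 2 * relY c q * (kern d c q - kern e c q - potential e d c q).
  have E : annulus e d c = fun q => potential e d c q * d2 c q.
    by apply/funext => r; rewrite potential_d2.
  have := px_annulus e d c q; rewrite {1}E (px_val (dXM (tf_dX q tM) (dX_d2 c q))).
  have := py_annulus e d c q; rewrite {1}E (py_val (dYM (tf_dY q tM) (dY_d2 c q))).
  rewrite /relX /relY.
  move: (px _ q) (py _ q) (potential _ _ _ q) (kern d c q) (kern e c q) (d2 c q) => a b m k1 k2 D h1 h2.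
  by split; lra.
have pX q : px phi q = potential e d c q + relX c q * px (potential e d c) q.
  rewrite (px_val (dXM (dXB (dX_fst q) (dX_cst c.1 q)) (tf_dX q tM))) /relX.
  by move: (px _ q) => z; ring.
have pY q : py phi q = relX c q * py (potential e d c) q.
  rewrite (py_val (dYM (dYB (dY_fst q) (dY_cst c.1 q)) (tf_dY q tM))) /relX.
  by move: (py _ q) => z; ring.
have sX q : px psi q = relY c q * px (potential e d c) q.
  rewrite (px_val (dXM (dXB (dX_snd q) (dX_cst c.2 q)) (tf_dX q tM))) /relY.
  by move: (px _ q) => z; ring.
have sY q : py psi q = potential e d c q + relY c q * py (potential e d c) q.
  rewrite (py_val (dYM (dYB (dY_snd q) (dY_cst c.2 q)) (tf_dY q tM))) /relY.
  by move: (py _ q) => z; ring.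
have dE q : d2 c q = relX c q ^+ 2 + relY c q ^+ 2 by rewrite /d2 /relX /relY; ring.
split => // q.
  rewrite pX sY; have [h1 h2] := Md q; have [d0'|dn] := eqVneq (d2 c q) 0.
    have [x0 y0] := d2_eq0 d0'.
    have -> : q = c by move: x0 y0; case: (q) (c) => x y [x' y']; rewrite /relX /relY /= => /subr0_eq -> /subr0_eq ->.
    have [-> ->] : relX c c = 0 /\ relY c c = 0 by rewrite /relX /relY !subrr.
    by rewrite potential_c// !kern_c !mul0r !addr0 subrr mulr0.
  apply: (mulIf dn); move: h1 h2 (dE q).
  move: (px _ q) (py _ q) (potential _ _ _ q) (kern d c q) (kern e c q) (d2 c q) (relX c q) (relY c q).
  move=> a b m k1 k2 D x y h1 h2 h3.
  have -> : (m + x * a + (m + y * b)) * D = 2 * m * D + x * (a * D) + y * (b * D) by ring.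
  by rewrite h1 h2 h3; ring.
rewrite pY sX; have [h1 h2] := Md q; have [d0'|dn] := eqVneq (d2 c q) 0.
  by have [-> ->] := d2_eq0 d0'; rewrite !mul0r.
exact: aux dn h1 h2.
Qed.

(** The hypothesis says that [u] annihilates divergences of curl-free test fields, a property of
    each component of a closed and coclosed field. By [potential_CR], twice the difference of two
    kernels with the same centre is such a divergence. *)
Lemma kern_indep u : L2fun u ->
  (forall phi psi, test_fun phi -> test_fun psi -> (forall q, py phi q = px psi q) ->
    ip u (px phi) + ip u (py psi) = 0) ->
  forall e d c, 0 < e -> 0 < d -> 2 * e < c.2 -> 2 * d < c.2 ->
  I (fun q => u q * kern e c q) = I (fun q => u q * kern d c q).
Proof.
move=> u2 H e d c e0 d0 ec dc.
have [tp ts h1 h2] := potential_CR e0 d0 ec dc.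
have j1 := L2M u2 (tf_L2 (tf_px tp)); have j2 := L2M u2 (tf_L2 (tf_py ts)).
have i1 := L2M u2 (tf_L2 (tf_kern e0 ec)); have i2 := L2M u2 (tf_L2 (tf_kern d0 dc)).
have E1 := etrans (ID j1 j2) (H _ _ tp ts h2).
have E2 : I (fun q => 2 * (u q * kern d c q - u q * kern e c q)) = 0.
  apply: etrans E1; apply: eq_I => q _; rewrite -mulrDr h1.
  by move: (kern d c q) (kern e c q) (u q) => x y z; ring.
move/eqP: (etrans (esym (etrans (IZ _ (integrableHB i2 i1)) (f_equal _ (IB i2 i1)))) E2).
by rewrite mulf_eq0 pnatr_eq0 /= subr_eq0 => /eqP.
Qed.

(** The scale depends on the point so as to satisfy [2 e < p.2] and [e < 1/2] everywhere; for stable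
    [f] any admissible scale gives the same value. *)
Definition regular f p : R := moll (Num.min (p.2 / 4) (1 / 4)) f p.

Definition stable f := L2fun f /\ forall e d c, 0 < e -> 0 < d -> 2 * e < c.2 -> 2 * d < c.2 ->
  I (fun q => f q * kern e c q) = I (fun q => f q * kern d c q).

Lemma regular_moll f e p : stable f -> Hp p -> 0 < e -> 2 * e < p.2 -> regular f p = moll e f p.
Proof.
move=> [_ ki] Hpp e0 ep; rewrite /regular /moll; congr (_ * _); apply: ki => //.
  by rewrite lt_min !divr_gt0.
by rewrite minr_pMr// gt_min; apply/orP; left; have : 0 < p.2 by []; lra.
Qed.

Lemma moll_cut f e p a b m : supp_in (kern e p) a b -> (forall q, box a b q -> cutoff m q = 1 :> R) ->
  moll e (fun q => cutoff m q * f q) p = moll e f p.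
Proof.
move=> sk k1; rewrite /moll; congr (_ * _); apply: eq_I => q _.
have [bq|nq] := pselect (box a b q); first by rewrite k1// mul1r.
by rewrite sk// !mulr0.
Qed.

(** Near [p0] one scale and one cutoff serve all points, so [regular f] is locally a convolution of
    an integrable function. The choice is independent of [f], which allows the two components of a
    form to be treated with the same kernel. *)
Lemma regular_loc p0 : Hp p0 -> exists a b m e, [/\ 0 < e, e < 1 / 2,
  forall f, stable f -> \forall p \near p0, regular f p = moll e (fun q => cutoff m q * f q) p,
  2 * e < p0.2 & supp_in (kern e p0) a b /\ forall q, box a b q -> cutoff m q = 1 :> R].
Proof.
move=> Hpp; pose B := `|p0.1| + `|p0.2| + 1.
have a0 : 0 < p0.2 / 2 by rewrite divr_gt0.
have [m [e0 [e00 e02 kn k1]]] := kern_nest B a0.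
have e0' : 0 < e0 / 2 by rewrite divr_gt0.
have e00' : e0 / 2 < e0 by lra.
have nb : \forall p \near p0, box (p0.2 / 2) B p.
  apply/nbhs2P; exists (Num.min (p0.2 / 2) 1); first by rewrite lt_min a0 ltr01.
  move=> q; rewrite !lt_min => /andP[_ h1] /andP[h2 h3].
  move: h1 h2 h3; rewrite !ltr_norml => /andP[h1 h1'] /andP[h2 h2'] /andP[h3 h3'].
  have n1 := ler_norm p0.1; have n2 := ler_norm p0.2; have n3 := ler_norm (- p0.1).
  rewrite normrN in n3; have n4 := normr_ge0 p0.1; have n5 := normr_ge0 p0.2.
  by apply/boxP; rewrite /B; split; apply/andP; split; lra.
have b0 := nbhs_singleton nb.
exists (p0.2 / 2 / 2), (B + 1), m, (e0 / 2); have [ep sk] := kn _ _ e0' e00' b0.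
split => //; first by lra.
move=> f sf; apply: filterS nb => p bp; have [ep' sk'] := kn _ _ e0' e00' bp.
by rewrite (regular_moll sf (box_Hp a0 bp) e0' ep') (moll_cut _ sk' k1).
Qed.

Lemma cutf_int m f : L2fun f -> integrableH (fun q => cutoff m q * f q).
Proof. exact: L2M (tf_L2 (tf_cut R m)). Qed.

Lemma smooth_regular f : stable f -> smooth_on (regular f).
Proof.
move=> sf n; apply: Ck_local => p0 Hpp.
have [a [b [m [e [e0 e2 nr _ _]]]]] := regular_loc Hpp.
exists (moll e (fun q => cutoff m q * f q)); split.
  by apply: moll_smooth => //; apply: cutf_int; case: sf.
by apply: filterS (nr f sf) => q ->.
Qed.

(** A single test function, the kernel at [p0], serves all stable [f]. The weak equations of a form
    tested against it become pointwise equations for the regularized components. *)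
Lemma regular_partials p0 : Hp p0 -> exists2 psi, test_fun psi & forall f, stable f ->
  px (regular f) p0 = - (kmass R)^-1 * ip f (px psi) /\
  py (regular f) p0 = - (kmass R)^-1 * ip f (py psi).
Proof.
move=> Hpp; have [a [b [m [e [e0 e2 nr ep [sk k1]]]]]] := regular_loc Hpp.
exists (kern e p0); first exact: tf_kern.
move=> f sf; have fi := cutf_int m sf.1.
have cutk g : supp_in g a b -> I (fun q => (cutoff m q * f q) * g q) = ip f g.
  move=> gs; apply: eq_I => q _; have [bq|nq] := pselect (box a b q); first by rewrite k1// mul1r.
  by rewrite gs// !mulr0.
rewrite (near_px (nr f sf)) (near_py (nr f sf)); split.
  rewrite (px_val (moll_dX p0 e0 e2 fi)); congr (_ * _); apply: cutk; exact: supp_px.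
rewrite (py_val (moll_dY p0 e0 e2 fi)); congr (_ * _); apply: cutk; exact: supp_py.
Qed.

(** Along scales tending to 0 the localized mollifications converge to [f] in [L^2]. On the support
    of the cutoff they already equal [regular f], by independence of the scale, and limits are
    unique. *)
Lemma cut_regular f (a : nat -> R * R -> R) n : stable f ->
  (forall n, test_fun (a n)) -> L2cvg a f ->
  L2fun (fun p => cutoff n p * regular f p - cutoff n p * f p) /\
  nsq (fun p => cutoff n p * regular f p - cutoff n p * f p) = 0.
Proof.
move=> sf ta af; have tc := tf_cut R n; have [c [d [c0 d0 cs]]] := tf_box tc.
have f2 := sf.1.
have [m [e0 [e00 e02 kn k1]]] := kern_nest d c0.
have tk := tf_cut R m; have fi := cutf_int m f2.
have e30 : 0 < e0 / 2 by rewrite divr_gt0.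
have g2 := tf_mul_L2 tk f2; have ta2 k := tf_L2 (ta k).
have mf := moll_cvg_seq (fun k => tfM tk (ta k)) g2 fi (tf_mul_cvg tk ta2 f2 af) e30.
pose e (k : nat) : R := e0 / 2 / k.+1%:R.
have ek0 k : 0 < e k by rewrite divr_gt0.
have eke k : e k < e0.
  apply: (@le_lt_trans _ _ (e0 / 2)); last by lra.
  by rewrite ler_pdivrMr// ler_peMr ?ler1n// ltW.
have ek2 k : e k < 1 / 2 by apply: lt_trans (eke k) e02.
have mf2 k : L2fun (moll (e k) (fun q => cutoff m q * f q)) by case: (young (ek0 k) (ek2 k) fi g2).
have r2 : L2fun (fun p => cutoff n p * regular f p).
  by apply: tf_L2; apply: tf_eq (smoothM_tf (smooth_regular sf) tc) => p; rewrite mulrC.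
have cf2 := tf_mul_L2 tc f2.
have l1 : L2cvg (fun k p => cutoff n p * moll (e k) (fun q => cutoff m q * f q) p)
    (fun p => cutoff n p * f p).
  apply: L2cvg_eq (tf_mul_cvg tc mf2 g2 mf) => // p Hpp.
  have [bp|np] := pselect (box c d p); last by rewrite cs// !mul0r.
  rewrite k1 ?mul1r//; apply: box_sub bp; last by rewrite lerDl.
  by rewrite ler_pdivrMr// ler_peMr ?ler1n// ltW.
have l2 : L2cvg (fun k p => cutoff n p * moll (e k) (fun q => cutoff m q * f q) p)
    (fun p => cutoff n p * regular f p).
  apply: (@L2cvg_eq _ (fun _ p => cutoff n p * regular f p) _ (fun p => cutoff n p * regular f p)) => //.
    move=> k p Hpp; have [bp|np] := pselect (box c d p); last by rewrite cs// !mul0r.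
    have [ep sk] := kn _ _ (ek0 k) (eke k) bp.
    by rewrite (moll_cut _ sk k1) (regular_moll sf Hpp (ek0 k) ep).
  rewrite /L2cvg (_ : (fun=> _) = fun=> 0); first exact: cvg_cst.
  apply/funext => k; rewrite -[RHS](I0 R); apply: eq_I => p _.
  by rewrite subrr expr0n.
split; first exact: L2B.
exact: (L2cvg_unique (fun k => tf_mul_L2 tc (mf2 k)) r2 cf2 l2 l1).
Qed.

(** Fatou's lemma removes the cutoff from [cut_regular]. *)
Lemma regular_eq f (a : nat -> R * R -> R) : stable f ->
  (forall n, test_fun (a n)) -> L2cvg a f ->
  L2fun (regular f) /\ nsq (fun p => regular f p - f p) = 0.
Proof.
move=> sf ta af; have key n := cut_regular n sf ta af.
have mr : measH (fun p => regular f p - f p).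
  by apply: measurable_funB; [exact: smooth_measH (smooth_regular sf)|case: sf => -[]].
have [d2 d0] : L2fun (fun p => regular f p - f p) /\ nsq (fun p => regular f p - f p) <= 0.
  apply: (@fatou_sq _ (fun n p => cutoff n p * regular f p - cutoff n p * f p)) => //.
  - by move=> n; case: (key n).
  - apply: aeW => p Hpp; have [N NP] := rho_le_nat p.
    by apply: cvg_near_cst; exists N => // n /NP /= hr; rewrite cut1// !mul1r.
  - by move=> n; case: (key n) => _ ->.
split; last by apply/eqP; rewrite eq_le d0 nsq_ge0.
by apply: eq_L2 (L2D d2 sf.1) => p _; rewrite subrK.
Qed.

Lemma weyl (w : oneform R) (a b : nat -> R * R -> R) : L2form w ->
  (forall n, test_fun (a n)) -> (forall n, test_fun (b n)) -> L2cvg a (fm1 w) -> L2cvg b (fm2 w) ->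
  (forall psi, test_fun psi -> ip (fm1 w) (py psi) = ip (fm2 w) (px psi)) ->
  (forall psi, test_fun psi -> ip (fm1 w) (px psi) + ip (fm2 w) (py psi) = 0) ->
  exists W : oneform R, [/\ smooth_form W, L2form W, closed_form W, coclosed_form W &
    nsq (fun p => fm1 W p - fm1 w p) = 0 /\ nsq (fun p => fm2 W p - fm2 w p) = 0].
Proof.
move=> [w1 w2] ta tb aw bw cl co.
(* For a curl-free test field [(phi, psi)], closedness tested with [psi] moves the second pairing
   from [fm1 w] to [fm2 w], and coclosedness tested with [phi] then gives 0. *)
have st1 : stable (fm1 w).
  split => //; apply: kern_indep => // phi psi tp ts E; rewrite (cl psi ts).
  have -> : px psi = py phi by apply/funext => q; rewrite E.
  exact: co.
have st2 : stable (fm2 w).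
  split => //; apply: kern_indep => // phi psi tp ts E; rewrite -(cl phi tp).
  have -> : py phi = px psi by apply/funext => q; rewrite E.
  exact: co.
have [r1 n1] := regular_eq st1 ta aw; have [r2 n2] := regular_eq st2 tb bw.
exists (fun p => (regular (fm1 w) p, regular (fm2 w) p)); split.
- by split; exact: smooth_regular.
- exact (conj r1 r2).
- move=> p Hpp; have [psi tp H] := regular_partials Hpp.
  have [_ e1] := H _ st1; have [e2 _] := H _ st2.
  by apply: etrans e1 _; apply: etrans _ (esym e2); rewrite (cl psi tp).
- move=> p Hpp; have [psi tp H] := regular_partials Hpp.
  have [e1 _] := H _ st1; have [_ e2] := H _ st2.
  by apply: etrans (f_equal2 +%R e1 e2) _; rewrite -mulrDr co// mulr0.
- exact (conj n1 n2).
Qed.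

End Weyl.

(** * Poincare's lemma *)

Section Poincare.
Variable R : realType.
Implicit Types (f g h : R * R -> R) (p q : R * R) (W : oneform R).
Let D : set R := `[0, 1]%classic.

Lemma smooth_bounded f a b : smooth_on f -> 0 < a -> exists M, forall p, box a b p -> `|f p| <= M.
Proof.
move=> fC a0; have [m mP] := box_rho b a0.
have [M M0 fM] := tf_bounded (smoothM_tf fC (tf_cut R m)).
exists M => p bp; have := fM p; rewrite cut1 ?mulr1//; first exact: box_Hp bp.
exact: mP.
Qed.

Lemma is_derive_affine (c t d z : R) : is_derive z (1 : R) (fun s => c + t * (s - d)) t.
Proof.
have := dXD (dX_cst c (z, 0 : R)) (dXZ t (dXB (dX_fst (z, 0 : R)) (dX_cst d (z, 0 : R)))).
by rewrite subr0 mulr1 add0r.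
Qed.

Lemma is_derive_affine2 (c e t : R) : is_derive t (1 : R) (fun s => c + s * e) e.
Proof.
have := dXD (dX_cst c (t, 0 : R)) (dXM (dX_fst (t, 0 : R)) (dX_cst e (t, 0 : R))).
by move=> h; apply: dX_eq h _; rewrite mulr0 addr0 add0r mul1r.
Qed.

Lemma is_derive_cont (F : R -> R) (x l : R) : is_derive x (1 : R) F l -> {for x, continuous F}.
Proof. by case=> h _; apply/differentiable_continuous/derivable1_diffP. Qed.

(** Differentiation under the integral over [[0, 1]]; the differentiated integrand is itself the
    [t]-derivative of [H], so the fundamental theorem evaluates its integral. *)
Lemma diff_unit_integral (Phi phi : R -> R -> R) (H : R -> R) (z0 r M : R) : 0 < r ->
  (forall (z t : R), `|z - z0| < r -> 0 <= t <= 1 -> is_derive z (1 : R) (Phi ^~ t) (phi z t)) ->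
  (forall (z t : R), `|z - z0| < r -> 0 <= t <= 1 -> {for t, continuous (Phi z)}) ->
  (forall (z t : R), `|z - z0| < r -> 0 <= t <= 1 -> `|phi z t| <= M) ->
  (forall (t : R), 0 <= t <= 1 -> is_derive t (1 : R) H (phi z0 t)) ->
  (forall (t : R), 0 <= t <= 1 -> {for t, continuous (phi z0)}) ->
  is_derive z0 (1 : R) (fun z => \int[@lebesgue_measure R]_(t in D) Phi z t) (H 1 - H 0).
Proof.
move=> r0 hP hc hM hH hp.
have mD : measurable (D : set (measurableTypeR R)) by exact: measurable_itv.
have D01 (t : R) : D t -> 0 <= t <= 1 by rewrite /D /= in_itv.
have I1 : `]z0 - r, z0 + r[%classic z0 by rewrite /= in_itv /= gtrBl ltrDl r0.
have Iz z : `]z0 - r, z0 + r[%classic z -> `|z - z0| < r.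
  by rewrite /= in_itv /= ltr_norml => /andP[h1 h2]; apply/andP; split; lra.
have cint (G : R -> R) : (forall (t : R), 0 <= t <= 1 -> {for t, continuous G}) ->
    {within D, continuous G} /\ (@lebesgue_measure R).-integrable D (EFin \o G).
  move=> Gc; have wc : {within D, continuous G}.
    by apply: continuous_in_subspaceT => t /set_mem /D01; exact: Gc.
  by split => //; apply: continuous_compact_integrable => //; exact: segment_compact.
have hI z : `]z0 - r, z0 + r[%classic z -> (@lebesgue_measure R).-integrable D (EFin \o Phi z).
  by move=> /Iz zr; apply: (cint _ _).2 => t; exact: hc.
have hD z (t : measurableTypeR R) : `]z0 - r, z0 + r[%classic z -> D t -> derivable (Phi ^~ t) z 1.
  by move=> /Iz zr /D01 /(hP z t zr)[].
have p1 (z : R) (t : measurableTypeR R) : `|z - z0| < r -> 0 <= t <= 1 -> partial1of2 Phi z t = phi z t.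
  move=> zr t01; rewrite partial1of2E; exact: (@derive_val _ _ _ _ _ _ _ (hP z t zr t01)).
have M0 : 0 <= M.
  apply: le_trans (hM z0 0 _ _); rewrite ?normr_ge0 ?subrr ?normr0 ?lexx ?ler01//.
have Gi : (@lebesgue_measure R).-integrable D (EFin \o cst M).
  by apply: (cint _ _).2 => t _; exact: cst_continuous.
have hB z (t : measurableTypeR R) : `]z0 - r, z0 + r[%classic z -> D t -> `|partial1of2 Phi z t| <= M.
  by move=> /Iz zr /D01 t01; rewrite p1// hM.
have D1 := derivable_under_integral mD I1 hI hD (fun=> M0) Gi hB.
have D2 := differentiation_under_integral mD I1 hI hD (fun=> M0) Gi hB.
apply: DeriveDef; first exact: D1.
have zz : `|z0 - z0| < r by rewrite subrr normr0.
have K : (\int[@lebesgue_measure R]_(t in D) (phi z0 t)%:E = (H 1)%:E - (H 0)%:E)%E.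
  apply: continuous_FTC2; first exact: ltr01.
  - by case: (cint _ hp).
  - split.
    + by move=> t; rewrite in_itv => /andP[h1 h2]; have [] := hH t; rewrite ?ltW.
    + by apply: cvg_at_right_filter; apply: is_derive_cont (hH 0 _); rewrite lexx ler01.
    + by apply: cvg_at_left_filter; apply: is_derive_cont (hH 1 _); rewrite lexx ler01.
  - move=> t; rewrite in_itv => /andP[h1 h2]; rewrite derive1E.
    have t01 : 0 <= t <= 1 by rewrite !ltW.
    exact: (@derive_val _ _ _ _ _ _ _ (hH t t01)).
rewrite -derive1E; apply: etrans D2 _.
apply: etrans (_ : fine (\int[@lebesgue_measure R]_(t in D) (phi z0 t)%:E)%E = _); last by rewrite K.
rewrite /Rintegral; congr fine; apply: eq_integral => t /set_mem /D01 t01.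
by rewrite p1.
Qed.

(** The primitive of [g] from [c], rescaled to the fixed segment [[0, 1]], which covers both
    positions of [z] relative to [c]. The [z]-derivative of its integrand is the [t]-derivative of
    [t * g (c + t * (z - c))]. *)
Lemma primitive_derive (g g' : R -> R) (c z0 r M : R) (S : R -> Prop) : 0 < r ->
  (forall (z t : R), `|z - z0| < r -> 0 <= t <= 1 -> S (c + t * (z - c))) ->
  (forall s, S s -> [/\ is_derive s (1 : R) g (g' s), {for s, continuous g'}, `|g s| <= M & `|g' s| <= M]) ->
  is_derive z0 (1 : R) (fun z => \int[@lebesgue_measure R]_(t in D) ((z - c) * g (c + t * (z - c)))) (g z0).
Proof.
move=> r0 hS hg.
have z00 : `|z0 - z0| < r by rewrite subrr normr0.
have cg s : S s -> {for s, continuous g} by move=> /hg[h _ _ _]; exact: is_derive_cont h.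
have caff (z t : R) : {for t, continuous (fun s : R => c + s * (z - c))} := is_derive_cont (is_derive_affine2 c (z - c) t).
have S0 : S c by have := hS z0 0 z00; rewrite mul0r addr0; apply; rewrite lexx ler01.
have M0 : 0 <= M by have [_ _ h _] := hg _ S0; apply: le_trans h.
have -> : g z0 = 1 * g (c + 1 * (z0 - c)) - 0 * g (c + 0 * (z0 - c)).
  by rewrite mul0r subr0 !mul1r addrC subrK.
have cgaff (z t : R) : `|z - z0| < r -> 0 <= t <= 1 -> {for t, continuous (fun s : R => g (c + s * (z - c)))}.
  move=> zr t01; apply: (@continuous_comp _ _ _ (fun s : R => c + s * (z - c)) g); first exact: caff.
  by apply: cg; exact: hS.
apply: (@diff_unit_integral (fun z t => (z - c) * g (c + t * (z - c)))
  (fun z t => g (c + t * (z - c)) + (z - c) * (g' (c + t * (z - c)) * t))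
  (fun t => t * g (c + t * (z0 - c))) z0 r (M + (`|z0| + r + `|c|) * M)) => //.
- move=> z t zr t01; have [h _ _ _] := hg _ (hS z t zr t01).
  have hc := @is_derive1_comp _ g (fun z => c + t * (z - c)) z _ _ h (is_derive_affine c t c z).
  have := dXM (dXB (dX_fst (z, 0 : R)) (dX_cst c (z, 0 : R))) (hc : dX (fun p => g (c + t * (p.1 - c))) (z, 0 : R) _).
  by move=> k; apply: dX_eq k _ => /=; ring.
- move=> z t zr t01; apply: cvgM; first exact: cvg_cst.
  exact: cgaff.
- move=> z t zr t01; have [_ _ h1 h2] := hg _ (hS z t zr t01).
  apply: le_trans (ler_normD _ _) _; apply: lerD => //.
  rewrite normrM; apply: ler_pM => //.
    have -> : z - c = z0 + (z - z0) - c by ring.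
    apply: le_trans (ler_normB _ _) _; rewrite lerD2r.
    by apply: le_trans (ler_normD _ _) _; rewrite lerD2l ltW.
  rewrite normrM -[M]mulr1; apply: ler_pM => //.
  by move: t01 => /andP[t0 t1]; rewrite ger0_norm.
- move=> t t01; have [h _ _ _] := hg _ (hS z0 t z00 t01).
  have hc := @is_derive1_comp _ g (fun t => c + t * (z0 - c)) t _ _ h (is_derive_affine2 c (z0 - c) t).
  have := dXM (dX_fst (t, 0 : R)) (hc : dX (fun p => g (c + p.1 * (z0 - c))) (t, 0 : R) _).
  by move=> k; apply: dX_eq k _ => /=; ring.
- move=> t t01; apply: cvgD; first exact: cgaff.
  apply: cvgM; first exact: cvg_cst.
  apply: cvgM; last exact: cvg_id.
  apply: (@continuous_comp _ _ _ (fun s : R => c + s * (z0 - c)) g'); first exact: caff.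
  by have [] := hg _ (hS z0 t z00 t01).
Qed.

Lemma between1 (a b t z : R) : 0 <= t <= 1 -> a <= 1 <= b -> a <= z <= b -> a <= 1 + t * (z - 1) <= b.
Proof.
move=> /andP[t0 t1] /andP[a1 b1] /andP[az zb].
have -> : 1 + t * (z - 1) = (1 - t) * 1 + t * z by ring.
have e x : x = (1 - t) * x + t * x by ring.
by rewrite (e a) (e b); apply/andP; split; apply: lerD; apply: ler_wpM2l => //; rewrite subr_ge0.
Qed.

(** [F] integrates [W] from [(0, 1)] along the horizontal line to [(x, 1)] and then vertically to
    [(x, y)]; this path stays in the half-plane. *)
Lemma poincare W : smooth_form W -> closed_form W ->
  exists F, smooth_on F /\ forall p, Hp p -> px F p = fm1 W p /\ py F p = fm2 W p.
Proof.
move=> [c1 c2] cl.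
pose A (x : R) := \int[@lebesgue_measure R]_(t in D) ((x - 0) * fm1 W (0 + t * (x - 0), 1)).
pose B p := \int[@lebesgue_measure R]_(t in D) ((p.2 - 1) * fm2 W (p.1, 1 + t * (p.2 - 1))).
have dA x : is_derive x (1 : R) A (fm1 W (x, 1)).
  have [M1 M1P] := smooth_bounded (`|x| + 2) c1 ltr01.
  have [M2 M2P] := smooth_bounded (`|x| + 2) (smooth_px c1) ltr01.
  apply: (@primitive_derive (fun s => fm1 W (s, 1)) (fun s => px (fm1 W) (s, 1)) 0 x 1 (Num.max M1 M2)
    (fun s => `|s| <= `|x| + 1)) => //.
    move=> z t zx /andP[t0 t1]; rewrite add0r subr0 normrM ger0_norm//.
    apply: (@le_trans _ _ `|z|); first by rewrite ler_piMl.
    have -> : z = x + (z - x) by ring.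
    by apply: le_trans (ler_normD _ _) _; rewrite lerD2l ltW.
  move=> s sx; have bs : box 1 (`|x| + 2) (s, 1).
    move: sx; rewrite ler_norml => /andP[h1 h2].
    by apply/boxP; split => /=; apply/andP; split; have := normr_ge0 x; lra.
  split.
  - exact: (smooth_dX c1 (Hp1 s)).
  - exact (cont_hline ((smooth_px c1 0%N) _ (Hp1 s))).
  - by rewrite le_max M1P.
  - by rewrite le_max M2P// orbT.
have dBY p : Hp p -> dY B p (fm2 W p).
  case: p => x y Hpp; have y0 : 0 < y by [].
  (* For [z] within [y / 2] of [y], the segment from 1 to [z] stays between [a] and [2 * y + 1],
     where [W] is bounded. *)
  pose a := Num.min 1 (y / 2); have a0 : 0 < a by rewrite lt_min ltr01 divr_gt0.
  pose b := `|x| + 2 * y + 1.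
  have [M1 M1P] := smooth_bounded b c2 a0.
  have [M2 M2P] := smooth_bounded b (smooth_py c2) a0.
  have y20 : 0 < y / 2 by rewrite divr_gt0.
  apply: (@primitive_derive (fun s => fm2 W (x, s)) (fun s => py (fm2 W) (x, s)) 1 y (y / 2) (Num.max M1 M2)
    (fun s => a <= s <= 2 * y + 1)) => //.
    move=> z t; rewrite ltr_norml => /andP[h1 h2] t01; apply: between1 => //.
      by rewrite ge_min lexx /=; lra.
    by rewrite ge_min; apply/andP; split; [apply/orP; right|]; lra.
  move=> s /andP[h1 h2]; have s0 : 0 < s by exact: lt_le_trans h1.
  have bs : box a b (x, s).
    apply/boxP; rewrite /b; split => /=; apply/andP; split => //; have := normr_ge0 x; have := ler_norm x;
    by have := ler_norm (- x); rewrite normrN; lra.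
  have Hs : Hp (x, s) by [].
  split.
  - exact: (smooth_dY c2 Hs).
  - exact (cont_vline ((smooth_py c2 0%N) _ Hs)).
  - by rewrite le_max M1P.
  - by rewrite le_max M2P// orbT.
(* Closedness turns the [x]-derivative of the vertical integrand into a [y]-derivative of [fm1 W],
   so the vertical integral contributes a difference of end values. *)
have dBX p : Hp p -> dX B p (fm1 W p - fm1 W (p.1, 1)).
  case: p => x y Hpp; have y0 : 0 < y by [].
  pose a := Num.min 1 y; have a0 : 0 < a by rewrite lt_min ltr01 y0.
  pose b := `|x| + y + 2.
  have [M MP] := smooth_bounded b (smooth_px c2) a0.
  have S (t : R) : 0 <= t <= 1 -> a <= 1 + t * (y - 1) <= y + 1.
    move=> t01; apply: between1 => //; first by rewrite ge_min lexx /= lerDr ltW.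
    by rewrite ge_min lexx orbT /= lerDl.
  have S0 (z t : R) : 0 <= t <= 1 -> Hp (z, 1 + t * (y - 1)).
    by move=> /S/andP[h _]; exact: lt_le_trans h.
  have -> : fm1 W (x, y) - fm1 W ((x, y).1, 1) = fm1 W (x, 1 + 1 * (y - 1)) - fm1 W (x, 1 + 0 * (y - 1)).
    have e1 : 1 + 1 * (y - 1) = y by ring.
    by rewrite e1 mul0r addr0.
  have vc (f : R * R -> R) (z t : R) : smooth_on f -> 0 <= t <= 1 ->
      {for t, continuous (fun t : R => f (z, 1 + t * (y - 1)))}.
    move=> fC t01; apply: (@continuous_comp _ _ _ (fun s : R => 1 + s * (y - 1)) (fun s => f (z, s))).
      exact (is_derive_cont (is_derive_affine2 1 (y - 1) t)).
    exact (cont_vline ((fC 0%N) _ (S0 z t t01))).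
  apply: (@diff_unit_integral (fun z t => (y - 1) * fm2 W (z, 1 + t * (y - 1)))
    (fun z t => (y - 1) * px (fm2 W) (z, 1 + t * (y - 1))) (fun t => fm1 W (x, 1 + t * (y - 1))) x 1
    (`|y - 1| * M)) => //.
  - move=> z t _ t01.
    exact: (dXZ (y - 1) (smooth_dX c2 (S0 z t t01))).
  - move=> z t _ t01; apply: cvgM; first exact: cvg_cst.
    exact: vc.
  - move=> z t zx t01; rewrite normrM ler_wpM2l//; apply: MP.
    have /andP[h1 h2] := S t t01; move: zx; rewrite ltr_norml => /andP[g1 g2].
    have n1 := normr_ge0 x; have n2 := ler_norm x; have n3 := ler_norm (- x); rewrite normrN in n3.
    by apply/boxP; rewrite /b; split => /=; apply/andP; split => //; lra.
  - move=> t t01; rewrite -(cl _ (S0 x t t01)) mulrC.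
    exact: (@is_derive1_comp _ (fun s => fm1 W (x, s)) (fun t => 1 + t * (y - 1)) t _ _
      (smooth_dY c1 (S0 x t t01)) (is_derive_affine2 1 (y - 1) t)).
  - move=> t t01; apply: cvgM; first exact: cvg_cst.
    by apply: vc => //; exact: smooth_px.
have FX p : Hp p -> dX (fun p => A p.1 + B p) p (fm1 W p).
  move=> Hpp; have hA : dX (fun p => A p.1) p (fm1 W (p.1, 1)) := dA p.1.
  by apply: dX_eq (dXD hA (dBX p Hpp)) _; rewrite addrC subrK.
have FY p : Hp p -> dY (fun p => A p.1 + B p) p (fm2 W p).
  move=> Hpp; have hA : dY (fun p => A p.1) p 0 := dY_cst (A p.1) p.
  by apply: dY_eq (dYD hA (dBY p Hpp)) _; rewrite add0r.
exists (fun p => A p.1 + B p); split; last by move=> p Hpp; rewrite (px_val (FX p Hpp)) (py_val (FY p Hpp)).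
move=> n; apply: CkW; apply: Ck_partials.
- by move=> p Hpp; rewrite (px_val (FX p Hpp)) (py_val (FY p Hpp)); split; [exact: FX|exact: FY].
- by apply: Ck_ext (c1 n) => p Hpp; rewrite (px_val (FX p Hpp)).
- by apply: Ck_ext (c2 n) => p Hpp; rewrite (py_val (FY p Hpp)).
Qed.

End Poincare.

(** * The two inclusions *)

Section Linearity.
Variable R : realType.
Implicit Types (f g h psi : R * R -> R) (p q : R * R) (u v w th : oneform R) (D E : sym2 R) (c : R).

(** One operation covers sums, with [c = 1], differences, with [c = -1], and the closure under
    combinations needed for projecting. *)
Definition form_lin c v w : oneform R := fun p => (fm1 v p + c * fm1 w p, fm2 v p + c * fm2 w p).
Definition sym_lin c D E : sym2 R := Sym2 (fun p => s11 D p + c * s11 E p)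
  (fun p => s12 D p + c * s12 E p) (fun p => s22 D p + c * s22 E p).

Lemma ip_lin c f g k h : (forall p, Hp p -> f p = g p + c * k p) ->
  L2fun g -> L2fun k -> L2fun h -> ip f h = ip g h + c * ip k h.
Proof.
move=> E g2 k2 h2; rewrite -(ipZl c k2 h2) -(ipDl g2 (L2Z c k2) h2).
exact: eq_ip.
Qed.

Lemma L2_lin c f g k : (forall p, Hp p -> f p = g p + c * k p) -> L2fun g -> L2fun k -> L2fun f.
Proof. by move=> E g2 k2; apply: eq_L2 (L2D g2 (L2Z c k2)) => p /E. Qed.

Lemma L2cvg_lin c (F G : nat -> R * R -> R) f g : (forall n, L2fun (F n)) -> (forall n, L2fun (G n)) ->
  L2fun f -> L2fun g -> L2cvg F f -> L2cvg G g ->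
  L2cvg (fun n p => F n p + c * G n p) (fun p => f p + c * g p).
Proof.
move=> F2 G2 f2 g2 Ff Gg.
have h := L2cvgB F2 (fun n => L2Z (- c) (G2 n)) f2 (L2Z (- c) g2) Ff (L2cvgZ (- c) G2 g2 Gg).
by apply: L2cvg_eq h => [n p _|p _]; rewrite mulNr opprK.
Qed.

Lemma L2form_lin c v w : L2form v -> L2form w -> L2form (form_lin c v w).
Proof. by move=> [v1 v2] [w1 w2]; split; [exact: L2_lin _ v1 w1|exact: L2_lin _ v2 w2]. Qed.

Lemma ym_lin c f g p : ym (fun q => f q + c * g q) p = ym f p + c * ym g p.
Proof. by rewrite /ym; ring. Qed.

Lemma L2D3_lin c D E : L2D3 D -> L2D3 E -> L2D3 (sym_lin c D E).
Proof.
move=> [d1 d2 d3] [e1 e2 e3].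
by split; [apply: L2_lin _ d1 e1|apply: L2_lin _ d2 e2|apply: L2_lin _ d3 e3] => p _; exact: ym_lin.
Qed.

Lemma Jf_lin a c u v D E i p :
  Jf a (form_lin c u v) (sym_lin c D E) i p = Jf a u D i p + c * Jf a v E i p.
Proof. by rewrite /Jf; case: i => -[|[|[|[|[|//]]]]] /= _ //; rewrite /ym /=; ring. Qed.

Lemma weakD_lin c v w D E psi : L2form v -> L2form w -> L2D3 D -> L2D3 E -> test_fun psi ->
  weakD v D psi -> weakD w E psi -> weakD (form_lin c v w) (sym_lin c D E) psi.
Proof.
have A1 (x y z x1 y1 z1 x2 y2 z2 : R) : x = x1 + c * x2 -> y = y1 + c * y2 -> z = z1 + c * z2 ->
    x1 + y1 = - z1 -> x2 + y2 = - z2 -> x + y = - z.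
  move=> -> -> -> h1 h2; have -> : x1 = - z1 - y1 by rewrite -h1 addrK.
  have -> : x2 = - z2 - y2 by rewrite -h2 addrK.
  by ring.
have A2 (x y z x1 y1 z1 x2 y2 z2 : R) : x = x1 + c * x2 -> y = y1 + c * y2 -> z = z1 + c * z2 ->
    x1 - y1 = - z1 -> x2 - y2 = - z2 -> x - y = - z.
  move=> -> -> -> h1 h2; have -> : x1 = - z1 + y1 by rewrite -h1 subrK.
  have -> : x2 = - z2 + y2 by rewrite -h2 subrK.
  by ring.
have A3 (x y z t x1 y1 z1 t1 x2 y2 z2 t2 : R) : x = x1 + c * x2 -> y = y1 + c * y2 -> z = z1 + c * z2 ->
    t = t1 + c * t2 -> x1 - y1 = - (z1 + t1) / 2 -> x2 - y2 = - (z2 + t2) / 2 -> x - y = - (z + t) / 2.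
  move=> -> -> -> -> h1 h2; have -> : x1 = - (z1 + t1) / 2 + y1 by rewrite -h1 subrK.
  have -> : x2 = - (z2 + t2) / 2 + y2 by rewrite -h2 subrK.
  by ring.
move=> [v1 v2] [w1 w2] [d1 d2 d3] [e1 e2 e3] tp [a1 a2 a3] [b1 b2 b3].
have y2 := tf_L2 (tf_yd tp); have px2 := tf_L2 (tf_px tp); have py2 := tf_L2 (tf_py tp).
have L1 h : L2fun h -> ip (fm1 (form_lin c v w)) h = ip (fm1 v) h + c * ip (fm1 w) h by exact: ip_lin.
have L2 h : L2fun h -> ip (fm2 (form_lin c v w)) h = ip (fm2 v) h + c * ip (fm2 w) h by exact: ip_lin.
split.
- by apply: A1 _ _ _ a1 b1; [apply: ip_lin => // p _; exact: ym_lin|exact: L2|exact: L1].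
- by apply: A3 _ _ _ _ a2 b2; [apply: ip_lin => // p _; exact: ym_lin|exact: L1|exact: L1|exact: L2].
- by apply: A2 _ _ _ a3 b3; [apply: ip_lin => // p _; exact: ym_lin|exact: L2|exact: L2].
Qed.

Lemma tf_form_lin c th eta : test_form th -> test_form eta -> test_form (form_lin c th eta).
Proof. by move=> [t1 t2] [e1 e2]; split; apply: tfD => //; exact: tfZ. Qed.

Lemma px_lin c f g p : test_fun f -> test_fun g ->
  px (fun q => f q + c * g q) p = px f p + c * px g p.
Proof. by move=> tf tg; apply: px_val; exact: dXD (tf_dX p tf) (dXZ c (tf_dX p tg)). Qed.

Lemma py_lin c f g p : test_fun f -> test_fun g ->
  py (fun q => f q + c * g q) p = py f p + c * py g p.
Proof. by move=> tf tg; apply: py_val; exact: dYD (tf_dY p tf) (dYZ c (tf_dY p tg)). Qed.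

Lemma Jf_Def_lin a c th eta i p : test_form th -> test_form eta ->
  Jf a (form_lin c th eta) (Def_smooth (form_lin c th eta)) i p =
    Jf a th (Def_smooth th) i p + c * Jf a eta (Def_smooth eta) i p.
Proof.
move=> [t1 t2] [e1 e2]; rewrite -Jf_lin.
have x1 := px_lin c p t1 e1; have x2 := px_lin c p t2 e2.
have y1 := py_lin c p t1 e1; have y2 := py_lin c p t2 e2.
rewrite /Jf; case: i => -[|[|[|[|[|//]]]]] /= _ //; rewrite /ym /=.
- rewrite -[px (fm1 (form_lin _ _ _)) p]/(px (fun q => fm1 th q + c * fm1 eta q) p) x1.
  rewrite /form_lin /fm2 /= -/(fm2 th p) -/(fm2 eta p).
  by move: (px _ _) (px _ _) => s t; ring.
- rewrite -[py (fm1 (form_lin _ _ _)) p]/(py (fun q => fm1 th q + c * fm1 eta q) p) y1.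
  rewrite -[px (fm2 (form_lin _ _ _)) p]/(px (fun q => fm2 th q + c * fm2 eta q) p) x2.
  rewrite /form_lin /fm1 /= -/(fm1 th p) -/(fm1 eta p).
  by move: (px _ _) (px _ _) (py _ _) (py _ _) => s t s' t'; ring.
- rewrite -[py (fm2 (form_lin _ _ _)) p]/(py (fun q => fm2 th q + c * fm2 eta q) p) y2.
  rewrite /form_lin /fm2 /= -/(fm2 th p) -/(fm2 eta p).
  by move: (py _ _) (py _ _) => s t; ring.
Qed.

Lemma dstar0_lin c v w : L2form v -> L2form w -> weak_dstar0 v -> weak_dstar0 w ->
  weak_dstar0 (form_lin c v w).
Proof.
have aux (x1 x2 y1 y2 : R) : x1 + y1 = 0 -> x2 + y2 = 0 -> x1 + c * x2 + (y1 + c * y2) = 0.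
  by move=> h1 h2; rewrite addrACA -mulrDr h1 h2 mulr0 addr0.
move=> v2 w2 /(weak_dstar0P v2) hv /(weak_dstar0P w2) hw.
apply/weak_dstar0P; first exact: L2form_lin.
move=> phi tp; have x2 := tf_L2 (tf_px tp); have y2 := tf_L2 (tf_py tp).
have e1 : ip (fm1 (form_lin c v w)) (px phi) = _ := ip_lin (fun p _ => erefl) v2.1 w2.1 x2.
have e2 : ip (fm2 (form_lin c v w)) (py phi) = _ := ip_lin (fun p _ => erefl) v2.2 w2.2 y2.
exact: etrans (f_equal2 +%R e1 e2) (aux _ _ _ _ (hv phi tp) (hw phi tp)).
Qed.

Lemma Vtilde_lin a c v w : 0 < a -> Vtilde a v -> Vtilde a w -> Vtilde a (form_lin c v w).
Proof.
move=> a0 [Hv dv] [Hw dw]; have id th : test_form th -> test_form th by [].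
have [D [v2 wD d3 [th [tt tc]]]] := (closureP v a0 id).1 Hv.
have [E [w2 wE e3 [et [te ec]]]] := (closureP w a0 id).1 Hw.
split; last exact: dstar0_lin.
apply/closureP => //; exists (sym_lin c D E).
have l2 := L2form_lin c v2 w2; have l3 := L2D3_lin c d3 e3.
split => //.
  apply/(weakDP l2 l3) => psi tp; apply: weakD_lin => //.
    exact: (weakDP v2 d3).1 wD psi tp.
  exact: (weakDP w2 e3).1 wE psi tp.
exists (fun n => form_lin c (th n) (et n)); split; first by move=> n; exact: tf_form_lin.
move=> i; have J1 n : L2fun (Jf a (th n) (Def_smooth (th n)) i).
  by apply: Jf_L2; [exact: tf_form_L2|exact: tf_Def_L2].
have J2 n : L2fun (Jf a (et n) (Def_smooth (et n)) i).
  by apply: Jf_L2; [exact: tf_form_L2|exact: tf_Def_L2].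
apply: L2cvg_eq (L2cvg_lin c J1 J2 (Jf_L2 a i v2 d3) (Jf_L2 a i w2 e3) (tc i) (ec i)) => [n p _|p _].
  by rewrite Jf_Def_lin.
by rewrite Jf_lin.
Qed.

Lemma weakD_ext u v D psi : (forall h, L2fun h -> ip (fm1 u) h = ip (fm1 v) h) ->
  (forall h, L2fun h -> ip (fm2 u) h = ip (fm2 v) h) -> test_fun psi -> weakD u D psi -> weakD v D psi.
Proof.
move=> e1 e2 tp [h1 h2 h3].
have y2 := tf_L2 (tf_yd tp); have px2 := tf_L2 (tf_px tp); have py2 := tf_L2 (tf_py tp).
by split; [rewrite -(e2 _ y2) -(e1 _ px2)|rewrite -(e1 _ y2) -(e1 _ py2) -(e2 _ px2)|rewrite -(e2 _ y2) -(e2 _ py2)].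
Qed.

Lemma L2cvg_null (F : nat -> R * R -> R) f g : (forall n, L2fun (F n)) -> L2fun f -> L2fun g ->
  nsq (fun p => f p - g p) = 0 -> L2cvg F f -> L2cvg F g.
Proof.
move=> F2 f2 g2 fg Ff.
apply: (@cvg0_le _ _ (fun n => 2 * nsq (fun p => F n p - f p))) => [n|].
  rewrite nsq_ge0 /=; rewrite (@eq_nsq _ _ (fun p => (F n p - f p) + (f p - g p))); last first.
    by move=> p _; rewrite addrA subrK.
  by apply: le_trans (nsqD_le (L2B (F2 n) f2) (L2B f2 g2)) _; rewrite fg mulr0 addr0.
by rewrite -(mulr0 2); apply: cvgM => //; exact: cvg_cst.
Qed.

(** The closure does not distinguish forms that agree almost everywhere: the same tensor and the
    same approximating sequence serve for both. *)
Lemma closure_null a (S : set (oneform R)) u v : 0 < a -> (forall th, S th -> test_form th) ->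
  L2form v -> nsq (fun p => fm1 u p - fm1 v p) = 0 -> nsq (fun p => fm2 u p - fm2 v p) = 0 ->
  H1_closure a S u -> H1_closure a S v.
Proof.
move=> a0 St v2 n1 n2 Hu; have [D [u2 wD d3 [th [Sth tc]]]] := (closureP u a0 St).1 Hu.
apply/closureP => //; exists D; split => //.
  apply/(weakDP v2 d3) => psi tp; apply: weakD_ext tp ((weakDP u2 d3).1 wD psi tp) => h h2.
    apply/eqP; rewrite -subr_eq0 -(ipBl u2.1 v2.1 h2); apply/eqP.
    exact: nsq0_ip (L2B u2.1 v2.1) h2 n1.
  apply/eqP; rewrite -subr_eq0 -(ipBl u2.2 v2.2 h2); apply/eqP.
  exact: nsq0_ip (L2B u2.2 v2.2) h2 n2.
exists th; split => // i.
have J n : L2fun (Jf a (th n) (Def_smooth (th n)) i).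
  by apply: Jf_L2; [exact: tf_form_L2 (St _ (Sth n))|exact: tf_Def_L2 (St _ (Sth n))].
apply: (L2cvg_null J (Jf_L2 a i u2 d3) (Jf_L2 a i v2 d3) _ (tc i)).
have z : nsq (fun p : R * R => 0 : R) = 0.
  by rewrite -[RHS](I0 R); apply: eq_I => p _; rewrite expr0n.
move: i {tc J} => [[|[|[|[|[|//]]]]] Hi] /=; first exact n1; first exact n2;
  by rewrite /Jf /= -[RHS]z; apply: eq_nsq => p _; rewrite subrr.
Qed.

Lemma null_ext f g : (forall p, Hp p -> f p = g p) -> nsq (fun p => f p - g p) = 0.
Proof. by move=> E; rewrite -[RHS](I0 R); apply: eq_I => p Hpp; rewrite E// subrr expr0n. Qed.

(** The sum [v + w] agrees with [u] on the half-plane only, so its properties are transferred to [u]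
    through [closure_null]. *)
Lemma Vbb_Vtilde a u : 0 < a -> Vbb a u -> Vtilde a u.
Proof.
move=> a0 [v [w [Vv [[F [hF [w2 wE]]] uE]]]].
have [s cl co] := dfun_CR a0 hF; rewrite -wE in s cl co w2.
have Vw : Vtilde a w.
  split; first exact: CR_H10. 
  exact: CR_dstar0.
have [Hl dl] := Vtilde_lin 1 a0 (Vbold_Vtilde a0 Vv) Vw.
have l2 : L2form (form_lin 1 v w) by case: Hl.
have e1 p : Hp p -> fm1 (form_lin 1 v w) p = fm1 u p.
  by move=> Hpp; rewrite /fm1 uE// /form_lin /= mul1r.
have e2 p : Hp p -> fm2 (form_lin 1 v w) p = fm2 u p.
  by move=> Hpp; rewrite /fm2 uE// /form_lin /= mul1r.
have u2 : L2form u by case: l2 => h1 h2; split; [exact: eq_L2 e1 h1|exact: eq_L2 e2 h2].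
split; first exact: (closure_null a0 _ u2 (null_ext e1) (null_ext e2) Hl).
apply/(weak_dstar0P u2) => phi tp; have := (weak_dstar0P l2).1 dl phi tp.
by rewrite (eq_ip e1 (fun p _ => erefl)) (eq_ip e2 (fun p _ => erefl)).
Qed.

End Linearity.

(** * Orthogonal decomposition of a coclosed form *)

Section Converse.
Variable R : realType.
Implicit Types (f g h psi : R * R -> R) (p q : R * R) (u v w th eta : oneform R) (D E : sym2 R) (a c : R).

Lemma tf_clairaut psi : test_fun psi -> px (py psi) = py (px psi).
Proof.
move=> tp; apply/funext => p; have [Hpp|np] := pselect (Hp p).
  exact: (clairaut (tp.1 2%N) Hpp).
by rewrite (tf_off (tf_px (tf_py tp)) np) (tf_off (tf_py (tf_px tp)) np).
Qed.

Definition rot psi : oneform R := fun p => (py psi p, - px psi p).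

Lemma rot_sigma a psi : test_fun psi -> Lc_sigma a (rot psi).
Proof.
move=> tp; split; first by split; [exact: tf_py|exact: tfN (tf_px tp)].
move=> p _; rewrite /dstar_smooth -[px (fm1 (rot psi)) p]/(px (py psi) p).
have -> : py (fm2 (rot psi)) p = - py (px psi) p := py_val (dYN (tf_dY p (tf_px tp))).
by rewrite (tf_clairaut tp) subrr mulr0.
Qed.

Lemma sigma_lin a c th eta : Lc_sigma a th -> Lc_sigma a eta -> Lc_sigma a (form_lin c th eta).
Proof.
move=> [tt td] [te ed]; split; first exact: tf_form_lin.
move=> p Hpp; have h1 := td p Hpp; have h2 := ed p Hpp.
case: tt te => [t1 t2] [e1 e2].
have x1 : px (fm1 (form_lin c th eta)) p = _ := px_lin c p t1 e1.
have y2 : py (fm2 (form_lin c th eta)) p = _ := py_lin c p t2 e2.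
rewrite /dstar_smooth x1 y2.
transitivity (dstar_smooth a th p + c * dstar_smooth a eta p); last by rewrite h1 h2 mulr0 addr0.
rewrite /dstar_smooth; move: (px _ p) (px _ p) (py _ p) (py _ p) => s1 s2 s3 s4; ring.
Qed.

Let zero : oneform R := fun=> (0, 0).

Lemma sigma0 a : Lc_sigma a zero.
Proof.
split; first by split; exact: tf0.
move=> p _; rewrite /dstar_smooth.
have -> : px (fm1 zero) p = 0 := px_val (dX_cst 0 p).
have -> : py (fm2 zero) p = 0 := py_val (dY_cst 0 p).
by rewrite addr0 mulr0.
Qed.

Lemma Jf0 a i p : Jf a zero (Def_smooth zero) i p = 0.
Proof.
have x1 : px (fm1 zero) p = 0 := px_val (dX_cst 0 p).
have x2 : px (fm2 zero) p = 0 := px_val (dX_cst 0 p).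
have y1 : py (fm1 zero) p = 0 := py_val (dY_cst 0 p).
have y2 : py (fm2 zero) p = 0 := py_val (dY_cst 0 p).
rewrite /Jf; case: i => -[|[|[|[|[|//]]]]] /= _ //; rewrite /ym /=.
- by rewrite x1 mul0r subr0 !mulr0.
- by rewrite x2 y1 addr0 !mul0r addr0 !mulr0.
- by rewrite y2 mul0r addr0 !mulr0.
Qed.

Lemma sqrt2a a : 0 < a -> Num.sqrt 2 * a != 0.
Proof. by move=> a0; rewrite gt_eqF// mulr_gt0// sqrtr_gt0. Qed.

(** The projection takes place in the fivefold power of [L^2], where its limit is just five
    functions; dividing by the weights of [Jf] turns them into a form and a tensor. That the tensor
    is the weak deformation of the form is the matter of [weakD_lim]. *)
Lemma proj_sigma a u Du : 0 < a -> L2form u -> L2D3 Du -> exists v D (th : nat -> oneform R),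
  [/\ L2form v, L2D3 D, forall n, Lc_sigma a (th n),
    forall i, L2cvg (fun n => Jf a (th n) (Def_smooth (th n)) i) (Jf a v D i) &
    forall eta, Lc_sigma a eta -> vip (Jf a (form_lin (-1) u v) (sym_lin (-1) Du D))
      (Jf a eta (Def_smooth eta)) = 0].
Proof.
move=> a0 u2 d3; have k0 := sqrt2a a0; set k := Num.sqrt 2 * a in k0.
have a20 : 2 * a != 0 by rewrite gt_eqF// mulr_gt0.
pose S (s : 'I_5 -> R * R -> R) := exists eta, Lc_sigma a eta /\
  forall i p, Hp p -> s i p = Jf a eta (Def_smooth eta) i p.
have JL eta i : Lc_sigma a eta -> L2fun (Jf a eta (Def_smooth eta) i).
  by move=> [te _]; apply: Jf_L2; [exact: tf_form_L2|exact: tf_Def_L2].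
have S2 s : S s -> forall i, L2fun (s i).
  by move=> [eta [Le E]] i; apply: eq_L2 (JL eta i Le) => p Hpp; rewrite E.
have S0 : S (fun _ _ => 0).
  by exists zero; split; [exact: sigma0|move=> i p _; rewrite Jf0].
have SD s t c : S s -> S t -> S (fun i p => s i p + c * t i p).
  move=> [th [Lt Et]] [eta [Le Ee]]; exists (form_lin c th eta); split; first exact: sigma_lin.
  by move=> i p Hpp; rewrite Jf_Def_lin ?Et ?Ee//; [case: Lt|case: Le].
have [V [V2 [s [Ss sV]] orth]] := projection (fun i => Jf_L2 a i u2 d3) S2 S0 SD.
have /choice [th thP] := Ss.
pose o i (H : (i < 5)%N) := @Ordinal 5 i H.
pose v : oneform R := fun p => (V (o 0%N isT) p, V (o 1%N isT) p).
(* The weights of [Jf] are undone: [yd] inverts [ym], and the constants are those of the three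
   tensor coordinates. *)
pose D := Sym2 (fun p => k^-1 * yd (V (o 2%N isT)) p) (fun p => (2 * a)^-1 * yd (V (o 3%N isT)) p)
  (fun p => k^-1 * yd (V (o 4%N isT)) p).
have ymk x f p : Hp p -> ym (fun q => x * yd f q) p = x * f p.
  by move=> Hpp; rewrite /ym mulrCA -[p.2 * yd f p]/(ym (yd f) p) ym_yd.
have VJ i p : Hp p -> Jf a v D i p = V i p.
  move=> Hpp; rewrite /Jf; case: i => -[|[|[|[|[|//]]]]] Hi /=.
  - by congr (V _ p); exact: val_inj.
  - by congr (V _ p); exact: val_inj.
  - by rewrite ymk// mulrA mulfV// mul1r; congr (V _ p); exact: val_inj.
  - by rewrite ymk// mulrA mulfV// mul1r; congr (V _ p); exact: val_inj.
  - by rewrite ymk// mulrA mulfV// mul1r; congr (V _ p); exact: val_inj.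
have v2 : L2form v by split; [exact: (V2 (o 0%N isT))|exact: (V2 (o 1%N isT))].
have D3 : L2D3 D.
  split.
  - by apply: eq_L2 (L2Z k^-1 (V2 (o 2%N isT))) => p Hpp; rewrite ymk.
  - by apply: eq_L2 (L2Z (2 * a)^-1 (V2 (o 3%N isT))) => p Hpp; rewrite ymk.
  - by apply: eq_L2 (L2Z k^-1 (V2 (o 4%N isT))) => p Hpp; rewrite ymk.
exists v, D, th; split => //.
- by move=> n; case: (thP n).
- move=> i; apply: L2cvg_eq (sV i) => [n p Hpp|p Hpp]; last by rewrite VJ.
  by case: (thP n) => _ ->.
- move=> eta Le; rewrite -(orth (Jf a eta (Def_smooth eta))); last by exists eta; split.
  apply: eq_bigr => i _; apply: eq_ip => // p Hpp.
  by rewrite Jf_lin VJ// mulN1r.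
Qed.

(** Polarization of [H1n], so this is the [H^1] inner product: the squared weights of [Jf] are
    [2 a^2] on the diagonal entries and [4 a^2] on the off-diagonal one, which counts twice. *)
Lemma vip_Jf a u D v E : L2form u -> L2D3 D -> L2form v -> L2D3 E ->
  vip (Jf a u D) (Jf a v E) = ip (fm1 u) (fm1 v) + ip (fm2 u) (fm2 v) +
    2 * a ^+ 2 * (ip (ym (s11 D)) (ym (s11 E)) + 2 * ip (ym (s12 D)) (ym (s12 E)) +
      ip (ym (s22 D)) (ym (s22 E))).
Proof.
move=> [u1 u2] [d1 d2 d3] [v1 v2] [e1 e2 e3].
have ipk x f g : L2fun f -> L2fun g -> ip (fun p => x * f p) (fun p => x * g p) = x ^+ 2 * ip f g.
  move=> f2 g2; rewrite (ipZl x f2 (L2Z x g2)) ipC (ipZl x g2 f2) ipC.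
  by rewrite mulrA expr2.
rewrite /vip sum5 /Jf /= ipk// ipk// ipk//.
have -> : (Num.sqrt 2 * a) ^+ 2 = 2 * a ^+ 2 by rewrite exprMn sqr_sqrtr.
move: (ip _ _) (ip _ _) (ip _ _) (ip _ _) (ip _ _) => x1 x2 x3 x4 x5; ring.
Qed.

(** Linear relations pass to limits; those with three terms use the coefficient 0 and repeat a
    sequence. *)
Lemma lim_lin4 (x y z t : nat -> R) (X Y Z T b1 b2 b3 b4 : R) :
  x n @[n --> \oo] --> X -> y n @[n --> \oo] --> Y ->
  z n @[n --> \oo] --> Z -> t n @[n --> \oo] --> T ->
  (forall n, b1 * x n + b2 * y n + b3 * z n + b4 * t n = 0) ->
  b1 * X + b2 * Y + b3 * Z + b4 * T = 0.
Proof.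
move=> hx hy hz ht H.
have l (r : nat -> R) L b : r n @[n --> \oo] --> L -> (fun n => b * r n) @ \oo --> b * L.
  by move=> h; apply: cvgM => //; exact: cvg_cst.
have h : (fun n => b1 * x n + b2 * y n + b3 * z n + b4 * t n) @ \oo --> b1 * X + b2 * Y + b3 * Z + b4 * T.
  by do 3 (apply: cvgD; last exact: l); exact: l.
have h0 : (fun n => b1 * x n + b2 * y n + b3 * z n + b4 * t n) @ \oo --> (0 : R).
  by rewrite (_ : (fun n => _) = fun=> 0); [exact: cvg_cst|apply/funext => n].
by rewrite -(cvg_lim (@Rhausdorff R) h) (cvg_lim (@Rhausdorff R) h0).
Qed.

Lemma Jf_cvg a (th : nat -> oneform R) v D : 0 < a -> L2form v -> L2D3 D ->
  (forall n, test_form (th n)) ->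
  (forall i, L2cvg (fun n => Jf a (th n) (Def_smooth (th n)) i) (Jf a v D i)) ->
  [/\ L2cvg (fun n => ym (s11 (Def_smooth (th n)))) (ym (s11 D)),
   L2cvg (fun n => ym (s12 (Def_smooth (th n)))) (ym (s12 D)) &
   L2cvg (fun n => ym (s22 (Def_smooth (th n)))) (ym (s22 D))].
Proof.
move=> a0 v2 d3 tt tc; have k0 := sqrt2a a0.
have a20 : 2 * a != 0 by rewrite gt_eqF// mulr_gt0.
have J2 i n : L2fun (Jf a (th n) (Def_smooth (th n)) i).
  by apply: Jf_L2; [exact: tf_form_L2|exact: tf_Def_L2].
have key k (F : nat -> R * R -> R) f : k != 0 -> (forall n, L2fun (fun p => k * F n p)) ->
    L2fun (fun p => k * f p) -> L2cvg (fun n p => k * F n p) (fun p => k * f p) -> L2cvg F f.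
  move=> kn F2 f2 /(L2cvgZ k^-1 F2 f2).
  by apply: L2cvg_eq => [n p _|p _]; rewrite mulrA mulVf// mul1r.
split.
- exact (key _ (fun n => ym (s11 (Def_smooth (th n)))) (ym (s11 D)) k0 (J2 (@Ordinal 5 2 isT))
    (Jf_L2 a (@Ordinal 5 2 isT) v2 d3) (tc (@Ordinal 5 2 isT))).
- exact (key _ (fun n => ym (s12 (Def_smooth (th n)))) (ym (s12 D)) a20 (J2 (@Ordinal 5 3 isT))
    (Jf_L2 a (@Ordinal 5 3 isT) v2 d3) (tc (@Ordinal 5 3 isT))).
- exact (key _ (fun n => ym (s22 (Def_smooth (th n)))) (ym (s22 D)) k0 (J2 (@Ordinal 5 4 isT))
    (Jf_L2 a (@Ordinal 5 4 isT) v2 d3) (tc (@Ordinal 5 4 isT))).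
Qed.

(** The weak deformation is a closed operator, since its defining equations are pairings with fixed
    [L^2] functions. *)
Lemma weakD_lim a (th : nat -> oneform R) v D psi : 0 < a -> L2form v -> L2D3 D ->
  (forall n, test_form (th n)) ->
  (forall i, L2cvg (fun n => Jf a (th n) (Def_smooth (th n)) i) (Jf a v D i)) ->
  test_fun psi -> weakD v D psi.
Proof.
have A1 (x y z : R) : 1 * x + 1 * y + 1 * z + 0 * z = 0 <-> x + y = - z by split => h; lra.
have A2 (x y z : R) : 1 * x + (-1) * y + 1 * z + 0 * z = 0 <-> x - y = - z by split => h; lra.
have A3 (x y z t : R) : 1 * x + (-1) * y + 2^-1 * z + 2^-1 * t = 0 <-> x - y = - (z + t) / 2.
  by split => h; lra.
move=> a0 v2 d3 tt tc tp; have [c1 c2 c3] := Jf_cvg a0 v2 d3 tt tc.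
have t2 n := tf_form_L2 (tt n); have td n := tf_Def_L2 (tt n).
have k1 : L2cvg (fun n => fm1 (th n)) (fm1 v) := tc (@Ordinal 5 0 isT).
have k2 : L2cvg (fun n => fm2 (th n)) (fm2 v) := tc (@Ordinal 5 1 isT).
have y2 := tf_L2 (tf_yd tp); have px2 := tf_L2 (tf_px tp); have py2 := tf_L2 (tf_py tp).
have T1 n : L2fun (fm1 (th n)) by case: (t2 n).
have T2 n : L2fun (fm2 (th n)) by case: (t2 n).
have T3 n : L2fun (ym (s11 (Def_smooth (th n)))) by case: (td n).
have T4 n : L2fun (ym (s12 (Def_smooth (th n)))) by case: (td n).
have T5 n : L2fun (ym (s22 (Def_smooth (th n)))) by case: (td n).
case: (v2) (d3) => [v21 v22] [d1 d2 d3'].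
have W n : weakD (th n) (Def_smooth (th n)) psi.
  by apply: smooth_weakD tp; case: (tt n) => t1 t3; split; [exact: t1.1|exact: t3.1].
have l1 h (h2 : L2fun h) := L2cvg_ip T1 v21 h2 k1.
have l2 h (h2 : L2fun h) := L2cvg_ip T2 v22 h2 k2.
have l3 h (h2 : L2fun h) := L2cvg_ip T3 d1 h2 c1.
have l4 h (h2 : L2fun h) := L2cvg_ip T4 d2 h2 c2.
have l5 h (h2 : L2fun h) := L2cvg_ip T5 d3' h2 c3.
split.
- apply/A1; apply: (lim_lin4 (l3 _ y2) (l2 _ y2) (l1 _ px2) (l1 _ px2)) => n.
  by apply/A1; case: (W n).
- apply/A3; apply: (lim_lin4 (l4 _ y2) (l1 _ y2) (l1 _ py2) (l2 _ px2)) => n.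
  by apply/A3; case: (W n).
- apply/A2; apply: (lim_lin4 (l5 _ y2) (l2 _ y2) (l2 _ py2) (l2 _ py2)) => n.
  by apply/A2; case: (W n).
Qed.

(** The Bochner identity with its divergence and zero-order terms dropped, both being nonnegative.
    It extends the curl from test forms to their [H^1] closure. *)
Lemma curl_le a th : test_form th ->
  a ^+ 2 * nsq (ym (curl th)) <= \sum_i nsq (Jf a th (Def_smooth th) i).
Proof.
move=> tt; rewrite (H1n_Jf a (tf_form_L2 tt) (tf_Def_L2 tt)) /H1n.
have := energy_identity tt.
have := nsq_ge0 (ym (dive th)); have := nsq_ge0 (fm1 th); have := nsq_ge0 (fm2 th); have := sqr_ge0 a.
move: (nsq _) (nsq _) (nsq _) (nsq _) (nsq _) (nsq _) (nsq _) (a ^+ 2) => s1 s2 s3 s4 s5 s6 s7 b b0 h2 h1 h3 e.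
by rewrite mulrCA e; nra.
Qed.

Lemma curl_lin c th eta p : test_form th -> test_form eta ->
  curl (form_lin c th eta) p = curl th p + c * curl eta p.
Proof.
move=> [t1 t2] [e1 e2]; have x2 : px (fm2 (form_lin c th eta)) p = _ := px_lin c p t2 e2.
have y1 : py (fm1 (form_lin c th eta)) p = _ := py_lin c p t1 e1.
by rewrite /curl x2 y1; move: (px _ p) (px _ p) (py _ p) (py _ p) => s1 s2 s3 s4; ring.
Qed.

Lemma curl_ip th psi : test_form th -> test_fun psi ->
  ip (ym (curl th)) (yd psi) = ip (fm1 th) (py psi) - ip (fm2 th) (px psi).
Proof.
move=> [t1 t2] tp; have e1 := ibp_y t1.1 tp; have e2 := ibp_x t2.1 tp.
have E : ip (ym (curl th)) (yd psi) = ip (fun p => px (fm2 th) p - py (fm1 th) p) psi.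
  apply: eq_I => p Hpp; have y0 := Hp_neq0 Hpp; rewrite /ym /yd /curl.
  by move: (px _ p) (py _ p) => s t; field.
apply: etrans E _; apply: etrans (ipBl (tf_L2 (tf_px t2)) (tf_L2 (tf_py t1)) (tf_L2 tp)) _.
by rewrite e1 e2 opprK addrC.
Qed.

(** By [curl_le] the weighted curls of the approximating forms are Cauchy. Their limit [h] is [y]
    times the weak curl of [w], as integration by parts on the test forms shows in the limit. *)
Lemma curl_limit a (sg : nat -> oneform R) w D : 0 < a -> L2form w -> L2D3 D ->
  (forall n, test_form (sg n)) ->
  (forall i, L2cvg (fun n => Jf a (sg n) (Def_smooth (sg n)) i) (Jf a w D i)) ->
  exists h, [/\ L2fun h, L2cvg (fun n => ym (curl (sg n))) h &
    forall psi, test_fun psi -> ip (fm1 w) (py psi) - ip (fm2 w) (px psi) = ip h (yd psi)].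
Proof.
have aux (x y z : R) : 1 * x + (-1) * y + (-1) * z + 0 * z = 0 <-> x - y = z by split => h; lra.
move=> a0 w2 d3 ts sc; have a20 : 0 < a ^+ 2 by exact: exprn_gt0.
have J2 i n : L2fun (Jf a (sg n) (Def_smooth (sg n)) i).
  by apply: Jf_L2; [exact: tf_form_L2|exact: tf_Def_L2].
have Jw i := Jf_L2 a i w2 d3.
have C2 n : L2fun (ym (curl (sg n))) by apply: tf_L2; apply: tf_ym; exact: tf_curl.
pose r n := \sum_i nsq (fun p => Jf a (sg n) (Def_smooth (sg n)) i p - Jf a w D i p).
have r0 : r n @[n --> \oo] --> (0 : R).
  have : r n @[n --> \oo] --> \sum_(i < 5) (0 : R) by apply: cvg_sum_ord => i; exact: sc.
  by rewrite big1.
have rge n : 0 <= r n by apply: sumr_ge0 => i _; exact: nsq_ge0.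
have key n m : a ^+ 2 * nsq (fun p => ym (curl (sg n)) p - ym (curl (sg m)) p) <= 2 * r n + 2 * r m.
  have E1 : nsq (fun p => ym (curl (sg n)) p - ym (curl (sg m)) p) =
      nsq (ym (curl (form_lin (-1) (sg n) (sg m)))).
    apply: eq_nsq => p _; rewrite /ym (curl_lin _ _ (ts n) (ts m)).
    by move: (curl (sg n) p) (curl (sg m) p) => s t; ring.
  rewrite E1; apply: le_trans (curl_le a (tf_form_lin _ (ts n) (ts m))) _.
  rewrite /r !mulr_sumr -big_split /=; apply: ler_sum => i _.
  have E2 : nsq (Jf a (form_lin (-1) (sg n) (sg m)) (Def_smooth (form_lin (-1) (sg n) (sg m))) i) =
      nsq (fun p => (Jf a (sg n) (Def_smooth (sg n)) i p - Jf a w D i p) +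
        (Jf a w D i p - Jf a (sg m) (Def_smooth (sg m)) i p)).
    apply: eq_nsq => p _; rewrite (Jf_Def_lin a (-1) i p (ts n) (ts m)) mulN1r.
    by rewrite addrA subrK.
  rewrite E2; apply: le_trans (nsqD_le (L2B (J2 i n) (Jw i)) (L2B (Jw i) (J2 i m))) _.
  by rewrite lerD2l ler_pM2l// nsqBC.
have [h [h2 hc]] : exists h, L2fun h /\ L2cvg (fun n => ym (curl (sg n))) h.
  apply: L2_complete => // e e0.
  have d0 : 0 < a ^+ 2 * e / 4 by rewrite divr_gt0// mulr_gt0.
  have [N NP] := cvg0_epsE r0 d0; exists N => n m Nn Nm.
  have := NP n Nn; have := NP m Nm; rewrite !ger0_norm// => h1 h2.
  rewrite -(ltr_pM2l a20); apply: le_lt_trans (key n m) _.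
  by move: h1 h2; move: (r n) (r m) (a ^+ 2 * e) => x y z; lra.
exists h; split => // psi tp.
have k1 : L2cvg (fun n => fm1 (sg n)) (fm1 w) := sc (@Ordinal 5 0 isT).
have k2 : L2cvg (fun n => fm2 (sg n)) (fm2 w) := sc (@Ordinal 5 1 isT).
have T1 n : L2fun (fm1 (sg n)) by case: (tf_form_L2 (ts n)).
have T2 n : L2fun (fm2 (sg n)) by case: (tf_form_L2 (ts n)).
have l1 := L2cvg_ip T1 w2.1 (tf_L2 (tf_py tp)) k1.
have l2 := L2cvg_ip T2 w2.2 (tf_L2 (tf_px tp)) k2.
have l3 := L2cvg_ip C2 h2 (tf_L2 (tf_yd tp)) hc.
apply/aux; apply: (lim_lin4 l1 l2 l3 l3) => n; apply/aux.
by rewrite curl_ip.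
Qed.

Lemma ip_comb4 (u f f0 f1 f2 f3 : R * R -> R) (c1 c2 c3 : R) :
  (forall p, Hp p -> f p = f0 p + c1 * f1 p + c2 * f2 p + c3 * f3 p) ->
  L2fun u -> L2fun f0 -> L2fun f1 -> L2fun f2 -> L2fun f3 ->
  ip u f = ip u f0 + c1 * ip u f1 + c2 * ip u f2 + c3 * ip u f3.
Proof.
move=> E u2 l0 l1 l2 l3.
have h1 := L2D l0 (L2Z c1 l1); have h2 := L2D h1 (L2Z c2 l2).
rewrite !(ipC u) (ip_lin (c := c3) E h2 l3 u2) (ip_lin (c := c2) (fun p _ => erefl) h1 l2 u2).
by rewrite (ip_lin (c := c1) (fun p _ => erefl) l0 l1 u2).
Qed.

(** With [a^2 y^2 lap] the Laplace-Beltrami operator, this is [(1 + 2 a^2) psi] minus the Laplacian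
    of [psi]. Against coclosed test forms the [H^1] inner product amounts to [1 + 2 a^2 + d^* d],
    which acts in this way on the stream function of [rot psi]. *)
Definition EL a psi p : R := (1 + 2 * a ^+ 2) * psi p + (- a ^+ 2) * ym (ym (lap psi)) p.

Lemma tf_EL a psi : test_fun psi -> test_fun (EL a psi).
Proof. by move=> tp; apply: tfD; apply: tfZ => //; do 2 apply: tf_ym; exact: tf_lap. Qed.

Lemma dX_ym f p l : dX f p l -> dX (ym f) p (p.2 * l).
Proof. by move=> h; apply: dX_eq (dXM (dX_snd p) h) _; rewrite mul0r add0r. Qed.

Lemma dY_ym f p l : dY f p l -> dY (ym f) p (f p + p.2 * l).
Proof. by move=> h; apply: dY_eq (dYM (dY_snd p) h) _; rewrite mul1r. Qed.

Lemma ip_yd_ym f g : ip f (yd (ym g)) = ip f g.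
Proof. by apply: eq_ip => // p; exact: yd_ym. Qed.

Lemma ipNr f g : L2fun f -> L2fun g -> ip f (fun p => - g p) = - ip f g.
Proof. by move=> f2 g2; rewrite ipC ipNl// ipC. Qed.

(** [P1], [P2], [A], [B], [C] stand for [psi_x], [psi_y], [psi_xy], [psi_xx], [psi_yy]. The
    right-hand side collects what the weak deformation equations pair with the first component of
    [w]; [EL_dX] does so for the second. *)
Lemma EL_dY a (psi P1 P2 A B C : R * R -> R) p (b c : R) :
  dY psi p (P2 p) -> dY P2 p (C p) -> dY B p b -> dY C p c -> dX A p b -> dX P1 p (B p) ->
  py (fun q => (1 + 2 * a ^+ 2) * psi q + (- a ^+ 2) * ym (ym (fun r => B r + C r)) q) p =
  P2 p + (- 2 * a ^+ 2) * px (ym (fun q => ym A q + P1 q)) p +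
    (4 * a ^+ 2) * (ym (fun q => (C q - B q) / 2) p + P2 p) +
    (- 2 * a ^+ 2) * py (ym (fun q => ym (fun r => (C r - B r) / 2) q + P2 q)) p.
Proof.
move=> yp yP yB yC xA xP.
rewrite (px_val (dX_ym (dXD (dX_ym xA) xP))).
rewrite (py_val (dYD (dYZ (1 + 2 * a ^+ 2) yp) (dYZ (- a ^+ 2) (dY_ym (dY_ym (dYD yB yC)))))).
rewrite (py_val (dY_ym (dYD (dY_ym (dYM (dYB yC yB) (dY_cst 2^-1 p))) yP))).
by rewrite /ym; field.
Qed.

Lemma EL_dX a (psi P1 P2 A B C : R * R -> R) p (b c : R) :
  dX psi p (P1 p) -> dY A p c -> dX B p b -> dX C p c -> dX P2 p (A p) -> dY P1 p (A p) ->
  px (fun q => (1 + 2 * a ^+ 2) * psi q + (- a ^+ 2) * ym (ym (fun r => B r + C r)) q) p =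
  P1 p + (4 * a ^+ 2) * (ym A p + P1 p) +
    (2 * a ^+ 2) * px (ym (fun q => ym (fun r => (C r - B r) / 2) q + P2 q)) p +
    (- 2 * a ^+ 2) * py (ym (fun q => ym A q + P1 q)) p.
Proof.
move=> xp yA xB xC xP yP.
rewrite (py_val (dY_ym (dYD (dY_ym yA) yP))).
rewrite (px_val (dXD (dXZ (1 + 2 * a ^+ 2) xp) (dXZ (- a ^+ 2) (dX_ym (dX_ym (dXD xB xC)))))).
rewrite (px_val (dX_ym (dXD (dX_ym (dXM (dXB xC xB) (dX_cst 2^-1 p))) xP))).
by rewrite /ym; field.
Qed.

(* [EL a psi] is chosen so that integrating the orthogonality relation with
   [rot psi] by parts leaves the curl of [w] tested against [EL a psi]. *)
Lemma euler_lagrange a w D : 0 < a -> L2form w -> L2D3 D ->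
  (forall psi, test_fun psi -> weakD w D psi) ->
  (forall eta, Lc_sigma a eta -> vip (Jf a w D) (Jf a eta (Def_smooth eta)) = 0) ->
  forall psi, test_fun psi -> ip (fm1 w) (py (EL a psi)) - ip (fm2 w) (px (EL a psi)) = 0.
Proof.
move=> a0 w2 d3 wD orth psi tp.
have t1 := tf_px tp; have t2 := tf_py tp.
have tA := tf_py t1; have tB := tf_px t1; have tC := tf_py t2.
(* The weighted deformation of [rot psi] has entries [e1], [e2] and [- e1]: it is trace-free because
   [rot psi] is coclosed. *)
pose e1 p := ym (py (px psi)) p + px psi p.
pose e2 p := ym (fun q => (py (py psi) q - px (px psi) q) / 2) p + py psi p.
have tBC : test_fun (fun q => (py (py psi) q - px (px psi) q) / 2).
  by apply: tf_eq (tfZ 2^-1 (tfB tC tB)) => q; rewrite mulrC.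
have te1 : test_fun e1 by apply: tfD => //; exact: tf_ym.
have te2 : test_fun e2 by apply: tfD => //; exact: tf_ym.
have xy := tf_clairaut tp.
have E1 p : Hp p -> ym (s11 (Def_smooth (rot psi))) p = e1 p.
  move=> /Hp_neq0 y0; rewrite /e1 /ym /= -[px (fm1 (rot psi)) p]/(px (py psi) p) xy.
  rewrite -[fm2 (rot psi) p]/(- px psi p); move: (py _ p) (px _ p) => s t; by field.
have E2 p : Hp p -> ym (s12 (Def_smooth (rot psi))) p = e2 p.
  move=> /Hp_neq0 y0; rewrite /e2 /ym /= -[py (fm1 (rot psi)) p]/(py (py psi) p).
  have -> : px (fm2 (rot psi)) p = - px (px psi) p := px_val (dXN (tf_dX p t1)).
  rewrite -[fm1 (rot psi) p]/(py psi p); move: (py (py psi) p) (px (px psi) p) (py psi p) => s t r; by field.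
have E3 p : Hp p -> ym (s22 (Def_smooth (rot psi))) p = (-1) * e1 p.
  move=> /Hp_neq0 y0; rewrite /e1 /ym /=.
  have -> : py (fm2 (rot psi)) p = - py (px psi) p := py_val (dYN (tf_dY p t1)).
  rewrite -[fm2 (rot psi) p]/(- px psi p); move: (py _ p) (px _ p) => s t; by field.
have Lr := rot_sigma a tp; have := orth _ Lr.
rewrite (vip_Jf a w2 d3 (tf_form_L2 Lr.1) (tf_Def_L2 Lr.1)).
have [W1 _ W3] := wD _ (tf_ym te1); have [_ W2 _] := wD _ (tf_ym te2).
case: (w2) (d3) => [w1 w2'] [d1 d2 d3'].
have le1 := tf_L2 te1; have le2 := tf_L2 te2.
rewrite !ip_yd_ym in W1 W2 W3.
have F1 : ip (ym (s11 D)) (ym (s11 (Def_smooth (rot psi)))) = ip (ym (s11 D)) e1 := eq_ip (fun p _ => erefl) E1.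
have F2 : ip (ym (s12 D)) (ym (s12 (Def_smooth (rot psi)))) = ip (ym (s12 D)) e2 := eq_ip (fun p _ => erefl) E2.
have F3 : ip (ym (s22 D)) (ym (s22 (Def_smooth (rot psi)))) = - ip (ym (s22 D)) e1.
  rewrite (eq_ip (fun p _ => erefl) E3) ipC (ipZl _ le1 d3') mulN1r ipC//.
have G2 : ip (fm2 w) (fm2 (rot psi)) = - ip (fm2 w) (px psi) := ipNr w2' (tf_L2 t1).
have X p : Hp p -> py (EL a psi) p = py psi p + (- 2 * a ^+ 2) * px (ym e1) p +
    (4 * a ^+ 2) * e2 p + (- 2 * a ^+ 2) * py (ym e2) p.
  move=> _; have h : dX (py (px psi)) p (py (px (px psi)) p).
    by rewrite -(tf_clairaut t1); exact: tf_dX (tf_py t1).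
  exact (@EL_dY a psi (px psi) (py psi) (py (px psi)) (px (px psi)) (py (py psi)) p _ _
    (tf_dY p tp) (tf_dY p t2) (tf_dY p tB) (tf_dY p tC) h (tf_dX p t1)).
have Y p : Hp p -> px (EL a psi) p = px psi p + (4 * a ^+ 2) * e1 p +
    (2 * a ^+ 2) * px (ym e2) p + (- 2 * a ^+ 2) * py (ym e1) p.
  move=> _; have h : dY (py (px psi)) p (px (py (py psi)) p).
    by rewrite (tf_clairaut t2) xy; exact: tf_dY tA.
  have k : dX (py psi) p (py (px psi) p) by rewrite -xy; exact: tf_dX t2.
  exact (@EL_dX a psi (px psi) (py psi) (py (px psi)) (px (px psi)) (py (py psi)) p _ _
    (tf_dX p tp) h (tf_dX p tB) (tf_dX p tC) k (tf_dY p t1)).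
have X' := ip_comb4 X w1 (tf_L2 t2) (tf_L2 (tf_px (tf_ym te1))) le2 (tf_L2 (tf_py (tf_ym te2))).
have Y' := ip_comb4 Y w2' (tf_L2 t1) le1 (tf_L2 (tf_px (tf_ym te2))) (tf_L2 (tf_py (tf_ym te1))).
have fin (x1 x2 x3 x4 y1 y2 y3 y4 z1 z2 z3 b : R) :
    z1 + y2 = - x2 -> z2 - x3 = - (x4 + y3) / 2 -> z3 - y2 = - y4 ->
    x1 + - y1 + 2 * b * (z1 + 2 * z2 + - z3) = 0 ->
    x1 + (- 2 * b) * x2 + (4 * b) * x3 + (- 2 * b) * x4 -
      (y1 + (4 * b) * y2 + (2 * b) * y3 + (- 2 * b) * y4) = 0.
  move=> q1 q2 q3 <-; have -> : z1 = - x2 - y2 by rewrite -q1 addrK.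
  have -> : z2 = - (x4 + y3) / 2 + x3 by rewrite -q2 subrK.
  have -> : z3 = - y4 + y2 by rewrite -q3 subrK.
  by field.
rewrite F1 F2 F3 G2 => H; apply: etrans (f_equal2 (fun x y => x - y) X' Y') _.
exact: fin W1 W2 W3 H.
Qed.

(** [h] annihilates [yd (EL a psi)] for every test function [psi], which is a Helmholtz equation of
    the sign treated in [helmholtz0]; its vanishing is weak closedness of [w]. *)
Lemma orthogonal_closed a (sg : nat -> oneform R) w D : 0 < a -> L2form w -> L2D3 D ->
  (forall psi, test_fun psi -> weakD w D psi) -> (forall n, test_form (sg n)) ->
  (forall i, L2cvg (fun n => Jf a (sg n) (Def_smooth (sg n)) i) (Jf a w D i)) ->
  (forall eta, Lc_sigma a eta -> vip (Jf a w D) (Jf a eta (Def_smooth eta)) = 0) ->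
  forall psi, test_fun psi -> ip (fm1 w) (py psi) = ip (fm2 w) (px psi).
Proof.
move=> a0 w2 d3 wD ts sc orth; have a20 : 0 < a ^+ 2 by exact: exprn_gt0.
have [h [h2 hc H]] := curl_limit a0 w2 d3 ts sc.
have h0 : nsq h = 0.
  (* With this constant [c0], [yd (EL a psi)] divided by [a ^ 2] is [c0 * yd psi - ym (lap psi)]. *)
  apply: (@helmholtz0 _ ((1 + 2 * a ^+ 2) / a ^+ 2) h (fun n => ym (curl (sg n)))) => //.
  - by rewrite divr_gt0// ltr_pwDl// mulr_ge0// ltW.
  - by move=> n; apply: tf_ym; exact: tf_curl.
  - move=> psi tp; have tE := tf_EL a tp.
    have e := etrans (esym (H _ tE)) (euler_lagrange a0 w2 d3 wD orth tp).
    have : a ^- 2 * ip h (yd (EL a psi)) = 0 by rewrite e mulr0.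
    have yE2 := tf_L2 (tf_yd tE).
    rewrite ipC -(ipZl _ yE2 h2) ipC => e'; rewrite -[RHS]e'; apply: eq_ip => // p Hpp.
    have y0 := Hp_neq0 Hpp; have an : a ^+ 2 != 0 by rewrite gt_eqF.
    by rewrite /yd /EL /ym; move: (lap psi p) (psi p) (p.2) (a ^+ 2) y0 an => s t y b y0 bn; field; rewrite y0 bn.
by move=> psi tp; apply/eqP; rewrite -subr_eq0 (H psi tp) (nsq0_ip h2 (tf_L2 (tf_yd tp)) h0).
Qed.

Lemma harmonic_primitive a W : smooth_form W -> closed_form W -> coclosed_form W ->
  exists2 F, Defs.harmonic a F & forall p, Hp p -> px F p = fm1 W p /\ py F p = fm2 W p.
Proof.
move=> sW cl co; have [F [FC FE]] := poincare sW cl.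
exists F => //; split => // p Hpp.
have nx : \forall q \near p, px F q = fm1 W q by apply: filterS (near_Hp Hpp) => q /FE[].
have ny : \forall q \near p, py F q = fm2 W q by apply: filterS (near_Hp Hpp) => q /FE[].
by rewrite (near_px nx) (near_py ny) co// mulr0.
Qed.

(** The residual [w] is weakly closed by orthogonality, and weakly coclosed because both [u] and its
    projection are. It also inherits an approximating sequence of test forms, as the mollification
    argument in [weyl] requires. *)
Lemma Vtilde_Vbb a u : 0 < a -> Vtilde a u -> Vbb a u.
Proof.
move=> a0 [Hu du]; have id th : test_form th -> test_form th by [].
have Lt th : Lc_sigma a th -> test_form th by case.
have [Du [u2 wDu d3 [ta [tt tc]]]] := (closureP u a0 id).1 Hu.
have [v [D [th [v2 D3 Lth thc orth]]]] := proj_sigma a0 u2 d3.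
have tth n := Lt _ (Lth n).
have wDv psi (tp : test_fun psi) := weakD_lim a0 v2 D3 tth thc tp.
have Vv : Vbold a v.
  apply/(closureP v a0 Lt); exists D; split => //; first by apply/(weakDP v2 D3).
  by exists th.
pose w := form_lin (-1) u v; pose E := sym_lin (-1) Du D.
have w2 : L2form w := L2form_lin (-1) u2 v2.
have E3 : L2D3 E := L2D3_lin (-1) d3 D3.
have wE psi (tp : test_fun psi) : weakD w E psi.
  exact: weakD_lin u2 v2 d3 D3 tp ((weakDP u2 d3).1 wDu psi tp) (wDv psi tp).
pose sg n := form_lin (-1) (ta n) (th n).
have tsg n : test_form (sg n) := tf_form_lin (-1) (tt n) (tth n).
have sgc i : L2cvg (fun n => Jf a (sg n) (Def_smooth (sg n)) i) (Jf a w E i).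
  have J1 n : L2fun (Jf a (ta n) (Def_smooth (ta n)) i).
    by apply: Jf_L2; [exact: tf_form_L2|exact: tf_Def_L2].
  have J2 n : L2fun (Jf a (th n) (Def_smooth (th n)) i).
    by apply: Jf_L2; [exact: tf_form_L2|exact: tf_Def_L2].
  apply: L2cvg_eq (L2cvg_lin (-1) J1 J2 (Jf_L2 a i u2 d3) (Jf_L2 a i v2 D3) (tc i) (thc i)) => [n p _|p _].
    by rewrite Jf_Def_lin.
  by rewrite Jf_lin.
have cl := orthogonal_closed a0 w2 E3 wE tsg sgc orth.
have dw : weak_dstar0 w := dstar0_lin (-1) u2 v2 du (Vbold_Vtilde a0 Vv).2.
have co := (weak_dstar0P w2).1 dw.
have [W [sW W2 Wcl Wco [n1 n2]]] := weyl w2 (fun n => (tsg n).1) (fun n => (tsg n).2)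
  (sgc (@Ordinal 5 0 isT)) (sgc (@Ordinal 5 1 isT)) cl co.
have [F hF FE] := harmonic_primitive a sW Wcl Wco.
have F2 : L2form (dfun F).
  by case: W2 => l1 l2; split; [apply: eq_L2 l1|apply: eq_L2 l2] => p /FE[].
(* [w] equals [dfun F] almost everywhere only. The first summand is therefore [u - dfun F] instead
   of [v], from which it differs by a null form, and the sum is exact at every point. *)
exists (form_lin (-1) u (dfun F)), (dfun F); split; last split.
- apply: (closure_null a0 Lt (L2form_lin (-1) u2 F2) _ _ Vv).
    rewrite -[RHS]n1; apply: eq_nsq => p Hpp; have [e _] := FE p Hpp.
    rewrite -[fm1 W p]e.
    rewrite -[fm1 (form_lin _ _ _) p]/(fm1 u p + -1 * px F p) -[fm1 w p]/(fm1 u p + -1 * fm1 v p).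
    by move: (px F p) (fm1 u p) (fm1 v p) => x y z; ring.
  rewrite -[RHS]n2; apply: eq_nsq => p Hpp; have [_ e] := FE p Hpp.
  rewrite -[fm2 W p]e.
  rewrite -[fm2 (form_lin _ _ _) p]/(fm2 u p + -1 * py F p) -[fm2 w p]/(fm2 u p + -1 * fm2 v p).
  by move: (py F p) (fm2 u p) (fm2 v p) => x y z; ring.
- by exists F.
- move=> p Hpp; rewrite /form_lin /dfun /fm1 /fm2 /=.
  by case: (u p) => x y /=; rewrite !mulN1r; congr (_, _); rewrite subrK.
Qed.

End Converse.

Theorem theorem1p7 (R : realType) (a : R) (ha : 0 < a) (u : oneform R) :
  Vbb a u <-> Vtilde a u.
Proof. by split; [exact: Vbb_Vtilde|exact: Vtilde_Vbb]. Qed.
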